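(* $C(\vec T)=\vec T$, and in particular $\vec T\cong\mathcal D^a(\langle e,f\mid e=ff,\ f=fe\rangle,\ e)$.
   Context: **Trees and $T$.** A full binary tree is a finite rooted plane tree in which every vertex has either $0$ children or $2$ children (a left and a right one); leaves are numbered $1,2,\dots$ from left to right. Associate $[0,1)$ with the root, and if $[a,b)$ is associated with a vertex, associate $[a,\frac{a+b}2)$ with its left child and $[\frac{a+b}2,b)$ with its right child. Given full binary trees $R,S$ with the same number $m$ of leaves and $1\le n\le m$, the triple $(R,S,n)$ represents the homeomorphism of the circle $[0,1]/(0\sim 1)$ which, for each $i$, maps the interval of leaf $i$ of $R$ affinely and increasingly onto the interval of leaf $i+n-1$ (taken mod $m$ in $\{1,\dots,m\}$) of $S$; leaf $i$ of $R$ is said to be identified with leaf $i+n-1$ of $S$. Thompson's group $T$ is the group of all homeomorphisms so represented; products are composed from left to right. A triple is reduced if there is no caret in $R$ both of whose children are leaves that are identified (left with left, right with right) with the two leaf children of a caret of $S$; every element of $T$ has a unique reduced triple. **Thompson graphs and $\vec T$.** For a full binary tree with leaves $l_1,\dots,l_m$ arranged on a horizontal line, its Thompson graph has vertices $v_1,\dots,v_m$ on that line, $v_1$ to the left of $l_1$ and $v_i$ between $l_{i-1}$ and $l_i$; for each left edge $e$ of the tree, the unique pair $v_i,v_j$ that can be joined by a path above the line crossing the tree only at $e$ is joined by an edge. (Equivalently: for each non-leaf vertex $p$, join $v_i$ to $v_j$ where $l_i$ is the leftmost leaf below the left child of $p$ and $l_j$ is the leftmost leaf below the right child of $p$.) The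 Thompson graph of $f\in T$ with reduced triple $(R,S,n)$ is obtained from the Thompson graphs of $R$ and $S$ by identifying their vertices in the same way as the leaves. $\vec T$ is the subgroup of all $f\in T$ whose Thompson graph is bipartite. It is finitely generated, by $x_0x_1,x_1x_2,x_2x_3,f_{1/2}$, where $x_0(t)=2t$ on $[0,\frac14)$, $t+\frac14$ on $[\frac14,\frac12)$, $\frac12t+\frac12$ on $[\frac12,1)$; $x_n(t)=t$ on $[0,\frac12]$ and $x_n(t)=\frac{x_{n-1}(2t-1)+1}{2}$ on $(\frac12,1]$ for $n\ge 1$; $f_{1/2}(t)=t+\frac12\bmod 1$. **Core and $C(H)$.** The diagram of a triple $(R,S,n)$ is the directed graph obtained by directing all edges of $R$ and $S$ away from the roots, labeling left edges $0$ and right edges $1$, and identifying the leaves of $R$ and $S$ as prescribed by $n$; the reduced diagram of $x\in T$ comes from its reduced triple. The core of a finitely generated subgroup $H=\langle y_1,\dots,y_k\rangle\le T$ is the labeled directed graph obtained from the reduced diagrams of $y_1,\dots,y_k$ by identifying all roots of all trees to one vertex (the root of the core) and then repeating as long as possible: (1) if two vertices are identified, identify their left children and left edges, and their right children and right edges; (2) if two vertices have their left children identified and their right children identified, identify the two vertices (with the corresponding edges). An element $x\in T$ is accepted by the core if there is a homomorphism of labeled directed graphs from the reduced diagram of $x$ to the core sending both roots to the root of the core. $C(H)$ is the set of elements of $T$ accepted by the core of $H$. **Annular diagram groups.** Let $\mathcal P=\langle X\mid \mathcal R\rangle$ be a semigroup presentation and $u$ a non-empty word over $X$. An annular $(u,u)$-diagram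 over $\mathcal P$ is a finite labeled oriented graph on an annulus obtained as follows: start with an oriented closed path (the outer path) with a distinguished outer vertex from which its label reads $u$; finitely many times, choose a directed subpath of the current inner boundary cycle (possibly the whole cycle read from some vertex) labeled $r$, where $r=s$ or $s=r$ is a relation in $\mathcal R$, and attach on the inside a cell whose outer path is that subpath and whose inner path is a new directed path labeled $s$ with the same endpoints, which replaces the subpath in the inner boundary; finally the inner boundary (the inner path) must read $u$ from a distinguished inner vertex. Diagrams are considered up to isomorphism of labeled complexes preserving the outer and inner paths and distinguished vertices. A dipole is a pair of cells $\Delta_1,\Delta_2$ such that the inner path of $\Delta_1$ is the outer path of $\Delta_2$ and the label of the outer path of $\Delta_1$ equals the label of the inner path of $\Delta_2$; it is removed by deleting both cells and identifying the outer path of $\Delta_1$ with the inner path of $\Delta_2$. $\mathcal D^a(\mathcal P,u)$ is the group of annular $(u,u)$-diagrams modulo insertion and removal of dipoles, with multiplication given by identifying the inner path (and inner vertex) of one diagram with the outer path (and outer vertex) of the other. *)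

(* Defs.v *)
From mathcomp Require Import all_boot all_order all_algebra.
From mathcomp Require Import boolp classical_sets reals ring lra.
From Stdlib Require Import Relation_Operators.

Set Implicit Arguments.
Unset Strict Implicit.
Unset Printing Implicit Defensive.

Import Order.TTheory GRing.Theory Num.Theory.
Local Open Scope classical_set_scope.
Local Open Scope ring_scope.

(** * Trees and Thompson's group T *)

Inductive tree := Leaf | Node of tree & tree.

(* A vertex of a tree is the word of turns leading to it from the root
   (false = left, true = right). *)
Fixpoint nodes (t : tree) : seq (seq bool) :=
  [::] :: if t is Node l r
          then [seq false :: p | p <- nodes l] ++ [seq true :: p | p <- nodes r]
          else [::].

(* From left to right; leaf number i (counted from 1) has index i - 1. *)
Fixpoint leaves (t : tree) : seq (seq bool) :=
  if t is Node l r
  then [seq false :: p | p <- leaves l] ++ [seq true :: p | p <- leaves r]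
  else [:: [::]].

Record triple := Triple { tdom : tree; tran : tree; tshift : nat }.

Definition wf_triple (d : triple) : Prop :=
  size (leaves (tdom d)) = size (leaves (tran d)) /\
  (1 <= tshift d <= size (leaves (tdom d)))%N.

(* [tshift d] is the n of (R, S, n): leaf i goes to leaf i + n - 1 mod m. *)
Definition leaf_image (d : triple) (i : nat) : nat :=
  ((i + (tshift d).-1) %% size (leaves (tran d)))%N.

Definition leaf_identified (d : triple) (p q : seq bool) : Prop :=
  exists i : nat, [/\ (i < size (leaves (tdom d)))%N,
    p = nth [::] (leaves (tdom d)) i &
    q = nth [::] (leaves (tran d)) (leaf_image d i)].

Definition reduced (d : triple) : Prop :=
  ~ exists p q : seq bool,
      leaf_identified d (rcons p false) (rcons q false) /\
      leaf_identified d (rcons p true) (rcons q true).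

Section ThompsonT.
Variable R : realType.

(* The circle [0, 1] / (0 ~ 1), through its representatives in [0, 1). *)
Definition circle : Type := {t : R | 0 <= t < 1}.

Fixpoint subinterval (a b : R) (p : seq bool) : R * R :=
  if p is c :: p' then
    let m := (a + b) / 2 in
    if c then subinterval m b p' else subinterval a m p'
  else (a, b).

Definition represents (d : triple) (g : circle -> circle) : Prop :=
  wf_triple d /\
  forall p q : seq bool, leaf_identified d p q ->
  let: (a, b) := subinterval 0 1 p in
  let: (c, e) := subinterval 0 1 q in
  forall t : circle, a <= val t < b ->
    val (g t) = c + (val t - a) * ((e - c) / (b - a)).

Definition thompsonT : set (circle -> circle) :=
  [set g | exists d, represents d g].

Definition reduced_triple_of (d : triple) (g : circle -> circle) : Prop :=
  reduced d /\ represents d g.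

(* Products are composed from left to right. *)
Definition lr_comp (f g : circle -> circle) : circle -> circle := g \o f.

Definition prod_on (G : set (circle -> circle)) (x y z : {g | G g}) : Prop :=
  sval z = lr_comp (sval x) (sval y).

Inductive generated (ys : seq (circle -> circle)) : set (circle -> circle) :=
| generated_id : generated ys id
| generated_in y : List.In y ys -> generated ys y
| generated_comp f g :
    generated ys f -> generated ys g -> generated ys (lr_comp f g)
| generated_inv f g :
    generated ys f -> cancel f g -> cancel g f -> generated ys g.

(** * Thompson graphs and the subgroup vecT *)

(* Edges of the Thompson graph of [t], whose vertices are identified with the
   leaves; [k] is the index of the leftmost leaf of [t]. *)
Fixpoint thompson_edges (k : nat) (t : tree) : seq (nat * nat) :=
  if t is Node l r then
    let k' := (k + size (leaves l))%N in
    (k, k') :: thompson_edges k l ++ thompson_edges k' r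
  else [::].

(* Vertex i of the graph of the first tree is merged with vertex
   [leaf_image d i] of the graph of the second one. *)
Definition thompson_adj (d : triple) (i j : nat) : Prop :=
  (i, j) \in thompson_edges 0 (tdom d) \/
  (leaf_image d i, leaf_image d j) \in thompson_edges 0 (tran d).

Definition thompson_bipartite (d : triple) : Prop :=
  exists c : nat -> bool, forall i j : nat,
    (i < size (leaves (tdom d)))%N -> (j < size (leaves (tdom d)))%N ->
    thompson_adj d i j -> c i != c j.

Definition vecT : set (circle -> circle) :=
  [set g | thompsonT g /\
           exists d, reduced_triple_of d g /\ thompson_bipartite d].

Fixpoint xfun (n : nat) (t : R) : R :=
  if n is n'.+1 then
    if t <= 1 / 2 then t else (xfun n' (2 * t - 1) + 1) / 2
  else
    if t < 1 / 4 then 2 * t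
    else if t < 1 / 2 then t + 1 / 4
    else 1 / 2 * t + 1 / 2.

Lemma xfun_circle n (t : R) : 0 <= t < 1 -> 0 <= xfun n t < 1.
Proof.
elim: n t => [|n IH] t /andP[t0 t1] /=.
  case: (ltP t (1 / 4)) => h1; first by apply/andP; split; lra.
  by case: (ltP t (1 / 2)) => h2; apply/andP; split; lra.
case: (leP t (1 / 2)) => h; first by rewrite t0 t1.
have /andP[a b] : 0 <= xfun n (2 * t - 1) < 1.
  by apply: IH; apply/andP; split; lra.
by apply/andP; split; lra.
Qed.

Definition x_ (n : nat) (t : circle) : circle :=
  exist _ (xfun n (sval t)) (xfun_circle n (svalP t)).

Definition half_turn (t : R) : R :=
  if t < 1 / 2 then t + 1 / 2 else t + 1 / 2 - 1.

Lemma half_turn_circle (t : R) : 0 <= t < 1 -> 0 <= half_turn t < 1.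
Proof.
rewrite /half_turn => /andP[t0 t1].
by case: (ltP t (1 / 2)) => h; apply/andP; split; lra.
Qed.

Definition f_half (t : circle) : circle :=
  exist _ (half_turn (sval t)) (half_turn_circle (svalP t)).

Definition vecT_gens : seq (circle -> circle) :=
  [:: lr_comp (x_ 0) (x_ 1); lr_comp (x_ 1) (x_ 2); lr_comp (x_ 2) (x_ 3);
      f_half].

End ThompsonT.

(** * Labeled directed graphs, diagrams, cores *)

(* Directed graphs with edges labeled 0 (false) and 1 (true) and some vertices
   distinguished as roots.  No graph below has two edges with the same
   label, source and target, so edges form a relation. *)
Record lgraph := LGraph {
  vert : Type;
  edge : bool -> vert -> vert -> Prop;
  root : vert -> Prop }.

Definition lgraph_hom (G H : lgraph) (h : vert G -> vert H) : Prop :=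
  (forall b u v, edge b u v -> edge b (h u) (h v)) /\
  (forall u, root u -> root (h u)).

(* The graph obtained from [G] by identifying vertices equivalent under [E]. *)
Definition quot_graph (G : lgraph) (E : vert G -> vert G -> Prop) : lgraph :=
  {| vert := {A : set (vert G) | exists u, A = [set v | E u v]};
     edge := fun b A B => exists u v, [/\ sval A u, sval B v & edge b u v];
     root := fun A => exists u, sval A u /\ root u |}.

Variant coprod_edge (I : Type) (G : I -> lgraph) (b : bool) :
    {i : I & vert (G i)} -> {i : I & vert (G i)} -> Prop :=
| CoprodEdge i (u v : vert (G i)) :
    edge b u v -> coprod_edge b (existT _ i u) (existT _ i v).

Definition coprod_graph (I : Type) (G : I -> lgraph) : lgraph :=
  {| vert := {i : I & vert (G i)};
     edge := @coprod_edge I G;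
     root := fun u => root (projT2 u) |}.

(* The disjoint union of the two trees of [d]: the vertex (s, p) is the vertex
   p of the first tree if s = false, of the second tree if s = true. *)
Definition two_trees (d : triple) : lgraph :=
  {| vert := {v : bool * seq bool |
              v.2 \in nodes (if v.1 then tran d else tdom d)};
     edge := fun b u v => val v = ((val u).1, rcons (val u).2 b);
     root := fun u => (val u).2 = [::] |}.

Definition leaf_glue (d : triple) (u v : vert (two_trees d)) : Prop :=
  [/\ (val u).1 = false, (val v).1 = true &
      leaf_identified d (val u).2 (val v).2].

Definition diagram (d : triple) : lgraph :=
  quot_graph (clos_refl_sym_trans _ (@leaf_glue d)).

(* The identifications made in the construction of a core. *)
Inductive fold_eq (G : lgraph) : vert G -> vert G -> Prop :=
| fold_refl u : fold_eq u u
| fold_sym u v : fold_eq u v -> fold_eq v u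
| fold_trans u v w : fold_eq u v -> fold_eq v w -> fold_eq u w
| fold_root u v : root u -> root v -> fold_eq u v
| fold_children b u v u' v' :
    edge b u u' -> edge b v v' -> fold_eq u v -> fold_eq u' v'
| fold_parents u v u0 u1 v0 v1 :
    edge false u u0 -> edge true u u1 -> edge false v v0 -> edge true v v1 ->
    fold_eq u0 v0 -> fold_eq u1 v1 -> fold_eq u v.

Definition core (ds : seq triple) : lgraph :=
  quot_graph
    (@fold_eq (coprod_graph (fun i => diagram (tnth (in_tuple ds) i)))).

Definition accepted (ds : seq triple) (d : triple) : Prop :=
  exists h : vert (diagram d) -> vert (core ds), lgraph_hom h.

(* C(H) for H generated by [ys]; the triples in the list [ds] and [d] are
   determined by [ys] and [x]. *)
Definition closureC (R : realType) (ys : seq (circle R -> circle R)) :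
    set (circle R -> circle R) :=
  [set x | thompsonT x /\ exists (ds : seq triple) (d : triple),
     [/\ List.Forall2 (@reduced_triple_of R) ds ys,
         reduced_triple_of d x & accepted ds d]].

(** * Annular diagram groups *)

Section Annular.
Variables (X : Type) (rels : seq X -> seq X -> Prop).

(* Labeled oriented 2-complexes with an outer and an inner path.  Paths are
   sequences of edges; [outv] and [innv] are the distinguished vertices, at
   which [outp] and [innp] start. *)
Record complex := Complex {
  cV : finType; cE : finType; cC : finType;
  src : cE -> cV; tgt : cE -> cV; lab : cE -> X;
  top : cC -> seq cE; bot : cC -> seq cE;
  outp : seq cE; outv : cV;
  innp : seq cE; innv : cV }.

(* The oriented closed path with label x w, read from its outer vertex. *)
Definition cycle_complex (x : X) (w : seq X) : complex :=
  {| cV := 'I_(size w).+1; cE := 'I_(size w).+1; cC := void;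
     src := id;
     tgt := @ordS _;
     lab := tnth (in_tuple (x :: w));
     top := fun c => match c with end; bot := fun c => match c with end;
     outp := enum 'I_(size w).+1; outv := ord0;
     innp := enum 'I_(size w).+1; innv := ord0 |}.

(* The same complex, its inner path being read after skipping [i] edges. *)
Definition rot_inner (i : nat) (K : complex) : complex :=
  {| cV := cV K; cE := cE K; cC := cC K;
     src := @src K; tgt := @tgt K; lab := @lab K;
     top := @top K; bot := @bot K;
     outp := outp K; outv := outv K;
     innp := rot i (innp K);
     innv := last (innv K) [seq tgt e | e <- take i (innp K)] |}.

Section Attach.
Variables (K : complex) (p q : seq (cE K)) (s : seq X).

(* The k-th vertex of the new path with label s, 0 <= k <= size s; it has
   (size s) - 1 new vertices, and the same endpoints as p. *)
Definition new_vertex (k : nat) : (cV K + 'I_(size s).-1)%type :=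
  if k is j.+1 then
    if insub j is Some j' then inr j'
    else inl (last (innv K) [seq tgt e | e <- p])
  else inl (innv K).

(* For [innp K] = p ++ q: a cell with outer path p is attached inside. *)
Definition attach : complex :=
  {| cV := (cV K + 'I_(size s).-1)%type; cE := (cE K + 'I_(size s))%type;
     cC := option (cC K);
     src := fun e => match e with
                     | inl e' => inl (src e') | inr i => new_vertex i end;
     tgt := fun e => match e with
                     | inl e' => inl (tgt e') | inr i => new_vertex i.+1 end;
     lab := fun e => match e with
                     | inl e' => lab e' | inr i => tnth (in_tuple s) i end;
     top := fun c => map inl (if c is Some c' then top c' else p);
     bot := fun c => if c is Some c' then map inl (bot c')
                     else map inr (enum 'I_(size s));
     outp := map inl (outp K); outv := inl (outv K);
     innp := map inr (enum 'I_(size s)) ++ map inl q;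
     innv := inl (innv K) |}.

End Attach.

(* Since the inner path can be rotated, any directed subpath of the inner
   boundary cycle may be taken as the initial segment p. *)
Inductive built (u : seq X) : complex -> Prop :=
| built_cycle x w : u = x :: w -> built u (cycle_complex x w)
| built_rot i K : built u K -> built u (rot_inner i K)
| built_attach K (p q : seq (cE K)) (r s : seq X) :
    built u K -> innp K = p ++ q -> map (@lab K) p = r ->
    rels r s \/ rels s r -> built u (attach p q s).

Definition annular (u : seq X) (K : complex) : Prop :=
  built u K /\ map (@lab K) (innp K) = u.

Definition complex_iso (K L : complex) : Prop :=
  exists (fV : cV K -> cV L) (fE : cE K -> cE L) (fC : cC K -> cC L),
  [/\ bijective fV, bijective fE & bijective fC] /\
  [/\ forall e, src (fE e) = fV (src e),
      forall e, tgt (fE e) = fV (tgt e) &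
      forall e, lab (fE e) = lab e] /\
  [/\ forall c, top (fC c) = map fE (top c),
      forall c, bot (fC c) = map fE (bot c),
      outp L = map fE (outp K) /\ outv L = fV (outv K) &
      innp L = map fE (innp K) /\ innv L = fV (innv K)].

Definition dipole (K : complex) (c1 c2 : cC K) : Prop :=
  bot c1 = top c2 /\ map (@lab K) (top c1) = map (@lab K) (bot c2).

(* Related by a pair of [zip s t], in either order, or equal. *)
Definition zip_eq (A : eqType) (s t : seq A) (a b : A) : Prop :=
  [\/ a = b, (a, b) \in zip s t | (b, a) \in zip s t].

(* L is K with the dipole c1, c2 removed: the two cells and the path separating
   them (edges and interior vertices) are deleted, and the i-th edge (vertex)
   of the outer path of c1 is identified with the i-th edge (vertex) of the
   inner path of c2.  The maps fV and fE are only constrained on what is kept. *)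
Definition dipole_removal (K L : complex) : Prop :=
  exists c1 c2 : cC K, dipole c1 c2 /\
  let keptE e := e \notin bot c1 in
  let keptV v := v \notin behead (map (@src K) (bot c1)) in
  let keptC c := c \notin [:: c1; c2] in
  exists (fV : cV K -> cV L) (fE : cE K -> cE L) (gC : cC L -> cC K),
  [/\ forall v', exists2 v, keptV v & fV v = v',
      forall e', exists2 e, keptE e & fE e = e' &
      forall c, keptC c <-> exists c', gC c' = c] /\
  [/\ forall v w, keptV v -> keptV w ->
        (fV v = fV w <->
         zip_eq (map (@src K) (top c1)) (map (@src K) (bot c2)) v w),
      forall e f, keptE e -> keptE f ->
        (fE e = fE f <-> zip_eq (top c1) (bot c2) e f) &
      injective gC] /\
  [/\ forall e, keptE e -> src (fE e) = fV (src e),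
      forall e, keptE e -> tgt (fE e) = fV (tgt e) &
      forall e, keptE e -> lab (fE e) = lab e] /\
  [/\ forall c, top c = map fE (top (gC c)),
      forall c, bot c = map fE (bot (gC c)),
      outp L = map fE (outp K) /\ outv L = fV (outv K) &
      innp L = map fE (innp K) /\ innv L = fV (innv K)].

(* M is obtained from K and L by identifying the inner path of K with the outer
   path of L, edge by edge and vertex by vertex from the distinguished ones. *)
Definition glued (K L M : complex) : Prop :=
  exists (fV : cV K -> cV M) (fE : cE K -> cE M) (fC : cC K -> cC M)
         (gV : cV L -> cV M) (gE : cE L -> cE M) (gC : cC L -> cC M),
  [/\ [/\ injective fV, injective fE & injective fC],
      [/\ injective gV, injective gE & injective gC],
      [/\ forall v, (exists v', fV v' = v) \/ (exists v', gV v' = v),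
          forall e, (exists e', fE e' = e) \/ (exists e', gE e' = e) &
          forall c, (exists c', fC c' = c) \/ (exists c', gC c' = c)] &
      [/\ forall v w, fV v = gV w <->
            (v, w) \in zip (map (@src K) (innp K)) (map (@src L) (outp L)),
          forall e f, fE e = gE f <-> (e, f) \in zip (innp K) (outp L) &
          forall c d, fC c <> gC d]] /\
  [/\ forall e, [/\ src (fE e) = fV (src e), tgt (fE e) = fV (tgt e) &
                    lab (fE e) = lab e],
      forall e, [/\ src (gE e) = gV (src e), tgt (gE e) = gV (tgt e) &
                    lab (gE e) = lab e],
      forall c, top (fC c) = map fE (top c) /\ bot (fC c) = map fE (bot c) &
      forall c, top (gC c) = map gE (top c) /\ bot (gC c) = map gE (bot c)] /\
  [/\ outp M = map fE (outp K) /\ outv M = fV (outv K) &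
      innp M = map gE (innp L) /\ innv M = gV (innv L)].

Variable u : seq X.

Definition adiag : Type := {K : complex | annular u K}.

(* Isomorphism, and insertion and removal of dipoles. *)
Definition adiag_eq : adiag -> adiag -> Prop :=
  clos_refl_sym_trans _ (fun D D' =>
    complex_iso (sval D) (sval D') \/ dipole_removal (sval D) (sval D')).

Definition adiag_group : Type :=
  {A : adiag -> Prop | exists D, A = adiag_eq D}.

Definition adiag_mul (A B C : adiag_group) : Prop :=
  exists D1 D2 D3, [/\ sval A D1, sval B D2, sval C D3 &
                       glued (sval D1) (sval D2) (sval D3)].

End Annular.

Inductive ef := Le | Lf.

Variant ef_rels : seq ef -> seq ef -> Prop :=
| rel_e : ef_rels [:: Le] [:: Lf; Lf]
| rel_f : ef_rels [:: Lf] [:: Lf; Le].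

(* Isomorphism of groups whose products are given by their graphs:
   [mA x y z] means x y = z.  The equivalence makes [mB] the graph of a group
   operation as soon as [mA] is one. *)
Definition isomorphic (A B : Type)
    (mA : A -> A -> A -> Prop) (mB : B -> B -> B -> Prop) : Prop :=
  exists phi : A -> B, bijective phi /\
    forall x y z, mA x y z <-> mB (phi x) (phi y) (phi z).

(* Main.v *)
Require Import Defs.
From mathcomp Require Import all_boot all_order all_algebra.
From mathcomp Require Import boolp classical_sets reals.
From mathcomp Require Import ring lra zify.
From Stdlib Require Import Relation_Operators.

(* The core of vecT is the automaton with states e (the root) and f, in which e
   has children f, f and f has children f, e.  A vertex of a tree is in state f
   exactly when the leftmost leaf below it and the leaf following its subtree
   have different colours in the Thompson graph, so a triple is bipartite if and
   only if identified leaves are in the same state.  Acceptance by the core thus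
   implies membership in vecT; conversely x_0 x_1 and f_{1/2} alone already force
   enough identifications in the core.

   Every letter e, f can be split in exactly one way, hence an annular diagram
   is a sequence of splits and inverse splits, interspersed with rotations, of a
   cyclic word.  Moving inverse splits to the right by an Ore condition puts the
   diagram in the form (tree T) (rotation) (tree S)^-1, where the labels of the
   leaves of T and S agree, i.e. in the form of a bipartite triple.  To read the
   map of the circle off an arbitrary diagram, parametrize the outer edge by the
   identity and transport the parametrization through the cells by halving: the
   parametrization of the inner edge does not change under isomorphisms and
   removals of dipoles, and is the inverse of the map. *)

Set Implicit Arguments.
Unset Strict Implicit.
Unset Printing Implicit Defensive.

Import Order.TTheory GRing.Theory Num.Theory.
Local Open Scope ring_scope.

(** * Dyadic cones of the circle *)

(** Two features shape the argument. The automata involved are codeterministic: a state is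
    determined by its two children. This carries agreement of states from a triple to its reduction,
    and from the leaves of a triple to arbitrary words: append letters until a word lies below a
    leaf, compare states there, and return to the original word. The appended letters are arbitrary,
    and it is not known beforehand that every vertex of a core has children; hence the free trees
    hung below it. In the annular part the obstacle is that diagrams are concrete complexes over
    dependent types. A split is therefore arranged so that its position and the inner vertex are
    restored exactly, and many facts about rotations become equalities of complexes. The inner
    labels of intermediate complexes are left arbitrary. Injectivity comes from common refinement:
    two diagrams with the same parametrization are given the same tree S; the rotated list of leaves
    of T can then be read off, which determines T and the effect of the rotation. *)

Section Cones.
Variable R : realType.
Local Notation circle := (circle R).

Lemma circle_inj (s t : circle) : sval s = sval t -> s = t.
Proof. exact: (@val_inj R _ {x | is_true (0 <= x < 1)}). Qed.

Lemma halve_circle (b : bool) (t : circle) : 0 <= (val t + b%:R) / 2 < 1.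
Proof. by case: t b => [t /= /andP[? ?]] [] /=; apply/andP; split; lra. Qed.

Definition point (t : R) (h : 0 <= t < 1) : circle :=
  exist (fun t => is_true (0 <= t < 1)) t h.

Definition halve (b : bool) (t : circle) : circle := point (halve_circle b t).

Lemma halve_inj b c (s t : circle) : halve b s = halve c t -> b = c /\ s = t.
Proof.
move=> h; have {h} : (sval s + b%:R) / 2 = (sval t + c%:R) / 2 := congr1 sval h.
case: s t b c => [s hs] [t ht] [] [] /= e; have /andP[? ?] := hs;
  have /andP[? ?] := ht; by [split=> //; apply: circle_inj => /=; lra | exfalso; lra].
Qed.

Lemma halve_surj (t : circle) : exists b s, t = halve b s.
Proof.
case: t => [t ht]; have /andP[t0 t1] := ht; have [h|h] := ltP t (1 / 2).
  have hs : 0 <= 2 * t < 1 by apply/andP; split; lra.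
  by exists false, (point hs); apply: circle_inj => /=; lra.
have hs : 0 <= 2 * t - 1 < 1 by apply/andP; split; lra.
by exists true, (point hs); apply: circle_inj => /=; lra.
Qed.

Definition cone (p : seq bool) (t : circle) : circle := foldr halve t p.

Lemma cone_cat p q t : cone (p ++ q) t = cone p (cone q t).
Proof. by rewrite /cone foldr_cat. Qed.

(** Dyadic intervals are nested or disjoint, because [halve] determines both its bit and its
    argument. *)
Lemma cone_compare p q s t : (size p <= size q)%N -> cone p s = cone q t ->
  exists w, q = p ++ w /\ s = cone w t.
Proof.
elim: p q => [|b p IH] [|c q] //= h e; [by exists [::]|by exists (c :: q)|].
by have [-> /IH[//|w [-> ->]]] := halve_inj e; exists w.
Qed.

Lemma cone_inj p s t : cone p s = cone p t -> s = t.
Proof. by elim: p => //= b p IH /halve_inj[_ /IH]. Qed.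

Lemma circle0_subproof : 0 <= (0 : R) < 1.
Proof. by rewrite lexx ltr01. Qed.
Definition circle0 : circle := point circle0_subproof.

Lemma cone_id w : (forall t, cone w t = t) -> w = [::].
Proof.
(* A point of the half opposite to the first letter of [w] cannot be fixed. *)
case: w => [//|b w] /(_ (halve (~~ b) circle0))/halve_inj[].
by case: b.
Qed.

Lemma cone_fun_inj p q : (forall t, cone p t = cone q t) -> p = q.
Proof.
wlog le_pq : p q / (size p <= size q)%N => [th|] e.
  by case: (leqP (size p) (size q)) => [/th|/ltnW/th h]; [|rewrite h]; auto.
have [w [eqw _]] := cone_compare le_pq (e circle0).
rewrite eqw (@cone_id w) ?cats0 // => t.
by apply: (@cone_inj p); rewrite -cone_cat -eqw e.
Qed.

Definition maps (g : circle -> circle) (p q : seq bool) : Prop :=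
  forall t, g (cone p t) = cone q t.

Lemma maps_cat g p q w : maps g p q -> maps g (p ++ w) (q ++ w).
Proof. by move=> h t; rewrite !cone_cat h. Qed.

Lemma maps_fun g p q q' : maps g p q -> maps g p q' -> q = q'.
Proof. by move=> h h'; apply: cone_fun_inj => t; rewrite -h -h'. Qed.

Lemma maps_comp g h p q r : maps g p q -> maps h q r -> maps (lr_comp g h) p r.
Proof. by move=> hg hh t; rewrite /lr_comp /= hg hh. Qed.

Lemma maps_merge g p q : maps g (rcons p false) (rcons q false) ->
  maps g (rcons p true) (rcons q true) -> maps g p q.
Proof.
move=> h0 h1 t; have [[] [s ->]] := halve_surj t.
  by have := h1 s; rewrite -!cats1 !cone_cat.
by have := h0 s; rewrite -!cats1 !cone_cat.
Qed.

(** The endpoints are general so that the induction on [p] can pass to either half; the instance 0,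
    1 links [subinterval] to [cone]. *)
Lemma subinterval_cone p (a b : R) : a < b ->
  (subinterval a b p).1 < (subinterval a b p).2 /\
  forall t, a + (b - a) * val (cone p t) =
    (subinterval a b p).1 +
    ((subinterval a b p).2 - (subinterval a b p).1) * val t.
Proof.
elim: p a b => [|c p IH] a b ab; first by split.
have h1 : a < (a + b) / 2 by lra.
have h2 : (a + b) / 2 < b by lra.
have hv t : val (cone (c :: p) t) = (val (cone p t) + c%:R) / 2 by [].
case: c hv => hv.
  by have [? e] := IH _ _ h2; split=> // t; rewrite hv -e /=; field.
by have [? e] := IH _ _ h1; split=> // t; rewrite hv -e /=; field.
Qed.

(** Trades the affine formula on reals for a statement about words, the form in which triples are
    used from here on. *)
Lemma represents_maps d (g : circle -> circle) : represents d g <->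
  wf_triple d /\ forall p q, leaf_identified d p q -> maps g p q.
Proof.
split=> [[wf h]|[wf h]]; split=> // p q /h; move: (h p q) => {h}.
  have [] := @subinterval_cone p 0 1 ltr01; have [] := @subinterval_cone q 0 1 ltr01.
  case: (subinterval 0 1 p) => a b; case: (subinterval 0 1 q) => c e /=.
  move=> ce hq ab hp _ h t; apply: circle_inj.
  have vp : val (cone p t) = a + (b - a) * val t.
    by rewrite -hp subr0 mul1r add0r.
  have vq : val (cone q t) = c + (e - c) * val t.
    by rewrite -hq subr0 mul1r add0r.
  have /andP[t0 t1] := valP t.
  rewrite h vp ?vq; first by field; lra.
  apply/andP; split; first by rewrite lerDl mulr_ge0 // subr_ge0 ltW.
  rewrite -[X in _ < X](subrK a) addrC ltrD2r.
  by rewrite gtr_pMr // subr_gt0.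
have [] := @subinterval_cone p 0 1 ltr01; have [] := @subinterval_cone q 0 1 ltr01.
case: (subinterval 0 1 p) => a b; case: (subinterval 0 1 q) => c e /=.
move=> ce hq ab hp _ h t /andP[ta tb].
have ba0 : 0 < b - a by rewrite subr_gt0.
have hs : 0 <= (val t - a) / (b - a) < 1.
  rewrite divr_ge0 ?subr_ge0 ?(ltW ab) //=.
  by rewrite ltr_pdivrMr // mul1r ltrD2r.
have -> : t = cone p (point hs).
  apply: circle_inj; have := hp (point hs); rewrite subr0 mul1r add0r => -> /=.
  by field; lra.
rewrite h.
have := hq (point hs); rewrite subr0 mul1r add0r => -> /=.
have := hp (point hs); rewrite subr0 mul1r add0r => -> /=.
by field; lra.
Qed.

End Cones.

(** * Trees and reduction of triples *)

Lemma leaves_gt0 t : (0 < size (leaves t))%N.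
Proof. by elim: t => //= l IHl r IHr; rewrite size_cat size_map addn_gt0 IHl. Qed.

Lemma mem_map_cons (b c : bool) p s :
  (b :: p \in [seq c :: q | q <- s]) = (b == c) && (p \in s).
Proof.
have [<-|/eqP bc] := eqVneq b c; first by rewrite mem_map // => x y [].
by apply/negbTE/mapP => -[q _ []].
Qed.

Lemma mem_leaves_Node b p l r :
  (b :: p \in leaves (Node l r)) = (p \in leaves (if b then r else l)).
Proof.
by rewrite mem_cat !mem_map_cons; case: b; rewrite ?orbF.
Qed.

Lemma nil_leaves_Node l r : ([::] \in leaves (Node l r)) = false.
Proof. by rewrite mem_cat; apply/negbTE/norP; split; apply/mapP => -[]. Qed.

(** [N] can be the depth of [t]. Appending enough letters thus pushes any word below a leaf. *)
Lemma leaves_cover t : exists N, forall w, (N <= size w)%N ->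
  exists p w', p \in leaves t /\ w = p ++ w'.
Proof.
elim: t => [|l [N hN] r [M hM]]; first by exists 0 => w _; exists [::], w.
exists (maxn N M).+1 => -[//|b w]; rewrite ltnS geq_max => /andP[/hN h0 /hM h1].
have [p [w' [hp ->]]] : exists p w', p \in leaves (if b then r else l) /\ w = p ++ w'.
  by case: b.
by exists (b :: p), w'; rewrite mem_leaves_Node.
Qed.

Lemma leaves_prefix t p w : p \in leaves t -> p ++ w \in leaves t -> w = [::].
Proof.
elim: t p => [|l IHl r IHr] p; first by rewrite !inE => /eqP-> /eqP.
case: p => [|b p]; first by rewrite nil_leaves_Node.
by rewrite cat_cons !mem_leaves_Node; case: b; [apply: IHr|apply: IHl].
Qed.

Lemma leaves_uniq t : uniq (leaves t).
Proof.
elim: t => //= l IHl r IHr; rewrite cat_uniq !map_inj_uniq ?IHl ?IHr //;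
  try by move=> ? ? [].
by rewrite andbT; apply/hasPn => x /mapP[p _ ->]; apply/mapP => -[].
Qed.

Lemma leaves_inj t t' : leaves t =i leaves t' -> t = t'.
Proof.
elim: t t' => [|l IHl r IHr] [|l' r'] h //.
- by have := h [::]; rewrite nil_leaves_Node mem_head.
- by have := h [::]; rewrite nil_leaves_Node mem_head.
congr Node.
  by apply: IHl => p; have := h (false :: p); rewrite !mem_leaves_Node.
by apply: IHr => p; have := h (true :: p); rewrite !mem_leaves_Node.
Qed.

Lemma leaves_nodes t : {subset leaves t <= nodes t}.
Proof.
elim: t => //= l IHl r IHr p; rewrite inE !mem_cat => /orP[] /mapP[q hq ->] /=.
  by rewrite (map_f _ (IHl _ hq)).
by rewrite (map_f _ (IHr _ hq)) orbT.
Qed.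

Lemma mem_nodes_Node b p l r :
  (b :: p \in nodes (Node l r)) = (p \in nodes (if b then r else l)).
Proof.
by rewrite inE mem_cat !mem_map_cons; case: b; rewrite ?orbF.
Qed.

Lemma nil_nodes t : [::] \in nodes t.
Proof. by case: t => *; rewrite mem_head. Qed.

Lemma nodes_rcons t p b c : rcons p b \in nodes t ->
  p \in nodes t /\ rcons p c \in nodes t.
Proof.
elim: t p => [|l IHl r IHr] [|a p] //.
  by move=> _; split; rewrite ?nil_nodes // mem_nodes_Node nil_nodes.
by rewrite !rcons_cons !mem_nodes_Node; case: a; [apply: IHr|apply: IHl].
Qed.

(** The conclusion records where the caret sits in the list of leaves, since the cyclic shift of a
    triple sees only positions. *)
Lemma remove_caret t p : rcons p false \in leaves t -> rcons p true \in leaves t ->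
  exists t' A B, leaves t = A ++ [:: rcons p false; rcons p true] ++ B /\
                 leaves t' = A ++ p :: B.
Proof.
elim: t p => [|l IHl r IHr] [|a p] //=.
  rewrite !mem_leaves_Node => h0 h1; exists Leaf, [::], [::].
  have leaf t : [::] \in leaves t -> t = Leaf.
    by case: t => // l' r'; rewrite nil_leaves_Node.
  by rewrite (leaf _ h0) (leaf _ h1).
rewrite !mem_leaves_Node; case: a => h0 h1.
  have [t' [A [B [-> et']]]] := IHr _ h0 h1.
  exists (Node l t'), (map (cons false) (leaves l) ++ map (cons true) A).
  by exists (map (cons true) B); rewrite /= et' !map_cat -!catA.
have [t' [A [B [-> et']]]] := IHl _ h0 h1.
exists (Node t' r), (map (cons false) A).
exists (map (cons false) B ++ map (cons true) (leaves r)).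
by rewrite /= et' !map_cat -!catA.
Qed.

(** * Rotations of lists and identification of leaves *)

Section Rotations.
Variable T : eqType.
Implicit Types s : seq T.

Lemma nth_rot x s k i : (k <= size s)%N -> (i < size s)%N ->
  nth x (rot k s) i = nth x s ((i + k) %% size s)%N.
Proof.
move=> hk hi; rewrite /rot nth_cat size_drop; case: ltnP => h.
  by rewrite nth_drop addnC modn_small // -(subnK hk) ltn_add2r.
rewrite nth_take; last by lia.
congr nth; have -> : (i + k = (i - (size s - k)) + size s)%N by lia.
by rewrite modnDr modn_small //; lia.
Qed.

Lemma rot_sym k s t : t = rot k s -> exists j, s = rot j t.
Proof.
move->; exists (size s - k)%N; rewrite -[in LHS](rotK k s) /rotr size_rot //.
Qed.

Lemma rot_trans k l s : exists j, rot k (rot l s) = rot j s.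
Proof.
by exists (rot_add s l k); rewrite rot_rot_add.
Qed.

Lemma rot_head_uniq k x s t : uniq (x :: s) -> rot k (x :: s) = x :: t -> s = t.
Proof.
move=> us e; case: (leqP (size (x :: s)) k) => hk.
  by move: e; rewrite rot_oversize // => -[].
have := congr1 (fun l => nth x l 0) e.
rewrite nth_rot // 1?ltnW // add0n modn_small // => /eqP.
rewrite -[X in _ == X]/(nth x (x :: s) 0) nth_uniq // => /eqP k0.
by move: e; rewrite k0 rot0 => -[].
Qed.

(** Rotate both lists so that they begin with the pair x, y. As letters do not repeat, the
    remainders then coincide, and the pair may be replaced by one letter on both sides. *)
Lemma rot_merge k (A A' B B' : seq T) x y z : uniq (A ++ [:: x; y] ++ B) ->
  rot k (A ++ [:: x; y] ++ B) = A' ++ [:: x; y] ++ B' ->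
  exists j, rot j (A ++ z :: B) = A' ++ z :: B'.
Proof.
move=> us e.
have [i ei] : exists i, rot i ([:: x; y] ++ B ++ A) = [:: x; y] ++ B' ++ A'.
  have e1 : rot (size A) (A ++ [:: x; y] ++ B) = [:: x; y] ++ B ++ A.
    by rewrite rot_size_cat catA.
  have [j ej] := rot_sym (esym e1).
  have [l el] := rot_trans (size A') k (A ++ [:: x; y] ++ B).
  rewrite e rot_size_cat -catA in el.
  by rewrite el ej; have [i ei] := rot_trans l j ([:: x; y] ++ B ++ A); exists i.
have {}ei : B ++ A = B' ++ A'.
  have : uniq (x :: y :: B ++ A).
    by rewrite -[_ :: _]/([:: x; y] ++ B ++ A) catA -uniq_catC.
  by move=> /rot_head_uniq/(_ ei)[].
have [j ej] : exists j, A' ++ z :: B' = rot j (z :: B' ++ A').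
  by apply: (@rot_sym (size A')); rewrite rot_size_cat.
have [l el] := rot_trans j (size A) (A ++ z :: B).
by exists l; rewrite -el rot_size_cat /= ei -ej.
Qed.

End Rotations.

Lemma leaf_identified_zip d p q : wf_triple d -> leaf_identified d p q <->
  (p, q) \in zip (leaves (tdom d)) (rot (tshift d).-1 (leaves (tran d))).
Proof.
move=> [es /andP[n0 nm]]; rewrite /leaf_identified /leaf_image.
have hk : ((tshift d).-1 <= size (leaves (tran d)))%N by lia.
have hz : size (zip (leaves (tdom d)) (rot (tshift d).-1 (leaves (tran d))))
          = size (leaves (tdom d)) by rewrite size1_zip // size_rot es.
split=> [[i [hi -> ->]]|].
  rewrite -nth_rot // -?es //.
  suff -> : (nth [::] (leaves (tdom d)) i, nth [::] (rot (tshift d).-1 (leaves (tran d))) i) =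
    nth ([::], [::]) (zip (leaves (tdom d)) (rot (tshift d).-1 (leaves (tran d)))) i.
    by apply: mem_nth; rewrite hz.
  by rewrite nth_zip ?size_rot.
move/(nthP ([::], [::])) => [i]; rewrite hz => hi.
rewrite nth_zip ?size_rot // => -[<- <-]; exists i; split=> //.
by rewrite nth_rot // -es.
Qed.

Lemma triple_of_rot T S k : size (leaves T) = size (leaves S) ->
  exists d, [/\ tdom d = T, tran d = S, wf_triple d &
                rot (tshift d).-1 (leaves S) = rot k (leaves S)].
Proof.
move=> es; case: (ltnP k (size (leaves S))) => hk.
  by exists (Triple T S k.+1); split=> //; split=> //=; rewrite es.
(* Rotating by at least the length changes nothing, so the shift 1, that is no rotation, serves. *)
exists (Triple T S 1); split=> //; last by rewrite rot0 rot_oversize.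
by split=> //=; exact: leaves_gt0.
Qed.

Definition leafwise (r : seq bool -> seq bool -> Prop) (d : triple) : Prop :=
  wf_triple d /\ forall p q, leaf_identified d p q -> r p q.

Lemma mem_zip (S T : eqType) (x : S) (y : T) s t :
  (x, y) \in zip s t -> x \in s /\ y \in t.
Proof.
elim: s t => [|a s IHs] [|b t] //=; rewrite !inE => /orP[/eqP[-> ->]|/IHs[-> ->]].
  by rewrite !eqxx.
by rewrite !orbT.
Qed.

Lemma mem_zip_nth (S T : eqType) (s : seq S) (t : seq T) x y y0 :
  uniq s -> size t = size s -> (x, y) \in zip s t -> y = nth y0 t (index x s).
Proof.
move=> us est /(nthP (x, y0))[i]; rewrite size1_zip ?est // => hi.
by rewrite nth_zip // => -[<- <-]; rewrite index_uniq.
Qed.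

Lemma zip_split (S T : eqType) (A B : seq S) (s : seq T) x y a b :
  uniq (A ++ [:: x; y] ++ B) -> size s = size (A ++ [:: x; y] ++ B) ->
  (x, a) \in zip (A ++ [:: x; y] ++ B) s -> (y, b) \in zip (A ++ [:: x; y] ++ B) s ->
  exists A' B', size A = size A' /\ s = A' ++ [:: a; b] ++ B'.
Proof.
move=> us es ha hb; have := mem_zip_nth a us es ha; have := mem_zip_nth a us es hb.
move: us; rewrite cat_uniq /= !inE => /and4P[_ /norP[xA /norP[yA _]] /norP[xy _] _].
have sA : (size A + 1 < size s)%N by rewrite es size_cat /=; lia.
rewrite !index_cat (negbTE xA) (negbTE yA) /= (negbTE xy) !eqxx !addn0 => -> ->.
exists (take (size A) s), (drop (size A + 2)%N s); split.
  by rewrite size_take; case: ltnP => //; lia.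
rewrite -[in LHS](cat_take_drop (size A) s). congr cat.
have h1 : (size A < size s)%N by lia.
rewrite (drop_nth a h1); rewrite addn1 in sA; rewrite (drop_nth a sA).
by rewrite addn1 addn2 (set_nth_default a).
Qed.

(** Contract a pair of identified carets to a pair of identified leaves; the number of leaves drops.
    The relation is arbitrary so that several properties of a triple can be carried through the
    reduction at once. *)
Lemma exists_reduced (r : seq bool -> seq bool -> Prop) d :
  (forall p q, r (rcons p false) (rcons q false) ->
               r (rcons p true) (rcons q true) -> r p q) ->
  leafwise r d -> exists d', reduced d' /\ leafwise r d'.
Proof.
move=> merge; have [n] := ubnP (size (leaves (tdom d))).
elim: n d => // n IH d hn hd.
have [red|] := pselect (reduced d); first by exists d.
move/contrapT => -[p [q []]]; have [wf rd] := hd.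
move=> i0 i1; have r0 := rd _ _ i0; have r1 := rd _ _ i1.
move: i0 i1; rewrite !leaf_identified_zip // => i0 i1.
have [p0 q0] := mem_zip i0; have [p1 q1] := mem_zip i1.
rewrite !mem_rot in q0 q1.
have [T' [A [B [eT eT']]]] := remove_caret p0 p1.
have [S' [C [D [eS eS']]]] := remove_caret q0 q1.
set k := (tshift d).-1 in i0 i1.
have [es _] := wf.
have uT := leaves_uniq (tdom d); have uS := leaves_uniq (tran d).
have szr : size (rot k (leaves (tran d))) = size (leaves (tdom d)) by rewrite size_rot.
have [A' [B' [sA eR]]] : exists A' B', size A = size A' /\
   rot k (leaves (tran d)) = A' ++ [:: rcons q false; rcons q true] ++ B'.
  rewrite eT in szr i0 i1 uT. exact: (zip_split uT szr i0 i1).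
rewrite eS in eR; rewrite eS in uS.
have [j ej] := rot_merge q uS eR.
have es' : size (leaves T') = size (leaves S').
  by move: es; rewrite eT eS eT' eS' !size_cat /=; lia.
have [d' [dT dS wf' ek]] := triple_of_rot j es'.
apply: (IH d').
  by move: hn; rewrite dT eT' eT !size_cat /=; lia.
split=> // x y; rewrite leaf_identified_zip // dT dS ek eT' eS' ej zip_cat // mem_cat /= inE.
have sub z : z \in zip A A' \/ z \in zip B B' -> r z.1 z.2.
  move=> hz; apply: rd; rewrite leaf_identified_zip // -/k eT eS eR -surjective_pairing.
  by rewrite zip_cat // mem_cat /= !inE; case: hz => ->; rewrite ?orbT.
case/or3P => h; [by apply: (sub (x, y)); left| |by apply: (sub (x, y)); right].
by case/eqP: h => -> ->; apply: merge.
Qed.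

(** * Thompson graphs and the two-state automaton *)

Section Automata.
Variables (Q : Type) (delta : Q -> bool -> Q) (q0 : Q).
Hypothesis codet : forall s s', (forall b, delta s b = delta s' b) -> s = s'.

(** Codeterminism moves equality of states from all descendants at depth [n] up to the vertices
    themselves, one level at a time. *)
Lemma run_codet n p q :
  (forall w, size w = n -> foldl delta q0 (p ++ w) = foldl delta q0 (q ++ w)) ->
  foldl delta q0 p = foldl delta q0 q.
Proof.
elim: n p q => [|n IH] p q h; first by have := h [::]; rewrite !cats0; apply.
apply: codet => b; rewrite -!foldl_rcons; apply: IH => w sw.
by rewrite -!cats1 -!catA; apply: h; rewrite /= sw.
Qed.

Variable R : realType.

(** The triple compares states only at its leaves, while [p] may lie above them. Every long
    extension of [p] lies below a leaf, where [g] forces the corresponding extension of [q];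
    codeterminism then returns to [p] and [q]. *)
Lemma maps_run d (g : circle R -> circle R) p q : represents d g ->
  leafwise (fun p q => foldl delta q0 p = foldl delta q0 q) d ->
  maps g p q -> foldl delta q0 p = foldl delta q0 q.
Proof.
move=> /represents_maps[wf hg] [_ hd] hpq.
have [N hN] := leaves_cover (tdom d).
apply: (@run_codet N) => w sw.
have [|l [w' [hl e]]] := hN (p ++ w); first by rewrite size_cat sw leq_addl.
have hi : (index l (leaves (tdom d)) < size (leaves (tdom d)))%N by rewrite index_mem.
have id : leaf_identified d l
    (nth [::] (leaves (tran d)) (leaf_image d (index l (leaves (tdom d))))).
  by exists (index l (leaves (tdom d))); split=> //; rewrite nth_index.
have m := maps_cat w hpq; have := maps_cat w' (hg _ _ id).
rewrite e => m'; rewrite e in m; rewrite (maps_fun m m') !foldl_cat.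
by rewrite (hd _ _ id).
Qed.

End Automata.

(* State [true] is f and [false] is e: e has children f, f and f has children
   f, e. *)
Definition ef_step (s b : bool) : bool := if b then ~~ s else true.

Lemma ef_step_codet s s' : (forall b, ef_step s b = ef_step s' b) -> s = s'.
Proof. by move/(_ true)/negb_inj. Qed.

Definition ef_run (p : seq bool) : bool := foldl ef_step false p.

(** The number of right turns modulo 2, which is the colour of a leaf in the 2-colouring of the
    Thompson graph that gives [false] to the first leaf. *)
Definition parity (p : seq bool) : bool := foldr addb false p.

Definition same_run (p q : seq bool) : Prop := ef_run p = ef_run q.

Definition parities a t : seq bool := [seq a (+) parity p | p <- leaves t].

Lemma parities_Node a l r :
  parities a (Node l r) = parities a l ++ parities (~~ a) r.
Proof.
rewrite /parities map_cat -!map_comp; congr cat; apply: eq_map => p /=.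
by rewrite addNb addbN.
Qed.

Lemma parities_head a t : parities a t = a :: behead (parities a t).
Proof.
elim: t a => [|l IHl r IHr] a; first by rewrite /parities /= addbF.
by rewrite parities_Node IHl.
Qed.

(* A vertex is in state f iff the leftmost leaf below it and the leaf following
   its subtree have different parities. *)
Lemma ef_runs_parities s a t : [seq foldl ef_step s p | p <- leaves t] =
  pairmap addb a (rcons (behead (parities a t)) (a (+) s)).
Proof.
elim: t s a => [|l IHl r IHr] s a; first by rewrite /= addKb.
rewrite /= map_cat -!map_comp.
have -> : [seq (foldl ef_step s \o cons false) i | i <- leaves l] =
   [seq foldl ef_step true p | p <- leaves l] by [].
have -> : [seq (foldl ef_step s \o cons true) i | i <- leaves r] =
   [seq foldl ef_step (~~ s) p | p <- leaves r] by [].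
(* The boundary terms match: [a (+) true] is the parity of the first leaf of [r], and
   [~~ a (+) ~~ s] equals [a (+) s]. *)
rewrite (IHl true a) (IHr (~~ s) (~~ a)) parities_Node (parities_head a l) /=.
rewrite (parities_head (~~ a) r) rcons_cat rcons_cons -cat_rcons pairmap_cat /=.
by rewrite last_rcons addbT addNb addbN negbK.
Qed.

(** For the root state e the parity that closes the list in [ef_runs_parities] is that of the first
    leaf. The successor of the last leaf is therefore the first one, in accordance with the cyclic
    identifications of T. *)
Lemma ef_run_parity t i : (i < size (leaves t))%N ->
  ef_run (nth [::] (leaves t) i) = parity (nth [::] (leaves t) i) (+)
    parity (nth [::] (leaves t) (i.+1 %% size (leaves t))).
Proof.
move=> hi; have := congr1 (nth false ^~ i) (ef_runs_parities false false t).
rewrite /ef_run (nth_map [::]) // => ->.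
have par j : (j < size (leaves t))%N ->
    nth false (parities false t) j = parity (nth [::] (leaves t) j).
  by move=> hj; rewrite (nth_map [::]).
have sz : size (behead (parities false t)) = (size (leaves t)).-1.
  by rewrite size_behead size_map.
have gt0 := leaves_gt0 t.
rewrite (nth_pairmap false) ?size_rcons ?sz ?prednK // -rcons_cons -parities_head.
rewrite nth_rcons size_map hi par //; congr addb.
rewrite nth_rcons sz; case: (ltnP i.+1 (size (leaves t))) => hi1.
  by rewrite modn_small // -par // ifT ?nth_behead //; lia.
have e1 : i.+1 = size (leaves t) by lia.
rewrite e1 modnn -par // parities_head /= ifF; last by lia.
by case: ifP.
Qed.

Lemma parity_first t : parity (nth [::] (leaves t) 0) = false.
Proof.
have := parities_head false t; have := leaves_gt0 t; rewrite /parities.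
by case: (leaves t) => //= p s _ [].
Qed.

Lemma edges_bound k t i j : (i, j) \in thompson_edges k t ->
  (k <= i < k + size (leaves t))%N /\ (k <= j < k + size (leaves t))%N.
Proof.
elim: t k => [//|l IHl r IHr] k; rewrite /= size_cat !size_map inE mem_cat.
have := leaves_gt0 l; have := leaves_gt0 r => r0 l0.
by case/or3P => [/eqP[-> ->]|/IHl[]|/IHr[]]; lia.
Qed.

(** The edge of a node joins the first leaves of its two subtrees, whose paths differ by one right
    turn. These edges propagate the colour of the first vertex to all others, so a proper
    2-colouring can only be the parity, up to a swap. *)
Lemma edges_coloring (c : nat -> bool) k t :
  (forall i j, (i, j) \in thompson_edges k t -> c i != c j) <->
  (forall i, (i < size (leaves t))%N ->
     c (k + i)%N = c k (+) parity (nth [::] (leaves t) i)).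
Proof.
have step l r i : (i < size (leaves r))%N ->
    parity (nth [::] (leaves (Node l r)) (size (leaves l) + i)) =
    ~~ parity (nth [::] (leaves r) i).
  move=> hi; rewrite /= nth_cat size_map ltnNge leq_addr /= addnC addnK.
  by rewrite (nth_map [::]).
have step0 l r i : (i < size (leaves l))%N ->
    parity (nth [::] (leaves (Node l r)) i) = parity (nth [::] (leaves l) i).
  by move=> hi; rewrite /= nth_cat size_map hi (nth_map [::]).
elim: t k => [|l IHl r IHr] k; split.
- by move=> _ [|i] //= _; rewrite addn0 addbF.
- by [].
- move=> h i hi; have hl : forall i, (i < size (leaves l))%N ->
     c (k + i)%N = c k (+) parity (nth [::] (leaves l) i).
    by apply/IHl => a b hab; apply: h; rewrite inE mem_cat hab orbT.
  have hr : forall i, (i < size (leaves r))%N ->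
     c (k + size (leaves l) + i)%N =
     c (k + size (leaves l))%N (+) parity (nth [::] (leaves r) i).
    by apply/IHr => a b hab; apply: h; rewrite inE mem_cat hab !orbT.
  have hk : c (k + size (leaves l))%N = ~~ c k.
    have := h k (k + size (leaves l))%N; rewrite inE eqxx.
    by case: (c k) => /(_ isT); case: (c _).
  case: (ltnP i (size (leaves l))) => hil; first by rewrite hl // step0.
  have hir : (i - size (leaves l) < size (leaves r))%N.
    by move: hi; rewrite /= size_cat !size_map; lia.
  have -> : i = (size (leaves l) + (i - size (leaves l)))%N by lia.
  by rewrite step // addnA hr // hk addNb addbN.
- have szN : size (leaves (Node l r)) = (size (leaves l) + size (leaves r))%N.
    by rewrite /= size_cat !size_map.
  move=> h; have hk : c (k + size (leaves l))%N = ~~ c k.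
    rewrite h ?szN; last by have := leaves_gt0 r; lia.
    rewrite -[X in nth _ _ X]addn0 step ?leaves_gt0 // parity_first.
    by rewrite addbT.
  move=> i j; rewrite inE mem_cat => /or3P[/eqP[-> ->]|hij|hij].
  + by rewrite hk; case: (c k).
  + apply: (proj2 (IHl k)) hij => x hx; rewrite h ?step0 //.
    by rewrite szN; lia.
  + apply: (proj2 (IHr (k + size (leaves l))%N)) hij => x hx.
    rewrite hk -addnA h ?szN ?ltn_add2l // step //.
    by rewrite addNb addbN.
Qed.

(** * Bipartite triples and states of identified leaves *)

Section Bipartite.
Variable d : triple.
Hypothesis wf : wf_triple d.
Let m := size (leaves (tdom d)).
Let par1 i := parity (nth [::] (leaves (tdom d)) i).
Let par2 i := parity (nth [::] (leaves (tran d)) i).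

Let unimage i := ((i + (m - (tshift d).-1)) %% m)%N.

Let sz2 : size (leaves (tran d)) = m.
Proof. by case: wf. Qed.

Let m0 : (0 < m)%N.
Proof. exact: leaves_gt0. Qed.

Let shift_lt : ((tshift d).-1 < m)%N.
Proof. by case: wf => _ /andP[]; rewrite -/m; lia. Qed.

Lemma leaf_image_lt i : (leaf_image d i < m)%N.
Proof. by rewrite /leaf_image sz2 ltn_mod. Qed.

Lemma unimageK i : (i < m)%N -> leaf_image d (unimage i) = i.
Proof.
move=> hi; rewrite /leaf_image sz2 /unimage modnDml -addnA.
by rewrite subnK ?modnDr ?modn_small // ltnW.
Qed.

Lemma leaf_imageK i : (i < m)%N -> unimage (leaf_image d i) = i.
Proof.
move=> hi; rewrite /leaf_image sz2 /unimage modnDml -addnA.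
by rewrite subnKC ?modnDr ?modn_small // ltnW.
Qed.

Lemma leaf_imageS i : ((leaf_image d i).+1 %% m = leaf_image d (i.+1 %% m))%N.
Proof. by rewrite /leaf_image sz2 -addn1 modnDml modnDml; congr modn; lia. Qed.

(** Each of the two graphs has only the parity colouring and its opposite. The two can be made to
    agree on merged vertices exactly when the parities of identified leaves differ by a constant. *)
Lemma bipartite_parity : thompson_bipartite d <->
  exists b, forall i, (i < m)%N -> par1 i (+) par2 (leaf_image d i) = b.
Proof.
split=> [[c hc]|[b hb]].
  have h1 : forall i, (i < m)%N -> c (0 + i)%N = c 0 (+) par1 i.
    apply/edges_coloring => i j hij; have := edges_bound hij.
    by rewrite -/m !add0n => -[/andP[_ hi] /andP[_ hj]]; apply: hc => //; left.
  have h2 : forall i, (i < size (leaves (tran d)))%N ->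
     c (unimage (0 + i)%N) = c (unimage 0) (+) par2 i.
    apply/(edges_coloring (c \o unimage)) => i j hij; have := edges_bound hij.
    rewrite sz2 !add0n => -[/andP[_ hi] /andP[_ hj]].
    apply: hc; rewrite ?ltn_mod //; right.
    by rewrite !unimageK.
  exists (c 0 (+) c (unimage 0)) => i hi.
  have e1 : c i = c 0 (+) par1 i := h1 i hi.
  have := h2 (leaf_image d i); rewrite sz2 leaf_image_lt => /(_ isT).
  rewrite add0n leaf_imageK // e1.
  by case: (c 0) (par1 i) (c (unimage 0)) (par2 _) => [] [] [] [].
exists par1 => i j hi hj [hij|hij].
  have: forall i j, (i, j) \in thompson_edges 0 (tdom d) -> par1 i != par1 j.
    apply/edges_coloring => x hx; rewrite add0n /par1 parity_first.
    by rewrite addFb.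
  exact.
have: forall i j, (i, j) \in thompson_edges 0 (tran d) -> par2 i != par2 j.
  apply/edges_coloring => x hx; rewrite add0n /par2 parity_first.
  by rewrite addFb.
move=> /(_ _ _ hij); have := hb _ hi; have := hb _ hj; move: hi hj {hij}.
by move=> _ _; case: (par1 i) (par1 j) (par2 _) (par2 _) b {hb} => [] [] [] [] [].
Qed.

(** The state of a leaf is the difference between its parity and that of its cyclic successor, and
    identification commutes with the successor. Equal states thus say that the difference of
    parities of identified leaves does not change from one leaf to the next. *)
Lemma bipartite_same_run : thompson_bipartite d <-> leafwise same_run d.
Proof.
have run1 i : (i < m)%N -> ef_run (nth [::] (leaves (tdom d)) i) =
   par1 i (+) par1 (i.+1 %% m) by move=> hi; rewrite ef_run_parity.
have run2 i : (i < m)%N -> ef_run (nth [::] (leaves (tran d)) i) =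
   par2 i (+) par2 (i.+1 %% m) by move=> hi; rewrite ef_run_parity ?sz2.
split=> [/bipartite_parity[b hb]|[_ h]].
  split=> // p q [i [hi -> ->]]; rewrite /same_run run1 // run2 ?leaf_image_lt //.
  rewrite leaf_imageS; have := hb _ hi.
  have := hb (i.+1 %% m)%N; rewrite ltn_mod m0 => /(_ isT).
  by case: (par1 i) (par1 _) (par2 _) (par2 _) b {hb} => [] [] [] [] [].
apply/bipartite_parity; exists (par1 0 (+) par2 (leaf_image d 0)).
elim=> [//|i IH] hi; have hi' := ltnW hi.
have : same_run (nth [::] (leaves (tdom d)) i)
                (nth [::] (leaves (tran d)) (leaf_image d i)).
  by apply: h; exists i.
rewrite /same_run run1 // run2 ?leaf_image_lt // leaf_imageS modn_small //.
rewrite -(IH hi').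
by case: (par1 i) (par1 i.+1) (par2 (leaf_image d i)) (par2 (leaf_image d i.+1))
  => [] [] [] [].
Qed.

End Bipartite.

Section VecT.
Variable R : realType.
Implicit Types g : circle R -> circle R.

Lemma same_run_merge p q : same_run (rcons p false) (rcons q false) ->
  same_run (rcons p true) (rcons q true) -> same_run p q.
Proof.
by rewrite /same_run /ef_run !foldl_rcons => _ /negb_inj.
Qed.

(** Frees membership in [vecT] from reduced triples: representing [g] and agreement of states both
    survive the contraction of carets. *)
Lemma vecTP g : vecT g <-> exists d, represents d g /\ leafwise same_run d.
Proof.
split=> [[_ [d [[red rep] bip]]]|[d [rep run]]].
  by exists d; split=> //; apply/bipartite_same_run => //; case: rep.
have /represents_maps[wf hg] := rep; have [_ hr] := run.
split; first by exists d.
have [||d' [red [wf' h']]] := @exists_reduced (fun p q => maps g p q /\ same_run p q) d.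
- by move=> p q [? ?] [? ?]; split; [apply: maps_merge|apply: same_run_merge].
- by split=> // p q hpq; split; [apply: hg|apply: hr].
exists d'; split; first split=> //.
  by apply/represents_maps; split=> // p q /h'[].
by apply/bipartite_same_run => //; split=> // p q /h'[].
Qed.

Lemma vecT_maps g p q : vecT g -> maps g p q -> same_run p q.
Proof. by move=> /vecTP[d [rep run]]; exact: (maps_run ef_step_codet rep run). Qed.

Lemma vecT_reduced g : vecT g -> exists d, reduced_triple_of d g.
Proof. by case=> _ [d [? _]]; exists d. Qed.

Lemma vecT_same_run g d : vecT g -> represents d g -> leafwise same_run d.
Proof.
move=> hg /represents_maps[wf rep]; split=> // p q /rep; exact: vecT_maps.
Qed.

End VecT.

(** * Some elements of vecT *)

Section Generators.
Variable R : realType.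

Lemma x0_maps00 : maps (@x_ R 0) [:: false; false] [:: false].
Proof.
move=> [t ht]; apply: circle_inj; have /andP[t0 t1] := ht.
by rewrite /= /xfun ifT; lra.
Qed.

Lemma x0_maps01 : maps (@x_ R 0) [:: false; true] [:: true; false].
Proof.
move=> [t ht]; apply: circle_inj; have /andP[t0 t1] := ht.
by rewrite /= /xfun ifF ?ifT; lra.
Qed.

Lemma x0_maps1 : maps (@x_ R 0) [:: true] [:: true; true].
Proof.
move=> [t ht]; apply: circle_inj; have /andP[t0 t1] := ht.
by rewrite /= /xfun ifF ?ifF; lra.
Qed.

Lemma xS_halve0 n (t : circle R) : x_ n.+1 (halve false t) = halve false t.
Proof.
case: t => t ht; apply: circle_inj; have /andP[t0 t1] := ht.
by rewrite /= ifT //; lra.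
Qed.

Lemma xfun0 n : xfun n (0 : R) = 0.
Proof.
case: n => [|n] /=; first by rewrite ifT; lra.
by rewrite ifT //; lra.
Qed.

Lemma xS_halve1 n (t : circle R) : x_ n.+1 (halve true t) = halve true (x_ n t).
Proof.
case: t => t ht; apply: circle_inj; have /andP[t0 t1] := ht; rewrite /=.
case: ifP => h; last by congr ((xfun n _ + 1) / 2); lra.
(* The remaining case is t = 0: the point 1/2 falls into the identity branch, consistently because 0
   is fixed by [xfun n]. *)
by rewrite (_ : t = 0) ?xfun0; lra.
Qed.

Lemma f_half_maps b : maps (@f_half R) [:: b] [:: ~~ b].
Proof.
move=> [t ht]; apply: circle_inj; have /andP[t0 t1] := ht.
by rewrite /= /half_turn; case: b => /=; case: ifP => h; lra.
Qed.

Definition xx n : circle R -> circle R := lr_comp (x_ n) (x_ n.+1).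

Lemma xxS_maps0 n : maps (xx n.+1) [:: false] [:: false].
Proof. by move=> t; rewrite /xx /lr_comp /= !xS_halve0. Qed.

Lemma xxS_maps n p q : maps (xx n) p q -> maps (xx n.+1) (true :: p) (true :: q).
Proof. by move=> h t; rewrite /xx /lr_comp /= !xS_halve1 -h. Qed.

Fixpoint xx_tree (t : tree) n : tree := if n is n'.+1 then Node Leaf (xx_tree t n') else t.

(** Below the vertex reached by n right turns, [xx n] acts as [xx 0] acts on the whole circle; its
    trees are those of [xx 0] hung at the end of a right spine of length n. *)
Definition xx_triple n : triple :=
  let c := Node Leaf Leaf in
  Triple (xx_tree (Node (Node Leaf c) Leaf) n) (xx_tree (Node Leaf (Node Leaf c)) n) 1.

Definition xx_leaves : seq (seq bool * seq bool) :=
  [:: ([:: false; false], [:: false]);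
      ([:: false; true; false], [:: true; false]);
      ([:: false; true; true], [:: true; true; false]);
      ([:: true], [:: true; true; true])].

Lemma xx0_maps p q : (p, q) \in xx_leaves -> maps (xx 0) p q.
Proof.
have x1 p' q' : maps (@x_ R 0) p' q' -> maps (@x_ R 1) (true :: p') (true :: q').
  by move=> h t; rewrite /= xS_halve1 h.
rewrite /xx_leaves !inE => /or4P[] /eqP[-> ->].
- apply: maps_comp x0_maps00 _ => t; exact: xS_halve0.
- apply: (maps_comp (q := [:: true; false; false])) (x1 _ _ x0_maps00).
  exact: (maps_cat [:: false] x0_maps01).
- apply: (maps_comp (q := [:: true; false; true])) (x1 _ _ x0_maps01).
  exact: (maps_cat [:: true] x0_maps01).
- exact: maps_comp x0_maps1 (x1 _ _ x0_maps1).
Qed.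

Lemma vecT_pairs T S n (g : circle R -> circle R) : wf_triple (Triple T S n) ->
  (forall p q, (p, q) \in zip (leaves T) (rot n.-1 (leaves S)) ->
    maps g p q /\ same_run p q) -> vecT g.
Proof.
move=> wf h; apply/vecTP; exists (Triple T S n); split.
  by apply/represents_maps; split=> // p q /(leaf_identified_zip _ _ wf)/h[].
by split=> // p q /(leaf_identified_zip _ _ wf)/h[].
Qed.

Lemma vecT_f_half : vecT (@f_half R).
Proof.
apply: (@vecT_pairs (Node Leaf Leaf) (Node Leaf Leaf) 2) => // p q.
by rewrite /= !inE => /orP[] /eqP[-> ->]; split=> //; apply: f_half_maps.
Qed.

Lemma vecT_xx n : vecT (xx n).
Proof.
have mapC (b : bool) (s t : seq (seq bool)) p q :
    (p, q) \in zip (map (cons b) s) (map (cons b) t) ->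
    exists p' q', [/\ p = b :: p', q = b :: q' & (p', q') \in zip s t].
  elim: s t => [|x s IH] [|y t] //=; rewrite inE => /orP[/eqP[-> ->]|/IH].
    by exists x, y; rewrite mem_head.
  by move=> [p' [q' [-> -> h]]]; exists p', q'; rewrite inE h orbT.
(* The runs are compared from every state [s], because the prefix [true] of the induction step
   changes the state in which the words are read. *)
have step m p q : (p, q) \in zip (leaves (tdom (xx_triple m))) (leaves (tran (xx_triple m))) ->
    maps (xx m) p q /\ forall s, foldl ef_step s p = foldl ef_step s q.
  elim: m p q => [|m IH] p q.
    move=> h; split; first exact: xx0_maps.
    by move=> s; move: h; rewrite /= !inE => /or4P[] /eqP[-> ->] //=; case: s.
  rewrite /= inE => /orP[/eqP[-> ->]|]; first by split=> //; apply: xxS_maps0.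
  move=> /mapC[p' [q' [-> -> /IH[hm hr]]]]; split; first exact: xxS_maps.
  by move=> s; apply: hr.
have wf : wf_triple (xx_triple n).
  split; last exact: leaves_gt0.
  by elim: n => //= m; rewrite !size_map => ->.
by apply: (vecT_pairs wf) => p q; rewrite rot0 => /step[? r]; split=> //; apply: r.
Qed.

End Generators.

(** * Cores *)

Section Quotients.
Variables (G : lgraph) (E : vert G -> vert G -> Prop).
Hypotheses (Erefl : forall u, E u u) (Esym : forall u v, E u v -> E v u).
Hypothesis Etrans : forall u v w, E u v -> E v w -> E u w.

Definition qclass (u : vert G) : vert (quot_graph E) :=
  exist (fun A : set (vert G) => exists u, A = [set v | E u v]%classic) _
        (ex_intro _ u erefl).

Lemma qclass_eq u v : E u v -> qclass u = qclass v.
Proof.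
move=> h; apply: eq_exist => /=; apply: funext => w; apply: propext; split.
  by apply: Etrans; apply: Esym.
exact: Etrans.
Qed.

Lemma qclass_mem (A : vert (quot_graph E)) u : sval A u -> A = qclass u.
Proof.
case: A => A [v ev] /= hu; apply: eq_exist; rewrite ev in hu *.
by have := qclass_eq hu; move/(congr1 sval).
Qed.

Lemma qclass_inv u v : qclass u = qclass v -> E u v.
Proof. by move/(congr1 (fun A => sval A v)) => /= ->. Qed.

Lemma qclass_surj (A : vert (quot_graph E)) : exists u, sval A u.
Proof. by case: A => A hA; have [u eA] := hA; exists u; rewrite /= eA; apply: Erefl. Qed.

Lemma edge_qclass b u v : edge b u v -> edge b (qclass u) (qclass v).
Proof. by exists u, v; split=> //=; apply: Erefl. Qed.

Definition qrepr (A : vert (quot_graph E)) : vert G := projT1 (cid (qclass_surj A)).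

Lemma qreprP A : qclass (qrepr A) = A.
Proof. by rewrite /qrepr; case: cid => u /= /qclass_mem. Qed.

Lemma qrepr_class u : E u (qrepr (qclass u)).
Proof. by apply: qclass_inv; rewrite qreprP. Qed.

End Quotients.

Section DiagramVertices.
Variable d : triple.

Local Notation glue := (clos_refl_sym_trans _ (@leaf_glue d)).

Lemma glue_refl u : glue u u. Proof. exact: rst_refl. Qed.
Lemma glue_sym u v : glue u v -> glue v u. Proof. exact: rst_sym. Qed.
Lemma glue_trans u v w : glue u v -> glue v w -> glue u w.
Proof. exact: rst_trans. Qed.

Definition dclass (u : vert (two_trees d)) : vert (diagram d) := qclass glue u.

Lemma two_trees_rcons (u : vert (two_trees d)) p b : (val u).2 = rcons p b ->
  forall c, exists v w : vert (two_trees d),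
    [/\ val v = ((val u).1, p), val w = ((val u).1, rcons p c), edge b v u & edge c v w].
Proof.
case: u => [[s q] hq] /= eq c; rewrite eq in hq.
have [hp hc] := nodes_rcons c hq.
exists (Sub (s, p) hp), (Sub (s, rcons p c) hc); split=> //=.
by rewrite eq.
Qed.

Lemma glue_run (u v : vert (two_trees d)) : leafwise same_run d ->
  glue u v -> ef_run (val u).2 = ef_run (val v).2.
Proof.
move=> [_ h]; elim=> [x y [_ _ /h]|x|x y _ ->|x y z _ -> _ ->] //.
Qed.

End DiagramVertices.

Section Core.
Variable ds : seq triple.

Local Notation G := (coprod_graph (fun i => diagram (tnth (in_tuple ds) i))).
Local Notation K := (core ds).

Definition kclass (u : vert G) : vert K := qclass (@fold_eq G) u.

Lemma kclass_eq (u v : vert G) : fold_eq u v -> kclass u = kclass v.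
Proof. by apply: qclass_eq; [apply: fold_sym|apply: fold_trans]. Qed.

Lemma kclass_mem (A : vert K) (u : vert G) : sval A u -> A = kclass u.
Proof. by apply: qclass_mem; [apply: fold_sym|apply: fold_trans]. Qed.

Lemma kclass_inv (u v : vert G) : kclass u = kclass v -> fold_eq u v.
Proof. by apply: qclass_inv; apply: fold_refl. Qed.

Lemma core_edge b (A B : vert K) : edge b A B ->
  exists u v : vert G, [/\ A = kclass u, B = kclass v & edge b u v].
Proof. by move=> [u [v [/kclass_mem-> /kclass_mem-> h]]]; exists u, v. Qed.

Lemma core_det b (A B B' : vert K) : edge b A B -> edge b A B' -> B = B'.
Proof.
move=> /core_edge[u [v [-> -> h]]] /core_edge[u' [v' [/kclass_inv e -> h']]].
exact: (kclass_eq (fold_children h h' e)).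
Qed.

Lemma diagram_edge d b (A B : vert (diagram d)) : edge b A B ->
  exists u v : vert (two_trees d), [/\ A = dclass u, B = dclass v & edge b u v].
Proof.
have mem := qclass_mem (@glue_sym d) (@glue_trans d).
by move=> [u [v [/mem-> /mem-> h]]]; exists u, v.
Qed.

Lemma edge_dclass d b (u v : vert (two_trees d)) :
  edge b u v -> edge b (dclass u) (dclass v).
Proof. exact: (edge_qclass (@glue_refl d)). Qed.

Lemma coprod_full b c (u v : vert G) : edge b u v -> exists w, edge c u w.
Proof.
case=> i {u v} A B /diagram_edge[u [v [-> _ h]]].
have [u' [w [eu' _ _ huw]]] := two_trees_rcons (congr1 snd h) c.
exists (existT _ i (dclass w)); constructor.
suff -> : u = u' by apply: edge_dclass.
by apply: val_inj; rewrite eu' h /= -surjective_pairing.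
Qed.

Lemma core_full b c (A B : vert K) : edge b A B -> exists B', edge c A B'.
Proof.
move=> /core_edge[u [v [-> _ /(coprod_full c)[w h]]]]; exists (kclass w).
exact: (edge_qclass (@fold_refl G) h).
Qed.

(** The left and the right edge of [A] may come from different vertices of the diagrams.
    [coprod_full] supplies both children of a single one, and folding children matches them, so that
    [fold_parents] applies. *)
Lemma core_codet (A B C D : vert K) : edge false A C -> edge true A D ->
  edge false B C -> edge true B D -> A = B.
Proof.
move=> /core_edge[a [c [-> -> ac]]] /core_edge[a' [d [/kclass_inv aa' -> ad]]].
move=> /core_edge[b [c' [-> /kclass_inv cc' bc]]].
move=> /core_edge[b' [d' [/kclass_inv bb' /kclass_inv dd' bd]]].
have [d1 ad1] := coprod_full true ac; have [d2 bd2] := coprod_full true bc.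
have e1 := fold_children ad1 ad aa'; have e2 := fold_children bd2 bd bb'.
apply: kclass_eq; apply: (fold_parents ac ad1 bc bd2 cc').
exact: (fold_trans e1 (fold_trans dd' (fold_sym e2))).
Qed.

Lemma core_root (A B : vert K) : Defs.root A -> Defs.root B -> A = B.
Proof.
move=> [u [/kclass_mem-> hu]] [v [/kclass_mem-> hv]].
exact: (kclass_eq (fold_root hu hv)).
Qed.

Definition tree_vertex d (s : bool) p (h : p \in nodes (if s then tran d else tdom d)) :
  vert (two_trees d) := exist (fun v : bool * seq bool =>
    is_true (v.2 \in nodes (if v.1 then tran d else tdom d))) (s, p) h.

Definition side i (s : bool) :=
  if s then tran (tnth (in_tuple ds) i) else tdom (tnth (in_tuple ds) i).

Definition core_vertex i s p
    (h : p \in nodes (side i s)) :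
    vert K :=
  kclass (existT _ i (dclass (tree_vertex h))).

Lemma core_vertex_root i s
    (h : [::] \in nodes (side i s)) :
  Defs.root (core_vertex h).
Proof.
exists (existT _ i (dclass (tree_vertex h))); split; first exact: fold_refl.
by exists (tree_vertex h); split=> //; apply: rst_refl.
Qed.

Lemma core_vertex_edge i s p b
    (h : p \in nodes (side i s))
    (h' : rcons p b \in nodes (side i s)) :
  edge b (core_vertex h) (core_vertex h').
Proof.
apply: (edge_qclass (@fold_refl G)); constructor; exact: edge_dclass.
Qed.

Lemma core_vertex_glue i p q
    (hp : p \in nodes (side i false))
    (hq : q \in nodes (side i true)) :
  leaf_identified (tnth (in_tuple ds) i) p q -> @core_vertex i false p hp = @core_vertex i true q hq.
Proof.
move=> h; congr (kclass (existT _ i _)).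
apply: (qclass_eq (@glue_sym _) (@glue_trans _)); apply: rst_step.
by split.
Qed.

End Core.

(** * Acceptance by the core implies agreement of states *)

Section CoreStates.
Variable ds : seq triple.
Hypothesis ds_run : forall i, leafwise same_run (tnth (in_tuple ds) i).

Local Notation G := (coprod_graph (fun i => diagram (tnth (in_tuple ds) i))).
Local Notation K := (core ds).

Definition diagram_state d (A : vert (diagram d)) : bool :=
  ef_run (val (qrepr (@glue_refl d) A)).2.

Lemma diagram_state_class d (u : vert (two_trees d)) : leafwise same_run d ->
  diagram_state (dclass u) = ef_run (val u).2.
Proof.
move=> hd; apply/esym/(glue_run hd).
exact: (qrepr_class (@glue_refl d) (@glue_sym d) (@glue_trans d)).
Qed.

Lemma coprod_state_edge b (u v : vert G) : edge b u v ->
  diagram_state (projT2 v) = ef_step (diagram_state (projT2 u)) b.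
Proof.
case=> i {u v} A B /diagram_edge[u [v [-> -> h]]] /=.
by rewrite !diagram_state_class // h /= /ef_run foldl_rcons.
Qed.

(** Each folding rule preserves states, so the core maps to the two-state automaton. For the
    identification of parents this holds because a right child has the state opposite to that of its
    parent. *)
Lemma fold_state (u v : vert G) : fold_eq u v ->
  diagram_state (projT2 u) = diagram_state (projT2 v).
Proof.
have root_state (w : vert G) : Defs.root w -> diagram_state (projT2 w) = false.
  move=> [x [hx ex]].
  have -> : projT2 w = dclass x.
    exact: (qclass_mem (@glue_sym _) (@glue_trans _) hx).
  by rewrite diagram_state_class // ex.
elim=> {u v} //.
- by move=> u v w _ -> _ ->.
- by move=> u v /root_state-> /root_state->.
- by move=> b u v u' v' /coprod_state_edge-> /coprod_state_edge-> _ ->.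
- move=> u v u0 u1 v0 v1 _ /coprod_state_edge-> _ /coprod_state_edge-> _ _ _.
  by move/negb_inj.
Qed.

Definition core_state (A : vert K) : bool :=
  diagram_state (projT2 (qrepr (@fold_refl G) A)).

Lemma core_state_class u : core_state (kclass u) = diagram_state (projT2 u).
Proof.
apply/esym/fold_state.
exact: (qrepr_class (@fold_refl G) (@fold_sym G) (@fold_trans G)).
Qed.

Lemma core_state_edge b (A B : vert K) : edge b A B ->
  core_state B = ef_step (core_state A) b.
Proof.
by move=> /core_edge[u [v [-> -> /coprod_state_edge]]]; rewrite !core_state_class.
Qed.

Lemma core_state_root (A : vert K) : Defs.root A -> core_state A = false.
Proof.
move=> [u [/kclass_mem-> [x [hx ex]]]]; rewrite core_state_class.
have -> : projT2 u = dclass x.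
  exact: (qclass_mem (@glue_sym _) (@glue_trans _) hx).
by rewrite diagram_state_class // ex.
Qed.

(** Along the accepting homomorphism, core states obey the recursion of [ef_run] from the root, so
    they are the runs. Identified leaves are one vertex of the diagram and hence have one state. *)
Lemma accepted_same_run d : wf_triple d -> accepted ds d -> leafwise same_run d.
Proof.
move=> wf [h [hedge hroot]]; split=> // p q hpq.
have run (u : vert (two_trees d)) : core_state (h (dclass u)) = ef_run (val u).2.
  move eu2 : (val u).2 => r; elim/last_ind: r u eu2 => [|r b IH] u eu.
    rewrite core_state_root //; apply: hroot; exists u; split=> //.
    exact: rst_refl.
  have [v [w [ev ew evu _]]] := two_trees_rcons eu b.
  rewrite (core_state_edge (hedge _ _ _ (edge_dclass evu))) (IH v) ?ev //.
  by rewrite /ef_run foldl_rcons.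
have hp : p \in nodes (tdom d).
  by case: hpq => i [hi -> _]; apply/leaves_nodes/mem_nth.
have hq : q \in nodes (tran d).
  case: hpq => i [hi _ ->]; apply/leaves_nodes/mem_nth.
  by have [es _] := wf; rewrite -es leaf_image_lt.
pose u : vert (two_trees d) := tree_vertex (s := false) hp.
pose v : vert (two_trees d) := tree_vertex (s := true) hq.
have e : dclass u = dclass v.
  by apply: (qclass_eq (@glue_sym d) (@glue_trans d)); apply: rst_step; split.
by have := run u; rewrite e run.
Qed.

End CoreStates.

(* The core with a free binary tree of new vertices hung below each vertex
   without children, so that every word can be read from every vertex. *)
Section CompletedCore.
Variable ds : seq triple.
Local Notation K := (core ds).

Definition complete_step (s : vert K * seq bool) (b : bool) : vert K * seq bool :=
  if s.2 is [::] then
    match pselect (exists B, edge b s.1 B) with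
    | left h => (projT1 (cid h), [::])
    | right _ => (s.1, [:: b])
    end
  else (s.1, rcons s.2 b).

Lemma complete_step_edge b (A B : vert K) : edge b A B ->
  complete_step (A, [::]) b = (B, [::]).
Proof.
move=> h; rewrite /complete_step /=; case: pselect => [h'|[]]; last by exists B.
by congr pair; case: cid => B' /= /(core_det h).
Qed.

Lemma complete_step_inner s b (B : vert K) : complete_step s b = (B, [::]) ->
  exists2 A, s = (A, [::]) & edge b A B.
Proof.
case: s => A [|c w]; last by [].
rewrite /complete_step /=; case: pselect => [h|_] //.
by move=> [<-]; exists A => //; case: cid.
Qed.

Lemma complete_step_outer s b (A : vert K) w : complete_step s b = (A, w) ->
  w != [::] -> s = (A, take (size w).-1 w).
Proof.
case: s => A' [|c w'].
  rewrite /complete_step /=; case: pselect => [h|_] [<- <-] //.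
by move=> [<- <-] _ /=; rewrite size_rcons /= -cats1 take_size_cat.
Qed.

(** A child inside the core arises only from an edge of the core, and then the other child lies in
    the core as well, so [core_codet] applies. A child outside the core records its parent in its
    word. *)
Lemma complete_step_codet s s' :
  (forall b, complete_step s b = complete_step s' b) -> s = s'.
Proof.
move=> h; have := h false; case e0 : (complete_step s' false) => [A [|c w]] h0.
  have [B es B0] := complete_step_inner h0; have [B' es' B'0] := complete_step_inner e0.
  have [C BC] := core_full true B0; have := h true.
  rewrite es (complete_step_edge BC) => /esym/complete_step_inner[B''].
  by rewrite es' => -[<-] B'C; rewrite (core_codet B0 BC B'0 B'C).
by rewrite (complete_step_outer h0) // (complete_step_outer e0).
Qed.

Variable i0 : 'I_(size ds).

Definition the_root : vert K := @core_vertex ds i0 false [::] (nil_nodes _).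

Definition complete_run (p : seq bool) := foldl complete_step (the_root, [::]) p.

Lemma complete_run_vertex i s p (h : p \in nodes (@side ds i s)) :
  complete_run p = (core_vertex h, [::]).
Proof.
elim/last_ind: p h => [|p b IH] h.
  by congr pair; apply: core_root; apply: core_vertex_root.
have [hp _] := nodes_rcons b h; rewrite /complete_run foldl_rcons.
rewrite -/(complete_run p) (IH hp); apply: complete_step_edge.
exact: core_vertex_edge.
Qed.

Lemma leafwise_complete_run i : wf_triple (tnth (in_tuple ds) i) ->
  leafwise (fun p q => complete_run p = complete_run q) (tnth (in_tuple ds) i).
Proof.
move=> wf; split=> // p q hpq.
have hp : p \in nodes (@side ds i false).
  by case: hpq => j [hj -> _]; apply/leaves_nodes/mem_nth.
have hq : q \in nodes (@side ds i true).
  case: hpq => j [hj _ ->]; apply/leaves_nodes/mem_nth.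
  by have [es _] := wf; rewrite -es leaf_image_lt.
by rewrite (complete_run_vertex hp) (complete_run_vertex hq) (core_vertex_glue _ _ hpq).
Qed.

End CompletedCore.

(** * The closure of vecT *)

Section Closure.
Variable R : realType.
Implicit Types g : circle R -> circle R.

Definition respects Q (delta : Q -> bool -> Q) q0 g : Prop :=
  forall p q, maps g p q -> foldl delta q0 p = foldl delta q0 q.

(** The difficulty is the product: a word sent to a word by the composite of [f] and [g] need not be
    sent to a word by [f] alone. After enough letters are appended it is, because [f] has a triple;
    codeterminism removes the letters again. *)
Lemma generated_respects (ys : seq (circle R -> circle R)) Q (delta : Q -> bool -> Q) q0 g :
  (forall s s', (forall b, delta s b = delta s' b) -> s = s') ->
  (forall h, generated ys h -> thompsonT h) ->
  (forall y, List.In y ys -> respects delta q0 y) ->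
  generated ys g -> respects delta q0 g.
Proof.
move=> codet tame hys; elim=> {g}.
- by move=> p q h; congr foldl; apply: cone_fun_inj (R) _ _ _ => t; rewrite -h.
- by move=> y /hys.
- move=> f g gf hf _ hg p q hpq.
  have [d /represents_maps[[es _] hd]] := tame _ gf.
  have [N hN] := leaves_cover (tdom d).
  apply: (run_codet codet (n := N)) => w sw.
  have [|l [w' [hl e]]] := hN (p ++ w); first by rewrite size_cat sw leq_addl.
  have [r hr] : exists r, maps f (p ++ w) r.
    set l' := nth [::] (leaves (tran d)) (leaf_image d (index l (leaves (tdom d)))).
    exists (l' ++ w'); rewrite e; apply/maps_cat/hd.
    exists (index l (leaves (tdom d))); rewrite index_mem nth_index //.
  rewrite (hf _ _ hr); apply: hg => t; rewrite -hr.
  exact: (maps_cat w hpq).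
- move=> f g _ hf fK gK p q h; apply/esym/hf => t.
  by rewrite -h gK.
Qed.

Lemma Forall2_tnth (T U : Type) (P : T -> U -> Prop) (s : seq T) (t : seq U) :
  List.Forall2 P s t -> forall i, exists2 u, List.In u t & P (tnth (in_tuple s) i) u.
Proof.
move=> h i; rewrite (tnth_nth (tnth (in_tuple s) i)) /=.
move: (tnth _ _) (ltn_ord i) => x0; elim: h (val i) => {i} [|x u s' t' hxu _ IH] [|i] //=.
  by move=> _; exists u => //; left.
by rewrite ltnS => /IH[v hv h]; exists v => //; right.
Qed.

Lemma Forall2_In (T U : Type) (P : T -> U -> Prop) (s : seq T) (t : seq U) u :
  List.Forall2 P s t -> List.In u t -> exists i, P (tnth (in_tuple s) i) u.
Proof.
move=> h hu; suff [i [hi hP]] : exists i, (i < size s)%N /\ forall x0, P (nth x0 s i) u.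
  by exists (Ordinal hi); rewrite (tnth_nth (tnth (in_tuple s) (Ordinal hi))).
elim: h hu => //= x v s' t' hxv _ IH [<-|/IH[i [hi hP]]]; first by exists 0.
by exists i.+1.
Qed.

(** Isolates what is needed of a generating list: it lies in [vecT], and an automaton respected by
    it is respected by f_{1/2} and x_0 x_1. This serves both the four given generators and an
    arbitrary list that generates [vecT]. *)
Lemma closureC_vecT (ys : seq (circle R -> circle R)) :
  (forall y, List.In y ys -> vecT y) ->
  (forall Q (delta : Q -> bool -> Q) q0,
     (forall s s', (forall b, delta s b = delta s' b) -> s = s') ->
     (forall y, List.In y ys -> respects delta q0 y) ->
     respects delta q0 (@f_half R) /\ respects delta q0 (@xx R 0)) ->
  closureC ys = @vecT R.
Proof.
move=> hys hresp; apply: funext => g; apply: propext; split.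
  move=> [hg [ds [d [hds [_ hd] acc]]]]; apply/vecTP; exists d; split=> //.
  apply: (@accepted_same_run ds) => [i||//]; last by case: hd.
  have [y /hys hy [_ rep]] := Forall2_tnth hds i.
  exact: vecT_same_run hy rep.
move=> hg; split; first by case: hg.
have [ds hds] : exists ds, List.Forall2 (@reduced_triple_of R) ds ys.
  elim: ys hys {hresp} => [|y ys IH] h; first by exists [::].
  have [|ds hds] := IH; first by move=> z hz; apply: h; right.
  have [|d hd] := @vecT_reduced _ y; first by apply: h; left.
  by exists (d :: ds); constructor.
have [d rd] := vecT_reduced hg; exists ds, d; split=> //.
have sz0 : (0 < size ds)%N.
  case: ds hds => // hds; have : ys = [::] by inversion hds.
  (* An empty list would respect the free automaton, whose state is the word read so far; but
     f_{1/2} sends the word 0 to the word 1. *)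
  move=> eys; have [] := @hresp (seq bool) (fun s b => rcons s b) [::].
  - by move=> s s' /(_ true)/rcons_inj[].
  - by rewrite eys.
  - by move=> /(_ _ _ (@f_half_maps R false)).
have [hfh hxx] : respects (@complete_step ds) (the_root (Ordinal sz0), [::]) (@f_half R) /\
      respects (@complete_step ds) (the_root (Ordinal sz0), [::]) (@xx R 0).
  apply: hresp; first exact: complete_step_codet.
  move=> y hy p q; have [i [_ rep]] := Forall2_In hds hy.
  apply: (maps_run (@complete_step_codet ds) rep); apply: leafwise_complete_run.
  by case: rep.
pose rt := the_root (Ordinal sz0).
have e1 := hfh _ _ (@f_half_maps R false).
have in_xx p q : (p, q) \in xx_leaves -> foldl (@complete_step ds) (rt, [::]) p =
   foldl (@complete_step ds) (rt, [::]) q by move=> h; apply/hxx/xx0_maps.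
have := in_xx [:: false; false] [:: false] isT.
have := in_xx [:: false; true; false] [:: true; false] isT.
have := in_xx [:: true] [:: true; true; true] isT.
move: e1; rewrite /=.
(* Write [f] for the left child of the root. f_{1/2} makes it the right child too, and the leaf
   pairs of x_0 x_1 then say that f = f11, f10 = f0 and f0 = f. *)
set f := complete_step (rt, [::]) false => e0; rewrite -e0 => e3 e2 e1.
(* [f] lies in the core itself: in an added free tree, f0 = f would equate a word with a longer
   one. *)
have [v [ef vv]] : exists v, f = (v, [::]) /\ edge false v v.
  case: f e1 {e0 e2 e3} => v [|b w] /=; first by move=> /complete_step_inner[A [<-]]; exists v.
  by move=> [/(congr1 size)/eqP]; rewrite size_rcons; lia.
have [s vs] := core_full true vv.
rewrite ef !(complete_step_edge vv) !(complete_step_edge vs) in e2 e3.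
have [_ [<-] s0] := complete_step_inner e2.
have [_ [<-] s1] := complete_step_inner (esym e3).
have [_ [<-] r0] := complete_step_inner ef.
rewrite ef in e0; have [_ [<-] r1] := complete_step_inner (esym e0).
(* Both children of the root and both children of [s] are [v], so [s] is the root: the states e and
   f are realized by [s] and [v]. *)
have ers := core_codet r0 r1 s0 s1.
have run : leafwise same_run d by apply: vecT_same_run hg _; case: rd.
exists (fun A => if diagram_state A then v else s); split=> [b A B|A [u [hu eu]]].
  move=> /diagram_edge[u [w [-> -> h]]]; rewrite !diagram_state_class // h /=.
  rewrite /ef_run foldl_rcons -/(ef_run _).
  by case: (ef_run _); case: b {h} => /=.
have -> : A = dclass u by exact: (qclass_mem (@glue_sym _) (@glue_trans _) hu).
by rewrite diagram_state_class // eu /= -ers; apply: core_vertex_root.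
Qed.

Lemma closureC_vecT_gens : closureC (vecT_gens R) = @vecT R.
Proof.
apply: closureC_vecT => [y|Q delta q0 _ h].
  by case=> [<-|[<-|[<-|[<-|//]]]]; [apply: vecT_xx|apply: vecT_xx|apply: vecT_xx|apply: vecT_f_half].
by split; apply: h; [do 3!right; left|left].
Qed.

Lemma closureC_generators (ys : seq (circle R -> circle R)) :
  generated ys = @vecT R -> closureC ys = @vecT R.
Proof.
move=> hgen; apply: closureC_vecT => [y hy|Q delta q0 codet h].
  by rewrite -hgen; apply: generated_in.
have tame f : generated ys f -> thompsonT f by rewrite hgen => -[].
split; apply: (generated_respects codet tame h); rewrite hgen.
  exact: vecT_f_half.
exact: vecT_xx.
Qed.

End Closure.

Local Close Scope ring_scope.

(** * Built complexes *)

Section GoodComplexes.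
Variable X : Type.
Implicit Types K L : complex X.

(** The trace of planarity that is used: the inner path is a simple closed path, an edge has at most
    one cell on each side, and edges of the inner and outer paths have none on the side of the
    boundary. *)
Record good K : Prop := Good {
  good_gt0 : (0 < size (innp K))%N;
  good_path : innv K :: map (@tgt _ K) (innp K) = rcons (map (@src _ K) (innp K)) (innv K);
  good_uniq : uniq (map (@src _ K) (innp K));
  good_top_innp : forall c e, e \in top c -> e \notin innp K;
  good_top_inj : forall (c c' : cC K) e, e \in top c -> e \in top c' -> c = c';
  good_bot_inj : forall (c c' : cC K) e, e \in bot c -> e \in bot c' -> c = c';
  good_bot_outp : forall (c : cC K) e, e \in bot c -> e \notin outp K }.

Lemma good_split K (p q : seq (cE K)) : good K -> innp K = p ++ q ->
  map (@src _ K) p = belast (innv K) (map (@tgt _ K) p) /\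
  last (innv K) (map (@tgt _ K) p) :: map (@tgt _ K) q = rcons (map (@src _ K) q) (innv K).
Proof.
move=> gK e; have := good_path gK; rewrite e !map_cat -cat_cons lastI cat_rcons.
rewrite rcons_cat; move/eqP; rewrite eqseq_cat; last by rewrite size_belast !size_map.
by move=> /andP[/eqP-> /eqP->].
Qed.

(** The inner vertex is read off the path instead of being accumulated along rotations. Rotations
    with the same resulting path therefore give equal complexes. *)
Definition set_inner K (l : seq (cE K)) : complex X :=
  {| cV := cV K; cE := cE K; cC := cC K;
     src := @src _ K; tgt := @tgt _ K; lab := @lab _ K;
     top := @top _ K; bot := @bot _ K;
     outp := outp K; outv := outv K;
     innp := l; innv := head (innv K) (map (@src _ K) l) |}.

Lemma rot_innerE i K : good K -> rot_inner i K = set_inner (rot i (innp K)).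
Proof.
move=> gK; rewrite /rot_inner /set_inner; congr Complex.
have e : innp K = take i (innp K) ++ drop i (innp K) by rewrite cat_take_drop.
have [e1 e2] := good_split gK e; rewrite /rot map_cat.
case: (drop i (innp K)) e e1 e2 => [|x l] /= e e1 e2; last by case: e2.
rewrite cats0 in e; rewrite -e in e1 e2 *; case: e2 => ->.
by have := good_path gK; have := good_gt0 gK; case: (innp K) => //= y s _ [].
Qed.

Lemma set_inner_id K : good K -> set_inner (innp K) = K.
Proof.
move=> gK; have := good_path gK; have := good_gt0 gK; rewrite /set_inner {gK}.
by case: K => V E C s t l tp bt op ov [|x ip] iv //= _ [<- _].
Qed.

Lemma good_rot i K : good K -> good (rot_inner i K).
Proof.
move=> gK; have := gK; case=> g0 gp gu g5 g6 g7 g8; split=> //=.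
- by rewrite size_rot.
- have [|e1 e2] := @good_split K (take i (innp K)) (drop i (innp K)) gK.
    by rewrite cat_take_drop.
  rewrite /rot !map_cat -cat_cons e2 cat_rcons -cats1 -catA; congr cat.
  by rewrite lastI e1 cats1.
- by rewrite map_rot rot_uniq.
- by move=> c e /g5; rewrite mem_rot.
Qed.

Section GoodAttach.
Variables (K : complex X) (p q : seq (cE K)) (s : seq X).
Hypotheses (gK : good K) (epq : innp K = p ++ q).
Hypotheses (p0 : (0 < size p)%N) (s0 : (0 < size s)%N).

Local Notation nv := (new_vertex p s).

Lemma attach_src_inner :
  map (@src _ (attach p q s)) (innp (attach p q s)) =
  map nv (iota 0 (size s)) ++ map inl (map (@src _ K) q).
Proof.
rewrite /= map_cat -!map_comp; congr cat.
by rewrite -enumT -val_enum_ord -map_comp.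
Qed.

Lemma attach_tgt_inner :
  map (@tgt _ (attach p q s)) (innp (attach p q s)) =
  map nv (iota 1 (size s)) ++ map inl (map (@tgt _ K) q).
Proof.
rewrite /= map_cat -!map_comp; congr cat.
by rewrite -enumT -(addn0 1%N) iotaDl -val_enum_ord -!map_comp.
Qed.

Lemma new_vertex_end : nv (size s) = inl (last (innv K) (map (@tgt _ K) p)).
Proof.
move: s0; rewrite /new_vertex; case: s => [//|x s' _] /=.
by rewrite insubF // ltnn.
Qed.

Lemma map_new_vertex : map nv (iota 0 (size s)) =
  inl (innv K) :: map inr (enum 'I_(size s).-1).
Proof.
move: s0; rewrite /new_vertex; case: s => [//|x s' _] /=; congr cons.
rewrite -(addn0 1%N) iotaDl -val_enum_ord -!map_comp; apply: eq_map => i /=.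
by rewrite valK.
Qed.

Lemma good_attach : good (attach p q s).
Proof.
have [e1 e2] := good_split gK epq; have := gK; case=> _ _ gu g5 g6 g7 g8.
have sp0 : innv K = head (innv K) (map (@src _ K) p).
  by move: p0 e1; case: p => //= x l _ [].
have inl_inj (A B : Type) : injective (@inl A B) by move=> x y [].
split.
- by rewrite /= size_cat size_map size_enum_ord addn_gt0 s0.
- rewrite attach_src_inner attach_tgt_inner -cat_cons.
  have -> : innv (attach p q s) :: map nv (iota 1 (size s)) =
     rcons (map nv (iota 0 (size s))) (nv (size s)).
    by rewrite -map_rcons -cats1 -(iotaD 0 _ 1) addn1.
  rewrite new_vertex_end rcons_cat cat_rcons; congr cat.
  rewrite /= -[inl (last _ _) :: _]/(map inl (_ :: _)) e2.
  by rewrite map_rcons.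
- have inr_inj (A B : Type) : injective (@inr A B) by move=> x y [].
  have u2 : uniq (map (@src _ K) q).
    by move: gu; rewrite epq map_cat cat_uniq => /and3P[].
  rewrite attach_src_inner map_new_vertex cat_uniq cons_uniq.
  rewrite (map_inj_uniq (@inr_inj _ _)) (map_inj_uniq (@inl_inj _ _)) u2 enum_uniq.
  rewrite !andbT; apply/andP; split; first by apply/mapP => -[].
  apply/hasPn => v /mapP[w hw ->]; rewrite inE negb_or; apply/andP; split; last by apply/mapP => -[].
  apply/eqP => -[ew]; move: gu; rewrite epq map_cat cat_uniq => /and3P[_ /hasPn/(_ w hw)].
  by rewrite ew sp0; case: p p0 => //= x l _; rewrite mem_head.
- have nin (c : cC (attach p q s)) e : e \in top c -> exists2 e', e = inl e' & e' \notin q.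
    case: c => [c|] /mapP[e' he' ->]; exists e' => //.
      by have := g5 _ _ he'; rewrite epq mem_cat negb_or => /andP[].
    apply/negP => hq; move: gu; rewrite epq map_cat cat_uniq.
    by move=> /and3P[_ /hasPn/(_ _ (map_f _ hq))]; rewrite map_f.
  move=> c e /nin[e' -> he']; rewrite /= mem_cat negb_or (mem_map (@inl_inj _ _)) he'.
  by rewrite andbT; apply/mapP => -[].
- move=> [c|] [c'|] e //= /mapP[x hx ->]; rewrite (mem_map (@inl_inj _ _)) => hx' //.
  + by rewrite (g6 _ _ _ hx hx').
  + by have := g5 _ _ hx; rewrite epq mem_cat hx'.
  + by have := g5 _ _ hx'; rewrite epq mem_cat hx.
- move=> [c|] [c'|] e //= /mapP[x hx ->].
  + by rewrite (mem_map (@inl_inj _ _)) => /(g7 _ _ _ hx)->.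
  + by move=> /mapP[].
  + by move=> /mapP[].
- move=> [c|] e /= /mapP[x hx ->].
    by rewrite (mem_map (@inl_inj _ _)); apply: (g8 c).
  by apply/mapP => -[].
Qed.

End GoodAttach.

Lemma good_cycle x w : good (cycle_complex x w).
Proof.
split=> //=.
- by rewrite size_enum_ord.
- rewrite map_id; apply: (@inj_map _ _ val); first exact: val_inj.
  rewrite map_rcons /= val_enum_ord -map_comp.
  have -> : [seq (val \o @ordS (size w).+1) i | i <- enum 'I_(size w).+1] =
     [seq (i.+1 %% (size w).+1)%N | i <- iota 0 (size w).+1].
    by rewrite -val_enum_ord -map_comp.
  rewrite -[X in iota 0 X]addn1 iotaD map_cat /= add0n modnn cats1.
  rewrite -rcons_cons; congr rcons; rewrite -(iotaD 0 _ 1) addn1 /=; congr cons.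
  rewrite (iotaDl 1 0); apply/eq_in_map => i; rewrite mem_iota add0n => hi.
  by rewrite modn_small // ltnS add1n.
- by rewrite map_id enum_uniq.
Qed.

Variable rels : seq X -> seq X -> Prop.
Hypothesis rels_gt0 : forall r s, rels r s -> (0 < size r)%N /\ (0 < size s)%N.

Lemma built_good u K : built rels u K -> good K.
Proof.
elim=> [x w _|i L _|L p q r s _ gL epq er hrs]; [exact: good_cycle|exact: good_rot|].
have [p0 s0] : (0 < size p)%N /\ (0 < size s)%N.
  by rewrite -(size_map (@lab _ L)) er; case: hrs => /rels_gt0[].
exact: good_attach.
Qed.

End GoodComplexes.

Section SumMaps.
Variables (A B C : Type) (f : A -> B).

Definition smap (x : A + C) : B + C :=
  match x with inl a => inl (f a) | inr c => inr c end.

Lemma smap_bij : bijective f -> bijective smap.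
Proof.
move=> [g fK gK]; exists (fun x => match x with inl b => inl (g b) | inr c => inr c end).
  by move=> [a|c] //=; rewrite fK.
by move=> [b|c] //=; rewrite gK.
Qed.

End SumMaps.

Lemma mem_zip_inl (A B : eqType) (s t : seq A) a b :
  ((inl a, inl b) \in zip (map (@inl A B) s) (map (@inl A B) t)) = ((a, b) \in zip s t).
Proof. by elim: s t => [|x s IH] [|y t] //=; rewrite !inE IH. Qed.

Lemma zip_eq_inl (A B : eqType) (s t : seq A) a b :
  zip_eq (map (@inl A B) s) (map (@inl A B) t) (inl a) (inl b) <-> zip_eq s t a b.
Proof.
rewrite /zip_eq !mem_zip_inl; split; first by case=> [[->]|h|h]; [constructor 1|constructor 2|constructor 3].
by case=> [->|h|h]; [constructor 1|constructor 2|constructor 3].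
Qed.

Lemma mem_zip_nth_uniq (S T : eqType) (x0 : S) (y0 : T) s t i y :
  size s = size t -> uniq t -> (i < size t)%N -> y = nth y0 t i ->
  forall x, ((x, y) \in zip s t) = (x == nth x0 s i).
Proof.
move=> est ut hi -> x; apply/idP/eqP => [|->].
  move=> /(nthP (x0, y0))[j]; rewrite size1_zip ?est // => hj.
  by rewrite nth_zip // => -[<- /eqP]; rewrite nth_uniq // => /eqP->.
by rewrite -nth_zip // mem_nth // size1_zip est.
Qed.

(** * Attaching and rotating respect isomorphisms and dipole removals *)

Section Congruence.
Variable X : Type.
Implicit Types K L : complex X.

Definition att (k : nat) (s : seq X) K := attach (take k (innp K)) (drop k (innp K)) s.

Lemma new_vertex_map K L (fV : cV K -> cV L) (fE : cE K -> cE L) p (s : seq X) k :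
  innv L = fV (innv K) -> (forall e, e \in p -> tgt (fE e) = fV (tgt e)) ->
  new_vertex (map fE p) s k = smap fV (new_vertex p s k).
Proof.
move=> ev et; case: k => [|j] /=; first by rewrite ev.
case: insub => //=; rewrite ev -map_comp.
have -> : [seq (@tgt _ L \o fE) e | e <- p] = map fV (map (@tgt _ K) p).
  by rewrite -map_comp; apply/eq_in_map => e /et.
by rewrite last_map.
Qed.

Lemma iso_att k s K L : complex_iso K L -> complex_iso (att k s K) (att k s L).
Proof.
move=> [fV [fE [fC [[bV bE bC] [[hs ht hl] [htop hbot [ho hov] [hi hiv]]]]]]].
have ep : take k (innp L) = map fE (take k (innp K)) by rewrite hi map_take.
have hnv j : new_vertex (take k (innp L)) s j =
    smap fV (new_vertex (take k (innp K)) s j).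
  by rewrite ep; apply: new_vertex_map.
exists (smap fV), (smap fE), (omap fC); split; [split|split; split].
- exact: smap_bij.
- exact: smap_bij.
- case: bC => gC fCK gCK; exists (omap gC); first by move=> [c|] //=; rewrite fCK.
  by move=> [c|] //=; rewrite gCK.
- by case=> [e|i]; [rewrite /= hs|exact: hnv].
- by case=> [e|i]; [rewrite /= ht|exact: hnv].
- by move=> [e|i] /=; rewrite ?hl.
- by move=> [c|] /=; rewrite ?htop ?ep -!map_comp.
- by move=> [c|] /=; rewrite ?hbot -!map_comp.
- by rewrite /= ho hov -!map_comp.
- by rewrite /= hiv hi -map_drop !map_cat -!map_comp.
Qed.

Lemma iso_rot i K L : complex_iso K L -> complex_iso (rot_inner i K) (rot_inner i L).
Proof.
move=> [fV [fE [fC [hb [[hs ht hl] [htop hbot ho [hi hiv]]]]]]].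
exists fV, fE, fC; split=> //; split=> //; split=> //=.
rewrite hi map_rot hiv -map_take -map_comp; split=> //.
by rewrite -(last_map fV) -map_comp; congr last; apply: eq_map => e /=; rewrite ht.
Qed.

(** The path inside the dipole is the outer path of [c2], hence disjoint from the inner path of [K].
    The new cell is thus attached to edges that are kept. *)
Lemma dipole_att k s K L : good K -> dipole_removal K L ->
  dipole_removal (att k s K) (att k s L).
Proof.
move=> gK [c1 [c2 [[bt lt] [fV [fE [gC [[sV sE sC] [[eV eE injC] [[hs ht hl]
  [htop hbot [ho hov] [hi hiv]]]]]]]]]]].
have kept e : e \in innp K -> e \notin bot c1.
  by move=> he; apply/negP; rewrite bt => /(good_top_innp gK); rewrite he.
have ep : take k (innp L) = map fE (take k (innp K)) by rewrite hi map_take.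
have hnv j : new_vertex (take k (innp L)) s j =
    smap fV (new_vertex (take k (innp K)) s j).
  by rewrite ep; apply: new_vertex_map => // e /mem_take/kept/ht.
have inl_inj (A B : Type) : injective (@inl A B) by move=> x y [].
have bsrc c : map (@src _ (att k s K)) (map inl (bot c)) = map inl (map (@src _ K) (bot c)).
  by rewrite -!map_comp.
have tsrc c : map (@src _ (att k s K)) (map inl (top c)) = map inl (map (@src _ K) (top c)).
  by rewrite -!map_comp.
have beh (A B : Type) (l : seq A) : behead (map (@inl A B) l) = map inl (behead l).
  by case: l.
exists (Some c1), (Some c2); split.
  by split; rewrite /= ?bt // -!map_comp.
exists (smap fV), (smap fE), (omap gC); split; [split|split; [split|split; split]].
- move=> [v'|i]; last by exists (inr i) => //; rewrite /= bsrc beh; apply/mapP => -[].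
  have [v kv <-] := sV v'; exists (inl v) => //.
  by rewrite /= bsrc beh (mem_map (@inl_inj _ _)).
- move=> [e'|i]; last by exists (inr i) => //; apply/mapP => -[].
  by have [e ke <-] := sE e'; exists (inl e); rewrite //= (mem_map (@inl_inj _ _)).
- have some_inj : injective (@Some (cC K)) by move=> x y [].
  have e12 c : (Some c \in [:: Some c1; Some c2]) = (c \in [:: c1; c2]).
    by rewrite !inE.
  move=> [c|]; last by split=> // _; exists None.
  rewrite e12; split=> [/sC[c' <-]|]; first by exists (Some c').
  by move=> [[c'|] // [ec]]; apply/sC; exists c'.
- move=> [v|i] [w|j] /=; rewrite !bsrc !tsrc beh ?(mem_map (@inl_inj _ _)) => kv kw.
  + rewrite zip_eq_inl -eV //; split=> [[]|->] //.
  + by split=> // -[//|/mem_zip[_ /mapP[]]|/mem_zip[/mapP[]]].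
  + by split=> // -[//|/mem_zip[/mapP[]]|/mem_zip[_ /mapP[]]].
  + split=> [[->]|]; first by constructor 1.
    by move=> [[->]|/mem_zip[/mapP[]]|/mem_zip[/mapP[]]].
- move=> [v|i] [w|j] /=; rewrite ?(mem_map (@inl_inj _ _)) => kv kw.
  + rewrite zip_eq_inl -eE //; split=> [[]|->] //.
  + by split=> // -[//|/mem_zip[_ /mapP[]]|/mem_zip[/mapP[]]].
  + by split=> // -[//|/mem_zip[/mapP[]]|/mem_zip[_ /mapP[]]].
  + split=> [[->]|]; first by constructor 1.
    by move=> [[->]|/mem_zip[/mapP[]]|/mem_zip[/mapP[]]].
- by move=> [c|] [c'|] //= [/injC->].
- by case=> [e|i] h; [rewrite /= hs //; rewrite /= (mem_map (@inl_inj _ _)) in h|exact: hnv].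
- by case=> [e|i] h; [rewrite /= ht //; rewrite /= (mem_map (@inl_inj _ _)) in h|exact: hnv].
- by move=> [e|i] /=; rewrite // (mem_map (@inl_inj _ _)) => /hl->.
- by move=> [c|] /=; rewrite ?htop ?ep -!map_comp.
- by move=> [c|] /=; rewrite ?hbot -!map_comp.
- by rewrite /= ho hov -!map_comp.
- by rewrite /= hiv hi -map_drop !map_cat -!map_comp.
Qed.

Lemma dipole_rot i K L : good K -> dipole_removal K L ->
  dipole_removal (rot_inner i K) (rot_inner i L).
Proof.
move=> gK [c1 [c2 [[bt lt] [fV [fE [gC [hS [hI [[hs ht hl]
  [htop hbot ho [hi hiv]]]]]]]]]]].
have kept e : e \in innp K -> e \notin bot c1.
  by move=> he; apply/negP; rewrite bt => /(good_top_innp gK); rewrite he.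
exists c1, c2; split; first by split.
exists fV, fE, gC; split=> //; split=> //; split=> //; split=> //=.
rewrite hi map_rot hiv -map_take -map_comp; split=> //.
rewrite -(last_map fV) -map_comp; congr last; apply/eq_in_map => e /mem_take/kept.
exact: ht.
Qed.

End Congruence.

Lemma nth_belast (T : Type) (x0 x : T) s i :
  (i.+1 < size s)%N -> nth x0 (belast x s) i.+1 = nth x0 s i.
Proof.
elim: s x i => //= y s IH x [|i] hi; first by case: s hi {IH}.
exact: IH.
Qed.

Lemma mem_zip_enum (A B : eqType) n (f : A -> B) (g : 'I_n -> B) (L : seq A) x0 x j :
  injective f -> injective g -> size L = n ->
  ((f x, g j) \in zip (map f L) (map g (enum 'I_n))) = (x == nth x0 L j).
Proof.
move=> fI gI sL; have sg : size (map g (enum 'I_n)) = n by rewrite size_map size_enum_ord.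
rewrite (@mem_zip_nth_uniq _ _ (f x0) (f x0) _ _ j) ?(map_inj_uniq gI) ?enum_uniq ?sg ?size_map //.
  by rewrite (nth_map x0) ?sL // (inj_eq fI).
by rewrite (nth_map j) ?size_enum_ord // nth_ord_enum.
Qed.

(** * A cell followed by its inverse *)

Section InverseCell.
Variable X : Type.

Section Dipole.
Variables (K : complex X) (p q : seq (cE K)) (s r : seq X).
Hypotheses (gK : good K) (epq : innp K = p ++ q) (er : map (@lab _ K) p = r).
Hypotheses (p0 : (0 < size p)%N) (s0 : (0 < size s)%N).

Let K1 := attach p q s.
Let p1 : seq (cE K1) := map inr (enum 'I_(size s)).
Let K2 := @attach X K1 p1 (map inl q) r.

Let szr : size r = size p. Proof. by rewrite -er size_map. Qed.

Let e0 : cE K := tnth (in_tuple p) (Ordinal p0).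

(** Vertices that disappear with the dipole get the default value [innv K]. The new vertex [inr j]
    is interior to the last path and corresponds to vertex [j.+1] of [p], counted from its
    origin. *)
Let fV (v : cV K2) : cV K :=
  match v with
  | inl (inl v') => v'
  | inl (inr _) => innv K
  | inr j => nth (innv K) (map (@src _ K) p) j.+1
  end.

Let fE (e : cE K2) : cE K :=
  match e with
  | inl (inl e') => e'
  | inl (inr _) => e0
  | inr j => nth e0 p j
  end.

Let gC (c : cC K) : cC K2 := Some (Some c).

Let src_p : map (@src _ K) p = belast (innv K) (map (@tgt _ K) p).
Proof. by case: (good_split gK epq). Qed.

Let uniq_p : uniq (map (@src _ K) p).
Proof. by have := good_uniq gK; rewrite epq map_cat cat_uniq => /and3P[]. Qed.

Let src_p0 : nth (innv K) (map (@src _ K) p) 0 = innv K.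
Proof. by rewrite src_p; case: (map _ p). Qed.

Let src_pS i : (i.+1 < size p)%N ->
  nth (innv K) (map (@src _ K) p) i.+1 = tgt (nth e0 p i).
Proof.
move=> hi; rewrite src_p nth_belast ?size_map // (nth_map e0) //; exact: ltnW.
Qed.

Let tgt_plast : tgt (nth e0 p (size p).-1) = last (innv K) (map (@tgt _ K) p).
Proof.
rewrite -(nth_map e0 (innv K)); last by rewrite prednK.
by rewrite -[size p](size_map (@tgt _ K)) nth_last; case: p p0.
Qed.

Let inl_inj (A B : Type) : injective (@inl A B).
Proof. by move=> x y []. Qed.

Let bot_src : map (@src _ K2) (map inl p1) =
  inl (inl (innv K)) :: map inl (map inr (enum 'I_(size s).-1)).
Proof.
have -> : map (@src _ K2) (map inl p1) = map inl (map (@src _ K1) p1).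
  by rewrite -!map_comp.
have -> : map (@src _ K1) p1 = map (new_vertex p s) (iota 0 (size s)).
  by rewrite -val_enum_ord -!map_comp.
by rewrite map_new_vertex.
Qed.

Let nv2 := @new_vertex X K1 p1 r.

Let inr_src : map (@src _ K2) (map inr (enum 'I_(size r))) =
  inl (inl (innv K)) :: map inr (enum 'I_(size r).-1).
Proof.
have -> : map (@src _ K2) (map inr (enum 'I_(size r))) = map nv2 (iota 0 (size r)).
  by rewrite -val_enum_ord -!map_comp.
by rewrite /nv2 map_new_vertex // szr.
Qed.

Let fV_nv2 j : (j < size p)%N -> fV (nv2 j) = nth (innv K) (map (@src _ K) p) j.
Proof.
case: j => [|j] hj; first by rewrite src_p0.
have h : (j < (size r).-1)%N by rewrite szr; lia.
by rewrite /nv2 /new_vertex insubT.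
Qed.

Let fV_nv2S j : (j < size p)%N -> fV (nv2 j.+1) = tgt (nth e0 p j).
Proof.
move=> hj; case: (ltnP j.+1 (size p)) => hj1; first by rewrite fV_nv2 // src_pS.
have -> : j = (size p).-1 by lia.
rewrite prednK // tgt_plast -szr /nv2 (@new_vertex_end X K1 p1 r) ?szr //=.
have -> : map (@tgt _ K1) p1 = map (new_vertex p s) (iota 1 (size s)).
  by rewrite (iotaDl 1 0) -val_enum_ord -!map_comp.
have -> : iota 1 (size s) = rcons (iota 1 (size s).-1) (size s).
  by have := iotaD 1 (size s).-1 1; rewrite addn1 add1n prednK // cats1.
by rewrite map_rcons last_rcons new_vertex_end.
Qed.

(** [Some None] is the cell attached first and [None] its inverse. Removing them folds the last
    path, edge by edge, onto [p]. *)
Lemma dipole_attach : dipole_removal K2 K.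
Proof.
exists (Some None), None; split.
  split=> //=; rewrite -!map_comp (eq_map (g := @lab _ K)) // er.
  rewrite -enumT.
  by rewrite -[RHS]/(map (tnth (in_tuple r)) (enum _)) map_tnth_enum.
have mem_p1 i : (inl (inr i) : cE K2) \in map inl p1.
  by rewrite (mem_map (@inl_inj _ _)) map_f // mem_enum.
have top_src : map (@src _ K2) (@top _ K2 (Some None)) = map (inl \o inl) (map (@src _ K) p).
  by rewrite /= -!map_comp.
have szp : size (map (@src _ K) p) = (size (enum 'I_(size r).-1)).+1.
  by rewrite size_map -cardE card_ord prednK // szr.
exists fV, fE, gC; split; [split|split; [split|split; split]].
- move=> v; exists (inl (inl v)) => //; rewrite bot_src /=.
  by rewrite (mem_map (@inl_inj _ _)); apply/mapP => -[].
- by move=> e; exists (inl (inl e)) => //=; rewrite (mem_map (@inl_inj _ _)); apply/mapP => -[].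
- move=> [[c|]|]; rewrite !inE ?eqxx ?orbT; split=> //; first by exists c.
  + by case=> c; rewrite /gC.
  + by case=> c; rewrite /gC.
- rewrite bot_src inr_src top_src /=.
  have [L eL] : exists L, map (@src _ K) p = innv K :: L.
    by exists (behead (map (@src _ K) p)); move: src_p0 szp; case: (map _ p) => //= x L ->.
  have fVr j : fV (inr j) = nth (innv K) L j by rewrite /= eL.
  have sL : size L = (size r).-1 by rewrite eL /= in szp; case: szp => ->; rewrite size_enum_ord.
  have uL : uniq L by move: uniq_p; rewrite eL => /andP[].
  have zL v j : ((inl (inl v) : cV K2, inr j : cV K2) \in
      zip (map (inl \o inl) L) (map inr (enum 'I_(size r).-1))) = (v == nth (innv K) L j).
    by apply: (mem_zip_enum (f := inl \o inl)) => // [x y []|x y []].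
  have ninr i : (inl (inr i) : cV K2) \in map inl (map inr (enum 'I_(size s).-1)).
    by rewrite !map_f // mem_enum.
  rewrite eL /=; move=> [[v|i]|i] [[w|j]|j]; rewrite ?ninr // => _ _.
  + split=> [/= ->|]; first by constructor 1.
    by case=> [[]|/predU1P[[-> ->]|/mem_zip[_ /mapP[]]]|/predU1P[[-> ->]|/mem_zip[_ /mapP[]]]].
  + rewrite fVr; split=> [/= e|]; first by constructor 2; apply/orP; right; apply: etrans (zL v j) _; apply/eqP.
    case=> [//|/predU1P[//|]|/predU1P[//|/mem_zip[/mapP[]//]]].
    by move=> h; apply/eqP; apply: etrans (esym (zL v j)) h.
  + rewrite fVr; split=> [/= e|]; first by constructor 3; apply/orP; right; apply: etrans (zL w i) _; apply/eqP.
    case=> [//|/predU1P[//|/mem_zip[/mapP[]//]]|/predU1P[//|]].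
    by move=> h; apply/esym/eqP; apply: etrans (esym (zL w i)) h.
  + rewrite !fVr; split=> [/eqP|]; last first.
      by case=> [[->]|/predU1P[//|/mem_zip[/mapP[]]]|/predU1P[//|/mem_zip[/mapP[]]]].
    by rewrite nth_uniq ?sL // => /eqP/val_inj->; constructor 1.
- have zp e j : ((inl (inl e) : cE K2, inr j : cE K2) \in
      zip (map (inl \o inl) p) (map inr (enum 'I_(size r)))) = (e == nth e0 p j).
    by apply: (mem_zip_enum (f := inl \o inl)) => // [x y []|x y []].
  have up : uniq p by apply: map_uniq uniq_p.
  have -> : @top _ K2 (Some None) = map (inl \o inl) p by rewrite /= -map_comp.
  have -> : @bot _ K2 None = map inr (enum 'I_(size r)) by [].
  have -> : @bot _ K2 (Some None) = map inl p1 by [].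
  move=> [[v|i]|i] [[w|j]|j]; rewrite ?mem_p1 // => _ _.
  + split=> [/= ->|]; first by constructor 1.
    by case=> [[]|/mem_zip[_ /mapP[]]|/mem_zip[_ /mapP[]]].
  + split=> [/= e|]; first by constructor 2; apply: etrans (zp v j) _; apply/eqP.
    case=> [//|h|/mem_zip[/mapP[]]//].
    by apply/eqP; apply: etrans (esym (zp v j)) h.
  + split=> [/= e|]; first by constructor 3; apply: etrans (zp w i) _; apply/eqP.
    case=> [//|/mem_zip[/mapP[]]//|h].
    by apply/esym/eqP; apply: etrans (esym (zp w i)) h.
  + split=> [/= /eqP|]; last first.
      by case=> [[->]|/mem_zip[/mapP[]]|/mem_zip[/mapP[]]].
    by rewrite nth_uniq -?szr // => /eqP/val_inj->; constructor 1.
- by move=> c c' [].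
- move=> [[e|i]|i] //=; first by rewrite mem_p1.
  move=> _; rewrite -/(nv2 i) fV_nv2 -?szr //.
  by rewrite (nth_map e0) // -szr.
- move=> [[e|i]|i]; [by []|by rewrite mem_p1|].
  by move=> _; apply/esym/fV_nv2S; rewrite -szr.
- move=> [[e|i]|i]; [by []|by rewrite mem_p1|].
  move=> _ /=; have e : nth (lab e0) r i = nth (lab e0) (map (@lab _ K) p) i by rewrite er.
  by rewrite (tnth_nth (lab e0)) /= e (nth_map e0) // -szr.
- by move=> c /=; rewrite -!map_comp map_id_in.
- by move=> c /=; rewrite -!map_comp map_id_in.
- by rewrite /= -!map_comp map_id_in.
- split=> //; rewrite /= epq map_cat -!map_comp; congr cat; last by rewrite map_id_in.
  rewrite -enumT; transitivity (map (nth e0 p) (iota 0 (size r))).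
    by rewrite szr map_nth_iota0 // take_size.
  by rewrite -val_enum_ord -map_comp.
Qed.

End Dipole.
End InverseCell.

(** * Splitting edges *)

Section SplitEdge.

Definition split_label (x : ef) : seq ef := [:: Lf; if x is Le then Lf else Le].

Variables (K : complex ef) (e : cE K).

Definition subst_edge (l : seq (cE K)) : seq (cE K + 'I_2) :=
  flatten [seq if x == e then [:: inr ord0; inr (Ordinal (isT : 1 < 2))]
               else [:: inl x] | x <- l].

(** Describes a split by its edge instead of its position, so that commutation of splits and their
    behaviour under rotation can be checked edge by edge. *)
Definition split_edge : complex ef :=
  {| cV := (cV K + 'I_1)%type; cE := (cE K + 'I_2)%type; cC := option (cC K);
     src := fun x => match x with
       | inl x' => inl (src x') | inr i => if val i == 0 then inl (src e) else inr ord0 end;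
     tgt := fun x => match x with
       | inl x' => inl (tgt x') | inr i => if val i == 0 then inr ord0 else inl (tgt e) end;
     lab := fun x => match x with
       | inl x' => lab x' | inr i => tnth (in_tuple (split_label (lab e))) i end;
     top := fun c => map inl (if c is Some c' then top c' else [:: e]);
     bot := fun c => if c is Some c' then map inl (bot c') else map inr (enum 'I_2);
     outp := map inl (outp K); outv := inl (outv K);
     innp := subst_edge (innp K); innv := inl (innv K) |}.

Lemma subst_edge_cat l l' : subst_edge (l ++ l') = subst_edge l ++ subst_edge l'.
Proof. by rewrite /subst_edge map_cat flatten_cat. Qed.

Lemma subst_edge_notin l : e \notin l -> subst_edge l = map inl l.
Proof.
elim: l => //= x l IH; rewrite inE negb_or eq_sym => /andP[/negbTE xe /IH].
by rewrite /subst_edge /= xe /= => ->.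
Qed.

Lemma subst_edge_cons l : subst_edge (e :: l) =
  [:: inr ord0; inr (Ordinal (isT : 1 < 2))] ++ subst_edge l.
Proof. by rewrite /subst_edge /= eqxx. Qed.

End SplitEdge.

Lemma enum_I1 : enum 'I_1 = [:: ord0].
Proof. by apply: (inj_map val_inj); rewrite val_enum_ord. Qed.

Lemma enum_I2 : enum 'I_2 = [:: ord0; Ordinal (isT : 1 < 2)].
Proof. by apply: (inj_map val_inj); rewrite val_enum_ord. Qed.

Section SplitAt.
Implicit Types K L : complex ef.

Definition labels K : seq ef := map (@lab _ K) (innp K).

(** The chosen edge is rotated to the front, split, and rotated back; [.+1] accounts for the path
    having grown by one edge. *)
Definition split_at (j : nat) K : complex ef :=
  rot_inner ((size (innp K)).+1 - j)
    (att 1 (split_label (nth Le (labels K) j)) (rot_inner j K)).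

(** An equality and not only an isomorphism: the types of vertices, edges and cells of [split_edge]
    are those produced by [attach], so only the structure maps have to be compared. *)
Lemma split_atE K A e B : good K -> innp K = A ++ e :: B ->
  split_at (size A) K = split_edge e.
Proof.
move=> gK eK; have hn : nth Le (labels K) (size A) = lab e.
  by rewrite /labels eK map_cat nth_cat size_map ltnn subnn.
have gR := good_rot (size A) gK.
have gA : good (att 1 (split_label (lab e)) (rot_inner (size A) K)).
  apply: good_attach => //; first by rewrite cat_take_drop.
  by rewrite size_takel //= size_rot eK size_cat addnS.
rewrite /split_at hn [LHS]rot_innerE //.
have eR : rot (size A) (innp K) = e :: B ++ A by rewrite eK rot_size_cat.
have := good_uniq gK; move/map_uniq; rewrite eK cat_uniq /= => /and4P[_ hA hB _].
have {hA} eA : e \notin A by move: hA; rewrite negb_or => /andP[].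
have [/= es et] := @good_split _ (rot_inner (size A) K) [:: e] (B ++ A) gR eR.
have tk : take 1 (rot (size A) (innp K)) = [:: e] by rewrite eR /= take0.
have dk : drop 1 (rot (size A) (innp K)) = B ++ A by rewrite eR /= drop0.
have hnv0 : @new_vertex ef (rot_inner (size A) K) [:: e] (split_label (lab e)) 0 = inl (src e).
  by case: es => ->.
have hnv1 : @new_vertex ef (rot_inner (size A) K) [:: e] (split_label (lab e)) 1 = inr ord0.
  by rewrite /new_vertex insubT //=; congr inr; apply: val_inj.
have hnv2 : @new_vertex ef (rot_inner (size A) K) [:: e] (split_label (lab e)) 2 = inl (tgt e).
  by rewrite /new_vertex insubF.
have hinn : rot ((size (A ++ e :: B)).+1 - size A)
    (map inr (enum 'I_2) ++ map inl (drop 1 (rot (size A) (innp K)))) =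
    map inl A ++ [:: inr ord0; inr (Ordinal (isT : 1 < 2))] ++ map inl B.
  rewrite [drop 1 _]dk enum_I2 map_cat catA.
  have -> : (size (A ++ e :: B)).+1 - size A =
      size ([seq inr i | i <- [:: ord0; Ordinal (isT : 1 < 2)]] ++ map (@inl (cE K) 'I_2) B).
    by rewrite !size_cat !size_map /=; lia.
  by rewrite rot_size_cat.
have hsub : subst_edge e (innp K) =
    map inl A ++ [:: inr ord0; inr (Ordinal (isT : 1 < 2))] ++ map inl B.
  by rewrite eK subst_edge_cat subst_edge_cons !subst_edge_notin.
rewrite /set_inner /split_edge /att /attach; congr Complex.
- apply: funext => -[x|i] //; rewrite -[LHS]/(new_vertex _ _ _) [take _ _]tk.
  by case: i => -[|[|//]] hi.
- apply: funext => -[x|i] //; rewrite -[LHS]/(new_vertex _ _ _) [take _ _]tk.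
  by case: i => -[|[|//]] hi.
- by apply: funext => -[c|] //; rewrite -[LHS]/(map inl (take _ _)) [take _ _]tk.
- by rewrite hsub; exact: hinn.
- transitivity (inl (head (innv K) (map (@src _ K) (A ++ e :: B))) : cV K + 'I_1).
    rewrite [rot _ _]hinn; case: (A) es => //= es.
    by case: es => ->.
  congr inl; rewrite -eK; have := good_path gK; have := good_gt0 gK.
  by case: (innp K) => //= x l _ [].
Qed.
End SplitAt.

(** * Equivalence of built complexes, splits and inverse splits *)

Section Equivalence.
Implicit Types K L : complex ef.

Local Notation built := (built ef_rels [:: Le]).

Definition cell_move K L : Prop :=
  [/\ built K, built L & complex_iso K L \/ dipole_removal K L].

Definition ceq : complex ef -> complex ef -> Prop := clos_refl_sym_trans _ cell_move.

Lemma ceq_refl K : ceq K K. Proof. exact: rst_refl. Qed.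
Lemma ceq_sym K L : ceq K L -> ceq L K. Proof. exact: rst_sym. Qed.
Lemma ceq_trans L K M : ceq K L -> ceq L M -> ceq K M. Proof. exact: rst_trans. Qed.

Lemma ef_rels_gt0 r s : ef_rels r s -> (0 < size r)%N /\ (0 < size s)%N.
Proof. by case. Qed.

Lemma ef_good K : built K -> good K.
Proof. by apply: built_good; apply: ef_rels_gt0. Qed.

Lemma move_labels K L : cell_move K L -> labels K = labels L.
Proof.
rewrite /labels => -[/ef_good gK _ []].
  move=> [fV [fE [fC [_ [[_ _ hl] [_ _ _ [-> _]]]]]]].
  by rewrite -map_comp; apply: eq_map => e /=; rewrite hl.
move=> [c1 [c2 [[bt _] [fV [fE [gC [_ [_ [[_ _ hl] [_ _ _ [-> _]]]]]]]]]]].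
rewrite -map_comp; apply/eq_in_map => e he /=; rewrite hl // bt.
by apply/negP => /(good_top_innp gK); rewrite he.
Qed.

Lemma ceq_labels K L : ceq K L -> labels K = labels L.
Proof. by elim=> [x y /move_labels|x|x y _ ->|x y z _ -> _ ->]. Qed.

Lemma ceq_size K L : ceq K L -> size (innp K) = size (innp L).
Proof. by move/ceq_labels/(congr1 size); rewrite !size_map. Qed.

Lemma built_att k s K : built K ->
  ef_rels (take k (labels K)) s \/ ef_rels s (take k (labels K)) ->
  built (att k s K).
Proof.
move=> bK h; apply: built_attach h => //; first by rewrite cat_take_drop.
by rewrite map_take.
Qed.

Lemma ceq_att k s K L : ef_rels (take k (labels K)) s \/ ef_rels s (take k (labels K)) ->
  ceq K L -> ceq (att k s K) (att k s L).
Proof.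
move=> h hKL; elim: hKL h => {K L} [K L m|K|K L /ceq_labels e IH|K L M /ceq_labels e IH _ IH'] h.
- apply: rst_step; have e := move_labels m; case: m => bK bL hKL.
  split; [exact: built_att|by apply: built_att; rewrite -?e|].
  by case: hKL => hKL; [left; apply: iso_att|right; apply: dipole_att => //; apply: ef_good].
- exact: rst_refl.
- by apply: rst_sym; apply: IH; rewrite e.
- by apply: rst_trans (IH h) _; apply: IH'; rewrite -e.
Qed.

Lemma ceq_rot i K L : ceq K L -> ceq (rot_inner i K) (rot_inner i L).
Proof.
elim=> {K L} [K L [bK bL hKL]|K|K L _ IH|K L M _ IH _ IH'].
- apply: rst_step; split; [exact: built_rot|exact: built_rot|].
  by case: hKL => hKL; [left; apply: iso_rot|right; apply: dipole_rot => //; apply: ef_good].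
- exact: rst_refl.
- exact: rst_sym.
- exact: rst_trans IH IH'.
Qed.

Lemma labels_rot i K : labels (rot_inner i K) = rot i (labels K).
Proof. by rewrite /labels /= map_rot. Qed.

Lemma split_label_rel x : ef_rels [:: x] (split_label x).
Proof. by case: x; constructor. Qed.

Lemma split_label_inj x y : split_label x = split_label y -> x = y.
Proof. by case: x y => [] []. Qed.

Lemma take1_rot (T : Type) (x0 : T) j (s : seq T) :
  j < size s -> take 1 (rot j s) = [:: nth x0 s j].
Proof. by move=> hj; rewrite /rot (drop_nth x0 hj) /= take0. Qed.

Lemma split_at_rel j K : (j < size (innp K))%N ->
  ef_rels (take 1 (labels (rot_inner j K))) (split_label (nth Le (labels K) j)).
Proof.
move=> hj; rewrite labels_rot (take1_rot Le) ?size_map //.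
exact: split_label_rel.
Qed.

Lemma built_split_at j K : (j < size (innp K))%N -> built K -> built (split_at j K).
Proof.
move=> hj bK; apply: built_rot; apply: built_att; first exact: built_rot.
by left; apply: split_at_rel.
Qed.

Lemma ceq_split_at j K L : (j < size (innp K))%N -> ceq K L ->
  ceq (split_at j K) (split_at j L).
Proof.
move=> hj e; rewrite /split_at -(ceq_labels e) -(ceq_size e).
apply: ceq_rot; apply: ceq_att; last exact: ceq_rot.
by left; apply: split_at_rel.
Qed.

Lemma innp_nth K j : (j < size (innp K))%N -> exists A e B, innp K = A ++ e :: B /\ size A = j.
Proof.
move=> hj; case e0 : (drop j (innp K)) => [|e B].
  by have := congr1 size e0; rewrite size_drop /=; lia.
exists (take j (innp K)), e, B; split; last by rewrite size_takel // ltnW.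
by rewrite -e0 cat_take_drop.
Qed.

Lemma innp_uniq K : good K -> uniq (innp K).
Proof. by move=> /good_uniq/map_uniq. Qed.

Lemma split_at_innp K A e B : good K -> innp K = A ++ e :: B ->
  split_at (size A) K = split_edge e /\
  innp (split_edge e) = map inl A ++ [:: inr ord0; inr (Ordinal (isT : 1 < 2))] ++ map inl B.
Proof.
move=> gK eK; split; first exact: (split_atE gK eK).
have := innp_uniq gK; rewrite /= eK cat_uniq /= => /and4P[_ hA hB _].
have {hA} eA : e \notin A by move: hA; rewrite negb_or => /andP[].
by rewrite subst_edge_cat subst_edge_cons !subst_edge_notin.
Qed.

Lemma size_split_at j K : good K -> (j < size (innp K))%N ->
  size (innp (split_at j K)) = (size (innp K)).+1.
Proof.
move=> gK hj; have [A [e [B [eK <-]]]] := innp_nth hj.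
have [-> ->] := split_at_innp gK eK.
by rewrite eK !size_cat !size_map /= !addnS.
Qed.

Lemma labels_split_at l x l' K : good K -> labels K = l ++ x :: l' ->
  labels (split_at (size l) K) = l ++ split_label x ++ l'.
Proof.
move=> gK eL; have hj : (size l < size (innp K))%N.
  by rewrite -(size_map (@lab _ K)) -/(labels K) eL size_cat addnS ltnS leq_addr.
have [A [e [B [eK sA]]]] := innp_nth hj.
move: eL; rewrite /labels eK map_cat => eL.
have eA := congr1 (take (size l)) eL; have eB := congr1 (drop (size l)) eL.
rewrite !take_size_cat ?size_map // in eA.
rewrite !drop_size_cat ?size_map // in eB; case: eB => ex eB.
have [e1 e2] := split_at_innp gK eK; rewrite -sA e1 e2.
by rewrite map_cat /= -!map_comp -eA -eB -ex.
Qed.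

Definition swap_new (A B : Type) (x : (A + B) + B) : (A + B) + B :=
  match x with
  | inl (inl a) => inl (inl a)
  | inl (inr b) => inr b
  | inr b => inl (inr b)
  end.

Lemma swap_new_bij A B : bijective (@swap_new A B).
Proof. by exists (@swap_new A B); move=> [[a|b]|b]. Qed.

Definition swap_cell (C : Type) (c : option (option C)) : option (option C) :=
  match c with
  | Some (Some c) => Some (Some c)
  | Some None => None
  | None => Some None
  end.

Lemma swap_cell_bij C : bijective (@swap_cell C).
Proof. by exists (@swap_cell C); move=> [[c|]|]. Qed.

Lemma split_edge_comm K (e e' : cE K) : e != e' ->
  complex_iso (@split_edge (split_edge e) (inl e')) (@split_edge (split_edge e') (inl e)).
Proof.
move=> ne.
exists (@swap_new _ _), (@swap_new _ _), (@swap_cell _); split; [split|split; split] => //;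
  try exact: swap_new_bij; try exact: swap_cell_bij.
- by move=> [[a|i]|i] //=; case: ifP.
- by move=> [[a|i]|i] //=; case: ifP.
- by move=> [[a|i]|i].
- by move=> [[c|]|] //=; rewrite -!map_comp.
- by move=> [[c|]|] //=; rewrite -!map_comp.
- by rewrite /= -!map_comp.
- split=> //=; elim: (innp K) => //= x l IH.
  rewrite /subst_edge /= !map_cat !flatten_cat map_cat -!/(subst_edge _ _) -IH.
  congr cat; have [xe|xe] := eqVneq x e.
    by rewrite xe (negbTE ne) /= eqxx.
  have [xe'|xe'] := eqVneq x e'; first by rewrite xe' /= eqxx.
  by rewrite /= ifF ?ifF //; apply/eqP => -[]; apply/eqP.
Qed.

(** Splits of different edges commute; the split at [i] moves the edge at [j] to position [j.+1]. *)
Lemma ceq_split_comm i j K : built K -> (i < j)%N -> (j < size (innp K))%N ->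
  ceq (split_at j.+1 (split_at i K)) (split_at i (split_at j K)).
Proof.
move=> bK ij hj; have gK := ef_good bK; have hi := ltn_trans ij hj.
have [A [e [B' [eK sA]]]] := innp_nth hi.
have [A' [e' [C [eK' sA']]]] := innp_nth hj.
have eA' : A' = A ++ e :: take (j - i).-1 B'.
  have -> : A' = take j (innp K) by rewrite eK' -sA' take_size_cat.
  rewrite eK take_cat sA ltnNge ltnW //= -sA; congr cat.
  by case: (j - size A) (subn_gt0 (size A) j) => [|n _ //]; rewrite sA ij.
move: (take _ _) eA' => B eA'.
rewrite {}eA' -catA /= in eK' sA'.
have [e1 n1] := split_at_innp gK eK'.
have sB : size A + (size B).+1 = j by rewrite -sA' size_cat.
have eKB : innp K = (A ++ e :: B) ++ e' :: C by rewrite eK' -catA.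
have [e2 n2] := split_at_innp gK eKB; rewrite size_cat /= sB in e2.
rewrite e2 -sA e1.
have b1 : built (split_edge e) by rewrite -e1; apply: built_split_at; rewrite ?sA.
have b2 : built (split_edge e') by rewrite -e2; apply: built_split_at.
have eu := innp_uniq gK.
have ne : e != e'.
  move: eu; rewrite eK' cat_uniq => /and3P[_ _ /=/andP[]].
  by rewrite mem_cat inE !negb_or => /and3P[].
have k1 : innp (split_edge e) = (map inl A ++ [:: inr ord0; inr (Ordinal (isT : 1 < 2))] ++ map inl B) ++ inl e' :: map inl C.
  by rewrite n1 map_cat -!catA.
have k2 : innp (split_edge e') = map inl A ++ inl e :: map inl B ++ [:: inr ord0; inr (Ordinal (isT : 1 < 2))] ++ map inl C.
  by rewrite n2 map_cat /= -!catA.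
have [f1 _] := split_at_innp (ef_good b1) k1; have [f2 _] := split_at_innp (ef_good b2) k2.
rewrite !size_cat !size_map /= in f1 f2.
have <- : size A + (size B).+2 = j.+1 by rewrite -sB addnS.
rewrite f1 f2; apply: rst_step; split.
- rewrite -f1; apply: built_split_at => //.
  by rewrite k1 !size_cat !size_map /=; lia.
- rewrite -f2; apply: built_split_at => //.
  by rewrite k2 !size_cat !size_map /=; lia.
- by left; apply: split_edge_comm.
Qed.

(** The amount of rotation counts both halves of [e] when [e] is among the edges rotated past. *)
Lemma rot_split_edge i K (e : cE K) :
  rot_inner (size (subst_edge e (take i (innp K)))) (split_edge e) =
  @split_edge (rot_inner i K) e.
Proof.
have eK : subst_edge e (innp K) =
    subst_edge e (take i (innp K)) ++ subst_edge e (drop i (innp K)).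
  by rewrite -subst_edge_cat cat_take_drop.
rewrite /rot_inner /split_edge; congr Complex.
  by rewrite /= eK rot_size_cat -subst_edge_cat.
rewrite /= eK take_size_cat //.
elim: (take i _) (innv K) {eK} => //= x A IH v; rewrite /subst_edge /= map_cat last_cat.
rewrite -/(subst_edge e A) -IH.
by case: eqP => [->|_].
Qed.

Lemma split_at_mem K (e : cE K) : good K -> e \in innp K ->
  exists2 j, j < size (innp K) & split_at j K = split_edge e.
Proof.
move=> gK /splitPr; case eK : (innp K) / => [A B]; exists (size A).
  by rewrite size_cat addnS ltnS leq_addr.
exact: split_atE eK.
Qed.

Lemma split_at_edge K j : good K -> j < size (innp K) ->
  exists2 e, e \in innp K & split_at j K = split_edge e.
Proof.
move=> gK hj; have [A [e [B [eK <-]]]] := innp_nth hj; exists e.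
  by rewrite eK mem_cat mem_head orbT.
exact: split_atE eK.
Qed.

Lemma split_at_rotl i j K : good K -> j < size (innp K) -> exists i' j',
  j' < size (innp K) /\ split_at j' (rot_inner i K) = rot_inner i' (split_at j K).
Proof.
move=> gK /split_at_edge[] // e he ->.
have [|j' hj' ej'] := @split_at_mem (rot_inner i K) e (good_rot i gK).
  by rewrite mem_rot.
exists (size (subst_edge e (take i (innp K)))), j'.
by rewrite rot_split_edge ej'; rewrite /= size_rot in hj'.
Qed.

Lemma split_at_rotr i j K : good K -> j < size (innp K) -> exists i' j',
  j' < size (innp K) /\ split_at j (rot_inner i K) = rot_inner i' (split_at j' K).
Proof.
move=> gK hj; have [|e] := @split_at_edge (rot_inner i K) j (good_rot i gK).
  by rewrite size_rot.
rewrite mem_rot => he ->; have [j' hj' ej'] := @split_at_mem K e gK he.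
exists (size (@subst_edge K e (take i (innp K)))), j'; split=> //.
by rewrite ej'; apply/esym/rot_split_edge.
Qed.

Lemma rot_innerK i j K : good K -> rot i (rot j (innp K)) = innp K ->
  rot_inner i (rot_inner j K) = K.
Proof.
move=> gK e; rewrite rot_innerE; last exact: good_rot.
rewrite -[RHS]set_inner_id // /set_inner; congr Complex => //=; rewrite e.
by have := good_gt0 gK; case: (innp K).
Qed.

Lemma rot_inner0 K : good K -> rot_inner 0 K = K.
Proof. by move=> gK; rewrite rot_innerE // rot0 set_inner_id. Qed.

Lemma rot_inner_size K : good K -> rot_inner (size (innp K)) K = K.
Proof. by move=> gK; rewrite rot_innerE // rot_size set_inner_id. Qed.

Lemma rot_addn_size (T : Type) i j (s : seq T) : i + j = size s -> rot i (rot j s) = s.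
Proof. by move=> e; rewrite -rotD ?e // rot_size. Qed.

Lemma size_att k s K : k <= size (innp K) ->
  size (innp (att k s K)) = size s + (size (innp K) - k).
Proof.
by move=> h; rewrite /= size_cat !size_map size_drop -enumT size_enum_ord.
Qed.

Lemma labels_att k s K : labels (att k s K) = s ++ drop k (labels K).
Proof.
rewrite /labels /= map_cat -!map_comp -map_drop -enumT; congr cat.
by rewrite -[LHS]/(map (tnth (in_tuple s)) (enum _)) map_tnth_enum.
Qed.

Lemma ceq_att_att k s K : built K -> 0 < k <= size (innp K) ->
  ef_rels (take k (labels K)) s \/ ef_rels s (take k (labels K)) ->
  ceq (att (size s) (take k (labels K)) (att k s K)) K.
Proof.
move=> bK /andP[k0 hk] h; have gK := ef_good bK.
have s0 : 0 < size s by case: h => /ef_rels_gt0[].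
have eL : take k (labels K) = map (@lab _ K) (take k (innp K)) by rewrite /labels map_take.
have sp : size (take k (innp K)) = k by rewrite size_takel.
apply: rst_step; split=> //.
  apply: built_att; first exact: built_att.
  have -> : take (size s) (labels (att k s K)) = s.
    by rewrite labels_att take_size_cat.
  by case: h; [right|left].
right; have := @dipole_attach _ K (take k (innp K)) (drop k (innp K)) s _ gK _ (esym eL).
rewrite cat_take_drop sp => /(_ erefl k0 s0).
rewrite [X in _ -> dipole_removal X _]/att.
have -> : take (size s) (innp (att k s K)) = map inr (enum 'I_(size s)).
  by rewrite take_size_cat // size_map size_enum_ord.
have -> : drop (size s) (innp (att k s K)) = map inl (drop k (innp K)).
  by rewrite drop_size_cat // size_map size_enum_ord.
by [].
Qed.

Definition unsplit_at (j : nat) (x : ef) K : complex ef :=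
  rot_inner ((size (innp K)).-1 - j) (att 2 [:: x] (rot_inner j K)).

Lemma unsplit_split j K : built K -> j < size (innp K) ->
  ceq (unsplit_at j (nth Le (labels K) j) (split_at j K)) K.
Proof.
move=> bK hj; have gK := ef_good bK; have bR := built_rot j bK.
have hrel := split_at_rel hj; set x := nth Le _ _ in hrel *.
have bM : built (att 1 (split_label x) (rot_inner j K)) by apply: built_att => //; left.
have sM : size (innp (att 1 (split_label x) (rot_inner j K))) = (size (innp K)).+1.
  by rewrite size_att /= size_rot ?(leq_trans _ hj) // add2n subn1 prednK // (leq_trans _ hj).
rewrite /unsplit_at size_split_at //= /split_at -/x rot_innerK; last 2 first.
- exact: ef_good.
- by rewrite rot_addn_size // sM; lia.
have e : take 1 (labels (rot_inner j K)) = [:: x].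
  by rewrite labels_rot (take1_rot Le) // size_map.
have := @ceq_att_att 1 (split_label x) _ bR; rewrite /= size_rot (leq_trans _ hj) //.
move=> /(_ isT (or_introl hrel)); rewrite e => /(ceq_rot (size (innp K) - j)) h.
apply: ceq_trans h _; rewrite rot_innerK //; first exact: ceq_refl.
by rewrite rot_addn_size // subnK // ltnW.
Qed.

Lemma built_unsplit j x K : built K -> take 2 (rot j (labels K)) = split_label x ->
  built (unsplit_at j x K).
Proof.
move=> bK e; apply: built_rot; apply: built_att; first exact: built_rot.
by rewrite labels_rot e; right; apply: split_label_rel.
Qed.

Lemma ceq_unsplit j x K L : take 2 (rot j (labels K)) = split_label x ->
  ceq K L -> ceq (unsplit_at j x K) (unsplit_at j x L).
Proof.
move=> e h; rewrite /unsplit_at -(ceq_size h); apply: ceq_rot; apply: ceq_att.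
  by rewrite labels_rot e; right; apply: split_label_rel.
exact: ceq_rot.
Qed.

(** The bound keeps the pair of edges from wrapping round the end of the inner path, where the
    merged edge would not land at position [j]. *)
Lemma split_unsplit j x K : built K -> j.+1 < size (innp K) ->
  take 2 (rot j (labels K)) = split_label x -> ceq (split_at j (unsplit_at j x K)) K.
Proof.
move=> bK hj e; have gK := ef_good bK; have bR := built_rot j bK.
have hrel : ef_rels [:: x] (take 2 (labels (rot_inner j K))).
  by rewrite labels_rot e; apply: split_label_rel.
have bN : built (att 2 [:: x] (rot_inner j K)) by apply: built_att => //; right.
have sN : size (innp (att 2 [:: x] (rot_inner j K))) = (size (innp K)).-1.
  by rewrite size_att /= size_rot; lia.
have ex : nth Le (labels (unsplit_at j x K)) j = x.
  have m0 : 0 < (size (innp (rot_inner j K))).-1 - j by rewrite /= size_rot; lia.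
  have sl : size (labels K) = size (innp K) by rewrite size_map.
  rewrite /= size_rot in m0.
  rewrite /unsplit_at labels_rot labels_att labels_rot /=.
  have sD : size (drop 2 (rot j (labels K))) = size (innp K) - 2.
    by rewrite size_drop size_rot sl.
  move: (drop 2 _) sD => D sD; rewrite /rot nth_cat size_drop /= sD.
  have -> : (size (innp K) - 2).+1 - ((size (innp K)).-1 - j) = j by lia.
  by rewrite ltnn subnn nth_take.

rewrite /split_at ex; have -> : size (innp (unsplit_at j x K)) = (size (innp K)).-1.
  by rewrite size_rot sN.

rewrite /unsplit_at rot_innerK; last 2 first.
- exact: ef_good.
- by rewrite rot_addn_size // sN; lia.

have h2 : 0 < 2 <= size (innp (rot_inner j K)) by rewrite /= size_rot; lia.
have := @ceq_att_att 2 [:: x] _ bR h2 (or_intror hrel); rewrite labels_rot e.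
move=> /(ceq_rot ((size (innp K)).-1.+1 - j)) h.
apply: ceq_trans h _; rewrite rot_innerK //; first exact: ceq_refl.
by rewrite rot_addn_size //; lia.
Qed.

End Equivalence.

(** * Normal forms of annular diagrams *)

Section Words.
Implicit Types K L : complex ef.
Local Notation built := (built ef_rels [:: Le]).

Definition splits (Q : seq nat) K : complex ef := foldl (fun K j => split_at j K) K Q.

Fixpoint valid (n : nat) (Q : seq nat) : bool :=
  if Q is j :: Q' then (j < n) && valid n.+1 Q' else true.

Lemma splits_cons j Q K : splits (j :: Q) K = splits Q (split_at j K).
Proof. by []. Qed.

Lemma splits_cat P Q K : splits (P ++ Q) K = splits Q (splits P K).
Proof. exact: foldl_cat. Qed.

Lemma valid_cat n P Q : valid n (P ++ Q) = valid n P && valid (n + size P) Q.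
Proof.
elim: P n => [|j P IH] n; first by rewrite /= addn0.
by rewrite /= IH -andbA addSnnS.
Qed.

Lemma built_splits Q K : valid (size (innp K)) Q -> built K ->
  built (splits Q K) /\ size (innp (splits Q K)) = size (innp K) + size Q.
Proof.
elim: Q K => [|j Q IH] K; first by rewrite addn0.
move=> /andP[hj hQ] bK; rewrite splits_cons; have bS := built_split_at hj bK.
have sS := size_split_at (ef_good bK) hj.
by have [|//|? ->] := IH (split_at j K); rewrite sS // addSnnS.
Qed.

Lemma ceq_splits Q K L : valid (size (innp K)) Q -> built K -> ceq K L ->
  ceq (splits Q K) (splits Q L).
Proof.
elim: Q K L => [//|j Q IH] K L /andP[hj hQ] bK e.
rewrite !splits_cons; apply: IH; first by rewrite (size_split_at (ef_good bK)).
  exact: built_split_at.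
exact: ceq_split_at.
Qed.

Lemma split_at_spec j K n : built K -> size (innp K) = n -> j < n ->
  built (split_at j K) /\ size (innp (split_at j K)) = n.+1.
Proof.
move=> bK <- hj; split; first exact: built_split_at.
exact: size_split_at (ef_good bK) hj.
Qed.

(* Q^-1 j = Q2 Q1^-1 with Q2 of length at most one. *)
Lemma ore_step Q j n : valid n Q -> j < n -> exists Q1 Q2,
  [/\ valid n.+1 Q1, valid (n + size Q) Q2, (size Q1).+1 = size Q + size Q2 &
   forall K, built K -> size (innp K) = n ->
     ceq (splits Q1 (split_at j K)) (splits Q2 (splits Q K))].
Proof.
elim: Q n j => [|i Q IH] n j.
  move=> _ hj; exists [::], [:: j]; rewrite /= addn0 hj; split=> // *.
  exact: ceq_refl.
move=> /andP[hi hQ] hj; case: (ltngtP i j) => ij.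
- have [|Q1 [Q2 [v1 v2 s12 h]]] := IH n.+1 j.+1 hQ; first by [].
  exists (i :: Q1), Q2; split.
  + by rewrite /= v1 (ltn_trans ij) // ltnW.
  + by rewrite /= addnS -addSn.
  + by rewrite /= s12 addSn.
  move=> K bK sK; have [bi si] := split_at_spec bK sK hi.
  have [bj sj] := split_at_spec bK sK hj; have [bij sij] := split_at_spec bj sj (ltnW hi).
  apply: (ceq_trans (L := splits Q1 (split_at j.+1 (split_at i K)))); last exact: h.
  rewrite splits_cons; apply: ceq_splits; rewrite ?sij //.
  by apply/ceq_sym/ceq_split_comm => //; rewrite sK.
- have [|Q1 [Q2 [v1 v2 s12 h]]] := IH n.+1 j hQ; first exact: ltnW.
  exists (i.+1 :: Q1), Q2; split.
  + by rewrite /= v1 ltnS hi.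
  + by rewrite /= addnS -addSn.
  + by rewrite /= s12 addSn.
  move=> K bK sK; have [bi si] := split_at_spec bK sK hi.
  have hi1 : i.+1 < n.+1 by [].
  have [bj sj] := split_at_spec bK sK hj; have [bij sij] := split_at_spec bj sj hi1.
  apply: (ceq_trans (L := splits Q1 (split_at j (split_at i K)))); last exact: h.
  rewrite splits_cons; apply: ceq_splits; rewrite ?sij //.
  by apply: ceq_split_comm => //; rewrite sK.
- exists Q, [::]; rewrite -ij; split=> //; first by rewrite addn0.
  by move=> *; exact: ceq_refl.
Qed.

(** Common refinement of two sequences of splits. One split [j] of [P] is moved past [Q] at a time:
    [Qa] is what remains of [Q] after [j], and [Qb] what remains of [j] after [Q]. *)
Lemma ore P Q n : valid n P -> valid n Q -> exists P1 Q1,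
  [/\ valid (n + size P) Q1, valid (n + size Q) P1, size P + size Q1 = size Q + size P1 &
   forall K, built K -> size (innp K) = n ->
     ceq (splits Q1 (splits P K)) (splits P1 (splits Q K))].
Proof.
elim: P Q n => [|j P IH] Q n.
  move=> _ hQ; exists [::], Q; rewrite !addn0; split=> // K bK sK.
  exact: ceq_refl.
move=> /andP[hj hP] hQ; have [Qa [Qb [va vb sab hab]]] := ore_step hQ hj.
have [P1 [Q1 [v1 v2 s12 h]]] := IH Qa n.+1 hP va.
exists (Qb ++ P1), Q1; split.
- by rewrite /= addnS -addSn.
- by rewrite valid_cat vb -addnA -sab addnS -addSn.
- by rewrite size_cat /=; lia.
move=> K bK sK; rewrite splits_cat splits_cons.
have bj : built (split_at j K) by apply: built_split_at => //; rewrite sK.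
have sj : size (innp (split_at j K)) = n.+1.
  by rewrite size_split_at ?sK //; apply: ef_good.
apply: ceq_trans (h _ bj sj) _; apply: ceq_splits; last exact: hab.
  by have [||_ ->] := @built_splits Qa (split_at j K); rewrite ?sj.
by have [||] := @built_splits Qa (split_at j K); rewrite ?sj.
Qed.

(** The two new labels determine the label that was split, so one and the same inverse split undoes
    both sides. *)
Lemma split_at_cancel j K L : built K -> built L -> j < size (innp K) ->
  size (innp K) = size (innp L) -> ceq (split_at j K) (split_at j L) -> ceq K L.
Proof.
move=> bK bL hj sKL e; have hj' := hj; rewrite sKL in hj'.
have lab K' : built K' -> j < size (innp K') ->
    take 2 (rot j (labels (split_at j K'))) = split_label (nth Le (labels K') j).
  move=> bK' h; have sl : size (labels K') = size (innp K') by rewrite size_map.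
  have [l [l' [x [el sl']]]] : exists l l' x, labels K' = l ++ x :: l' /\ size l = j.
    exists (take j (labels K')), (drop j.+1 (labels K')), (nth Le (labels K') j).
    by rewrite -drop_nth ?sl // cat_take_drop size_takel // sl ltnW.
  rewrite el -sl' (labels_split_at (ef_good bK') el) nth_cat ltnn subnn.
  by rewrite rot_size_cat -catA take_size_cat.
have ex : nth Le (labels K) j = nth Le (labels L) j.
  by apply: split_label_inj; rewrite -!lab // (ceq_labels e).
apply: ceq_trans (ceq_sym (unsplit_split bK hj)) _.
apply: ceq_trans (unsplit_split bL hj'); rewrite -ex.
exact: ceq_unsplit (lab K bK hj) e.
Qed.

Lemma splits_cancel Q K L : built K -> built L -> valid (size (innp K)) Q ->
  size (innp K) = size (innp L) -> ceq (splits Q K) (splits Q L) -> ceq K L.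
Proof.
elim: Q K L => [//|j Q IH] K L bK bL /andP[hj hQ] sKL; rewrite !splits_cons => e.
have hj' := hj; rewrite sKL in hj'.
apply: (split_at_cancel bK bL hj sKL); apply: IH => //.
- exact: built_split_at.
- exact: built_split_at.
- by rewrite size_split_at //; apply: ef_good.
- by rewrite !size_split_at ?sKL //; apply: ef_good.
Qed.

Definition trivial_diagram : complex ef := cycle_complex Le [::].

Lemma built_trivial : built trivial_diagram.
Proof. exact: built_cycle. Qed.

(** Says that [K] is P, a rotation, Q^-1, with the factor Q moved to the other side so that only
    splits occur. *)
Definition normalizable K : Prop := exists Q P i,
  [/\ valid (size (innp K)) Q, valid 1 P &
      ceq (splits Q K) (rot_inner i (splits P trivial_diagram))].

Lemma splits_rotl Q i K : built K -> valid (size (innp K)) Q -> exists i' Q',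
  valid (size (innp K)) Q' /\ splits Q' (rot_inner i K) = rot_inner i' (splits Q K).
Proof.
elim: Q i K => [|j Q IH] i K bK; first by exists i, [::].
move=> /andP[hj hQ]; have gK := ef_good bK.
have [i1 [j1 [hj1 e1]]] := split_at_rotl i gK hj.
have [||i2 [Q2 [v2 e2]]] := IH i1 (split_at j K).
- exact: built_split_at.
- by rewrite size_split_at.
exists i2, (j1 :: Q2); rewrite size_split_at // in v2.
by rewrite !splits_cons e1 e2 /= hj1 v2.
Qed.

Lemma splits_rotr Q i K : built K -> valid (size (innp K)) Q -> exists i' Q',
  valid (size (innp K)) Q' /\ splits Q (rot_inner i K) = rot_inner i' (splits Q' K).
Proof.
elim: Q i K => [|j Q IH] i K bK; first by exists i, [::].
move=> /andP[hj hQ]; have gK := ef_good bK.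
have [i1 [j1 [hj1 e1]]] := split_at_rotr i gK hj.
have [||i2 [Q2 [v2 e2]]] := IH i1 (split_at j1 K).
- exact: built_split_at.
- by rewrite size_split_at.
exists i2, (j1 :: Q2); rewrite size_split_at // in v2.
by rewrite !splits_cons e1 e2 /= hj1 v2.
Qed.

Lemma normalizable_rot i K : built K -> normalizable K -> normalizable (rot_inner i K).
Proof.
move=> bK [Q [P [k [vQ vP e]]]]; have [i' [Q' [v' e']]] := splits_rotl i bK vQ.
have [bP sP] : built (splits P trivial_diagram) /\ size (innp (splits P trivial_diagram)) = 1 + size P.
  by have [|//|] := @built_splits P trivial_diagram; rewrite ?size_enum_ord //; exact: built_trivial.
have := ceq_rot i' e; rewrite -e'.
have gP := ef_good bP.
rewrite [X in ceq _ X]rot_innerE; last exact: good_rot.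
have [k2 ek2] : exists k2, rot i' (rot k (innp (splits P trivial_diagram))) = rot k2 (innp (splits P trivial_diagram)).
  by exists (rot_add (innp (splits P trivial_diagram)) k i'); rewrite rot_rot_add.
have -> : set_inner (rot i' (innp (rot_inner k (splits P trivial_diagram)))) = rot_inner k2 (splits P trivial_diagram).
  rewrite [RHS]rot_innerE // /set_inner; congr Complex => //=; rewrite ek2.
  have : 0 < size (rot k2 (innp (splits P trivial_diagram))) by rewrite size_rot sP.
  by case: (rot k2 _).
by move=> h; exists Q', P, k2; rewrite /= size_rot.
Qed.

(** Here the Ore condition enters: Q^-1 followed by the split becomes Q2 Q1^-1; then Q2 passes the
    rotation and is appended to P. *)
Lemma normalizable_split j K : built K -> j < size (innp K) ->
  normalizable K -> normalizable (split_at j K).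
Proof.
move=> bK hj [Q [P [k [vQ vP e]]]].
have [Q1 [Q2 [v1 v2 s12 h]]] := ore_step vQ hj.
have [bP sP] : built (splits P trivial_diagram) /\ size (innp (splits P trivial_diagram)) = 1 + size P.
  by have [|//|] := @built_splits P trivial_diagram; rewrite ?size_enum_ord //; exact: built_trivial.
have [bQ sQ] := built_splits vQ bK.
have sQP : size (innp K) + size Q = 1 + size P.
  by rewrite -sQ (ceq_size e) /= size_rot sP.
have [|k' [Q' [v' e']]] := @splits_rotr Q2 k _ bP; first by rewrite sP -sQP.
exists Q1, (P ++ Q'), k'; split.
- by rewrite size_split_at //; apply: ef_good.
- by rewrite valid_cat vP -sP.
rewrite splits_cat -e'; apply: ceq_trans (h K bK erefl) _.
by apply: ceq_splits => //; rewrite sQ.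
Qed.

Lemma normal_form K : built K -> normalizable K.
Proof.
elim=> {K} [x w [<- <-]|i K bK|K p q r s bK nK epq er hrs].
- exists [::], [::], 0; split=> //; rewrite rot_inner0 //; first exact: ceq_refl.
  exact: ef_good built_trivial.
- exact: normalizable_rot.
have gK := ef_good bK.
have eatt : attach p q s = att (size p) s K.
  by rewrite /att epq take_size_cat // drop_size_cat.
have ep : take (size p) (labels K) = r.
  by rewrite /labels epq map_cat take_size_cat ?size_map.
have bA : built (attach p q s) by apply: built_attach er hrs.
have sp : size p = size r by rewrite -er size_map.
have hp : 0 < size (innp K) by case: gK.
(* The cell is attached to the beginning of the inner path, so this is a split at position 0. *)
have h1 x : r = [:: x] -> s = split_label x -> normalizable (attach p q s).
  move=> erx es; suff -> : attach p q s = split_at 0 K by apply: normalizable_split.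
  rewrite /split_at rot_inner0 //; have <- : x = nth Le (labels K) 0.
    by move: ep; rewrite sp erx; case: (labels K) => //= y l; rewrite take0 => -[].
  rewrite eatt sp erx es subn0; have <- : size (innp (att 1 (split_label x) K)) = (size (innp K)).+1.
    by rewrite size_att // add2n subn1 prednK.
  rewrite rot_inner_size //; apply: ef_good; rewrite -[1]/(size [:: x]) -erx -sp -es -eatt.
  exact: bA.
(* An inverse split is absorbed by Q: the split at 0 that undoes it is put in front. *)
have h2 x : r = split_label x -> s = [:: x] -> normalizable (attach p q s).
  move=> erx es; have [Q [P [k [vQ vP e]]]] := nK.
  have sp2 : size p = 2 by rewrite sp erx.
  have hp2 : 1 < size (innp K) by rewrite epq size_cat sp2.
  have e0 : unsplit_at 0 x K = attach p q s.
    rewrite /unsplit_at rot_inner0 // eatt sp2 es subn0.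
    have <- : size (innp (att 2 [:: x] K)) = (size (innp K)).-1.
      by rewrite size_att //=; lia.
    by rewrite rot_inner_size //; apply: ef_good; rewrite -sp2 -es -eatt.
  have := @split_unsplit 0 x K bK hp2; rewrite rot0 -sp2 ep => /(_ erx).
  rewrite e0 => e1; exists (0 :: Q), P, k.
  have sA : size (innp (split_at 0 (attach p q s))) = size (innp K) by rewrite (ceq_size e1).
  have gA := ef_good bA; have A0 := good_gt0 gA.
  have sA' := size_split_at gA A0.
  split=> //; first by rewrite /= A0 -sA' sA.
  rewrite splits_cons; apply: ceq_trans e; apply: ceq_splits => //; first by rewrite sA.
  exact: built_split_at.
case: hrs => hrs; case: hrs {er eatt ep bA sp hp} h1 h2 => h1 h2.
- exact: (h1 Le).
- exact: (h1 Lf).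
- exact: (h2 Le).
- exact: (h2 Lf).
Qed.

End Words.

(** * Sequences of splits as trees *)

Section TreeWords.
Implicit Types K L : complex ef.
Local Notation built := (built ef_rels [:: Le]).

(* The right subtree is grown first, so that the position of the left one does
   not move. *)
Fixpoint tree_word (k : nat) (t : tree) : seq nat :=
  if t is Node l r then k :: tree_word k.+1 r ++ tree_word k l else [::].

Lemma size_tree_word k t : (size (tree_word k t)).+1 = size (leaves t).
Proof.
elim: t k => //= l IHl r IHr k; rewrite !size_cat !size_map -(IHl k) -(IHr k.+1).
by lia.
Qed.

Lemma valid_tree_word k n t : k < n -> valid n (tree_word k t).
Proof.
elim: t k n => //= l IHl r IHr k n hk; rewrite hk valid_cat IHr //= IHl //.
by lia.
Qed.

Lemma built_tree_word k t K : built K -> k < size (innp K) ->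
  built (splits (tree_word k t) K) /\
  size (innp (splits (tree_word k t) K)) = size (innp K) + (size (leaves t)).-1.
Proof.
by move=> bK hk; rewrite -(size_tree_word k t); apply: built_splits; rewrite ?valid_tree_word.
Qed.

Lemma ceq_tree_word k t K L : built K -> k < size (innp K) -> ceq K L ->
  ceq (splits (tree_word k t) K) (splits (tree_word k t) L).
Proof. by move=> bK hk; apply: ceq_splits => //; apply: valid_tree_word. Qed.

Lemma splits_Node k l r K : splits (tree_word k (Node l r)) K =
  splits (tree_word k l) (splits (tree_word k.+1 r) (split_at k K)).
Proof. by rewrite -splits_cat -splits_cons. Qed.

(** A split to the right of the edge on which [t] is grown commutes with the growth; its position
    shifts as one edge becomes [size (leaves t)] edges. *)
Lemma tree_word_comm t k m K : built K -> k + 1 + m < size (innp K) ->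
  ceq (split_at (k + size (leaves t) + m) (splits (tree_word k t) K))
      (splits (tree_word k t) (split_at (k + 1 + m) K)).
Proof.
elim: t k m K => [|l IHl r IHr] k m K bK hk; first exact: ceq_refl.
have hk0 : k < size (innp K) by lia.
have [b1 s1] := split_at_spec bK erefl hk0.
have hk1 : k.+1 < size (innp (split_at k K)) by rewrite s1.
have [b2 s2] := built_tree_word r b1 hk1.
rewrite !splits_Node; have gr := leaves_gt0 r.
have -> : k + size (leaves (Node l r)) + m = k + size (leaves l) + (size (leaves r) + m).
  by rewrite /= size_cat !size_map; lia.
apply: ceq_trans (IHl k (size (leaves r) + m) _ b2 _) _; first by rewrite s2 s1; lia.
apply: ceq_tree_word.
- by apply: built_split_at => //; rewrite s2 s1; lia.
- by rewrite (size_split_at (ef_good b2)) s2 s1; lia.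
have -> : k + 1 + (size (leaves r) + m) = k.+1 + size (leaves r) + m by lia.
apply: ceq_trans (IHr k.+1 m _ b1 _) _; first by rewrite s1; lia.
apply: ceq_tree_word.
- by apply: built_split_at => //; rewrite s1; lia.
- by rewrite (size_split_at (ef_good b1)) s1; lia.
have -> : k.+1 + 1 + m = (k + 1 + m).+1 by lia.
by apply: ceq_split_comm => //; lia.
Qed.

Lemma tree_word_grow t j : j < size (leaves t) -> exists t', forall k K,
  built K -> k < size (innp K) ->
  ceq (split_at (k + j) (splits (tree_word k t) K)) (splits (tree_word k t') K).
Proof.
elim: t j => [|l IHl r IHr] j hj.
  exists (Node Leaf Leaf) => k K _ _; have -> : j = 0 by case: j hj.
  by rewrite addn0; apply: ceq_refl.
have split_r K k : built K -> k < size (innp K) ->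
    [/\ built (split_at k K), k.+1 < size (innp (split_at k K)),
        built (splits (tree_word k.+1 r) (split_at k K)) &
        size (innp K) + size (leaves r) = size (innp (splits (tree_word k.+1 r) (split_at k K)))].
  move=> bK hk; have [b1 s1] := split_at_spec bK erefl hk.
  have hk1 : k.+1 < size (innp (split_at k K)) by rewrite s1.
  have [b2 ->] := built_tree_word r b1 hk1; have gr := leaves_gt0 r.
  by split=> //; rewrite s1; lia.
have [hjl|hjl] := ltnP j (size (leaves l)).
  have [l' hl'] := IHl j hjl; exists (Node l' r) => k K bK hk; rewrite !splits_Node.
  have [b1 s1 b2 s2] := split_r K k bK hk.
  by apply: hl' => //; rewrite -s2; lia.
have hjr : j - size (leaves l) < size (leaves r).
  by move: hj; rewrite /= size_cat !size_map; lia.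
have [r' hr'] := IHr _ hjr; exists (Node l r') => k K bK hk; rewrite !splits_Node.
have [b1 s1 b2 s2] := split_r K k bK hk.
have -> : k + j = k + size (leaves l) + (j - size (leaves l)) by lia.
apply: ceq_trans (tree_word_comm l b2 _) _; first by rewrite -s2; lia.
apply: ceq_tree_word.
- by apply: built_split_at => //; rewrite -s2; lia.
- by rewrite (size_split_at (ef_good b2)) -s2; lia.
by rewrite addn1; apply: hr'.
Qed.

(** Sequences of splits of one edge are, up to commutation, trees: each further split grows a caret
    at a leaf. *)
Lemma word_tree P : valid 1 P -> exists t, forall K, built K -> size (innp K) = 1 ->
  ceq (splits P K) (splits (tree_word 0 t) K).
Proof.
elim/last_ind: P => [_|P j IH]; first by exists Leaf => K *; apply: ceq_refl.
rewrite -cats1 valid_cat => /andP[vP /=]; rewrite andbT => hj.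
have [t ht] := IH vP.
(* The induction hypothesis speaks only of complexes; evaluating it on [trivial_diagram] counts the
   leaves. *)
have st : size (leaves t) = 1 + size P.
  have sT : size (innp trivial_diagram) = 1 by rewrite size_enum_ord.
  have := ceq_size (ht _ built_trivial sT).
  have [|_ ->] := @built_splits P trivial_diagram _ built_trivial; first by rewrite sT.
  have [|_ ->] := @built_tree_word 0 t trivial_diagram built_trivial; first by rewrite sT.
  by have := leaves_gt0 t; lia.
have [|t' ht'] := @tree_word_grow t j; first by rewrite st.
exists t' => K bK sK; rewrite splits_cat.
have [|bP sP] := @built_splits P K _ bK; first by rewrite sK.
apply: ceq_trans (ht' 0 K bK _); last by rewrite sK.
by rewrite splits_cons; apply: ceq_split_at; [rewrite sP sK|apply: ht].
Qed.

Definition ef_of (s : bool) : ef := if s then Lf else Le.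

Definition tree_labels s t : seq ef := [seq ef_of (foldl ef_step s p) | p <- leaves t].

Lemma tree_labels_Node s l r : tree_labels s (Node l r) =
  tree_labels (ef_step s false) l ++ tree_labels (ef_step s true) r.
Proof. by rewrite /tree_labels /= map_cat -!map_comp. Qed.

Lemma split_label_of s :
  split_label (ef_of s) = [:: ef_of (ef_step s false); ef_of (ef_step s true)].
Proof. by case: s. Qed.

Lemma labels_lt l x l' K : labels K = l ++ x :: l' -> size l < size (innp K).
Proof. by move=> e; rewrite -(size_map (@lab _ K)) -/(labels K) e size_cat addnS ltnS leq_addr. Qed.

Lemma labels_tree_word l s l' t K : built K -> labels K = l ++ ef_of s :: l' ->
  labels (splits (tree_word (size l) t) K) = l ++ tree_labels s t ++ l'.
Proof.
elim: t l s l' K => [|t1 IH1 t2 IH2] l s l' K bK e; first by rewrite e.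
have hl := labels_lt e; rewrite splits_Node tree_labels_Node.
have [b1 s1] := split_at_spec bK erefl hl.
have e1 := labels_split_at (ef_good bK) e; rewrite split_label_of cat_cons cat1s -cat_rcons in e1.
have := IH2 _ _ _ _ b1 e1; rewrite size_rcons cat_rcons => e2.
have [|b2 _] := @built_tree_word (size l).+1 t2 _ b1; first by rewrite s1.
by rewrite (IH1 _ _ _ _ b2 e2) -catA.
Qed.

(** Labels alone decide whether a block can be contracted. The order is the reverse of [tree_word]:
    left subtree, right subtree, root. *)
Lemma tree_unsplit t l s l' M : built M -> labels M = l ++ tree_labels s t ++ l' ->
  exists L, [/\ built L, labels L = l ++ ef_of s :: l' &
                ceq (splits (tree_word (size l) t) L) M].
Proof.
elim: t l s l' M => [|t1 IH1 t2 IH2] l s l' M bM e.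
  by exists M; split=> //; apply: ceq_refl.
rewrite tree_labels_Node -catA in e; have [L1 [b1 e1 h1]] := IH1 _ _ _ _ bM e.
rewrite -cat_rcons in e1; have [L2 [b2 e2 h2]] := IH2 _ _ _ _ b1 e1.
rewrite cat_rcons in e2; rewrite size_rcons in h2.
have sL2 : size (innp L2) = size l + (size l').+2.
  by rewrite -(size_map (@lab _ L2)) -/(labels L2) e2 size_cat.
have e3 : take 2 (rot (size l) (labels L2)) = split_label (ef_of s).
  by rewrite e2 rot_size_cat split_label_of /= take0.
have hl : (size l).+1 < size (innp L2) by rewrite sL2; lia.
have b3 := built_unsplit b2 e3.
have e4 : labels (unsplit_at (size l) (ef_of s) L2) = l ++ ef_of s :: l'.
  rewrite /unsplit_at labels_rot labels_att labels_rot e2 rot_size_cat /= drop0.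
  have -> : (size (innp L2)).-1 - size l = size (ef_of s :: l').
    by rewrite sL2 /=; lia.
  by rewrite -cat_cons rot_size_cat.
exists (unsplit_at (size l) (ef_of s) L2); split=> //; rewrite splits_Node.
have h3 := split_unsplit b2 hl e3.
have hl0 := labels_lt e4.
have b4 := built_split_at hl0 b3.
apply: ceq_trans (ceq_tree_word t1 _ _ (ceq_trans (ceq_tree_word t2 _ _ h3) h2)) h1 => //.
- by have [|] := @built_tree_word (size l).+1 t2 _ b4; rewrite ?(ceq_size h3).
- have [|_ ->] := @built_tree_word (size l).+1 t2 _ b4; first by rewrite (ceq_size h3).
  by rewrite (ceq_size h3); lia.
- by rewrite (ceq_size h3).
Qed.

End TreeWords.

(** * Valuations *)

Section Valuations.
Variable R : realType.
Local Notation circle := (circle R).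
Local Notation built := (built ef_rels [:: Le]).
Implicit Types K L : complex ef.

Definition bisects (f g h : circle -> circle) : Prop :=
  forall t, f (halve false t) = g t /\ f (halve true t) = h t.

Lemma bisects_fun f f' g h : bisects f g h -> bisects f' g h -> f = f'.
Proof.
move=> hf hf'; apply: funext => t; have [[] [s ->]] := halve_surj t.
  by rewrite (hf s).2 (hf' s).2.
by rewrite (hf s).1 (hf' s).1.
Qed.

Lemma bisects_inj f g h g' h' : bisects f g h -> bisects f g' h' -> g = g' /\ h = h'.
Proof.
move=> hf hf'; split; apply: funext => t; first by rewrite -(hf t).1 (hf' t).1.
by rewrite -(hf t).2 (hf' t).2.
Qed.

Lemma bisects_exists g h : exists f, bisects f g h.
Proof.
have /boolp.choice[f hf] : forall t : circle, exists u : circle, exists b s,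
    t = halve b s /\ u = if b then h s else g s.
  by move=> t; have [b [s e]] := halve_surj t; exists (if b then h s else g s), b, s.
exists f => t; split.
  by have [b [s [/halve_inj[<- <-] ->]]] := hf (halve false t).
by have [b [s [/halve_inj[<- <-] ->]]] := hf (halve true t).
Qed.

(* A valuation parametrizes the edges of a complex by maps of the circle, in
   such a way that the two edges on one side of a cell parametrize the two
   halves of the edge on the other side. *)
Definition cell_valued K (phi : cE K -> circle -> circle) (c : cC K) : Prop :=
  (forall a b1 b2, top c = [:: a] -> bot c = [:: b1; b2] ->
     bisects (phi a) (phi b1) (phi b2)) /\
  (forall a b1 b2, bot c = [:: a] -> top c = [:: b1; b2] ->
     bisects (phi a) (phi b1) (phi b2)).

Definition valuation K phi : Prop := forall c, @cell_valued K phi c.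

Definition inner_valuation K (psis : seq (circle -> circle)) : Prop :=
  exists phi, [/\ valuation phi, forall e : cE K, e \in outp K -> phi e = id &
                  map phi (innp K) = psis].

Lemma built_shape K (c : cC K) : built K ->
  (exists a b1 b2, top c = [:: a] /\ bot c = [:: b1; b2]) \/
  (exists a b1 b2, bot c = [:: a] /\ top c = [:: b1; b2]).
Proof.
move=> bK; elim: bK c => {K} [x w _ []|i K _ IH|K p q r s _ IH _ er hrs [c|]] //=.
  case: (IH c) => -[a [b1 [b2 [-> ->]]]]; first by left; exists (inl a), (inl b1), (inl b2).
  by right; exists (inl a), (inl b1), (inl b2).
have one x : r = [:: x] -> exists a, p = [:: a].
  by rewrite -er; case: (p) => [|a []] //; exists a.
have two x y : r = [:: x; y] -> exists a b, p = [:: a; b].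
  by rewrite -er; case: (p) => [|a [|b []]] //; exists a, b.
case: hrs => hrs; case: hrs {er} one two => one two.
- by have [a ->] := one _ erefl; left; exists (inl a), (inr ord0), (inr (Ordinal (isT : 1 < 2)));
  rewrite /= -?enumT enum_I2.
- by have [a ->] := one _ erefl; left; exists (inl a), (inr ord0), (inr (Ordinal (isT : 1 < 2)));
  rewrite /= -?enumT enum_I2.
- by have [a [b ->]] := two _ _ erefl; right; exists (inr ord0), (inl a), (inl b); rewrite /= -?enumT enum_I1.
- by have [a [b ->]] := two _ _ erefl; right; exists (inr ord0), (inl a), (inl b); rewrite /= -?enumT enum_I1.
Qed.

Lemma valuation_attach K (p q : seq (cE K)) s (phi : cE K + 'I_(size s) -> circle -> circle) :
  @valuation (attach p q s) phi -> @valuation K (phi \o inl).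
Proof.
move=> h c; have [h1 h2] := h (Some c); split=> a b1 b2 e1 e2.
  by apply: h1; rewrite /= ?e1 ?e2.
by apply: h2; rewrite /= ?e1 ?e2.
Qed.

(** Cells are attached from the outside inwards, and the values on the outer path of a cell
    determine those on its inner path, whether it splits or merges. *)
Lemma valuation_unique K (phi phi' : cE K -> circle -> circle) : built K ->
  valuation phi -> valuation phi' -> (forall e, e \in outp K -> phi e = phi' e) ->
  forall e, phi e = phi' e.
Proof.
move=> bK; elim: bK phi phi' => {K} [x w _|i K _ IH|K p q r s bK IH epq er hrs] phi phi' h h' ho.
- by move=> e; apply: ho; rewrite mem_enum.
- exact: IH.
have hK : forall e, phi (inl e) = phi' (inl e).
  apply: (IH (phi \o inl) (phi' \o inl)) => [||e he].
  - exact: valuation_attach h.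
  - exact: valuation_attach h'.
  - by apply: ho; rewrite /= map_f.
case=> [//|i]; have bA : built (attach p q s) by apply: built_attach bK epq er hrs.
have hi : (inr i : cE (attach p q s)) \in @bot _ (attach p q s) None.
  by rewrite /= map_f // mem_enum.
have hp : forall e, e \in @top _ (attach p q s) None -> phi e = phi' e.
  by move=> e /mapP[e' _ ->]; apply: hK.
have [h1 h2] := h None; have [h1' h2'] := h' None.
case: (@built_shape (attach p q s) None bA) => -[a [b1 [b2 [e1 e2]]]].
  have [|f1 f2] := bisects_inj (h1 _ _ _ e1 e2) (g' := phi' b1) (h' := phi' b2).
    by rewrite hp ?e1 ?mem_head //; apply: h1'.
  by move: hi; rewrite e2 !inE => /orP[] /eqP->.
move: hi; rewrite e1 inE => /eqP->; apply: bisects_fun (h2 _ _ _ e1 e2) _.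
by rewrite !hp ?e2 ?inE ?eqxx ?orbT //; apply: h2'.
Qed.

Lemma valuation_extend K (p q : seq (cE K)) s (phi : cE K -> circle -> circle) :
  (size p = 1 /\ size s = 2) \/ (size p = 2 /\ size s = 1) -> valuation phi ->
  exists phi' : cE (attach p q s) -> circle -> circle,
    valuation phi' /\ forall e, phi' (inl e) = phi e.
Proof.
have old (F : 'I_(size s) -> circle -> circle) :
    let phi' (e : cE (attach p q s)) := match e with inl e' => phi e' | inr i => F i end in
    valuation phi -> cell_valued phi' None -> valuation phi'.
  move=> phi' h hN [c|//]; have [h1 h2] := h c.
  split=> a b1 b2 /=.
    case: (top c) h1 => [//|a' [|//]] h1 [<-]; case: (bot c) h1 => [//|b1' [//|b2' [|//]]] h1.
    by case=> <- <-; apply: h1.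
  case: (bot c) h2 => [//|a' [|//]] h2 [<-]; case: (top c) h2 => [//|b1' [//|b2' [|//]]] h2.
  by case=> <- <-; apply: h2.
move=> hsz h; case: p old hsz => [|a [|b [|c p]]] old;
  case: s phi old h => [|x [|y [|z s]]] phi old h hsz; try (by case: hsz => -[]).
  exists (fun e => match e with inl e' => phi e'
            | inr i => fun t => phi a (halve (val i != 0) t) end).
  split=> //; apply: old => //; split=> a' b1 b2 /=; rewrite -?enumT enum_I2 //=.
  by move=> [<-] [<- <-] t.
have [f hf] := bisects_exists (phi a) (phi b).
exists (fun e => match e with inl e' => phi e' | inr i => f end).
split=> //; apply: old => //; split=> a' b1 b2 /=; rewrite -?enumT enum_I1 //=.
by move=> [<-] [<- <-].
Qed.

Lemma valuation_exists K : built K -> exists phi : cE K -> circle -> circle,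
  valuation phi /\ forall e, e \in outp K -> phi e = id.
Proof.
elim=> {K} [x w _|i K _ [phi hphi]|K p q r s bK [phi [h ho]] epq er hrs].
- by exists (fun _ => id); split=> // -[].
- by exists phi.
have [|phi' [h' e']] := @valuation_extend K p q s phi _ h.
  have -> : size p = size r by rewrite -er size_map.
  by case: hrs => -[]; [left|left|right|right].
exists phi'; split=> // e /mapP[e0 he ->].
by rewrite e' ho.
Qed.

Lemma inner_valuation_exists K : built K -> exists psis, inner_valuation K psis.
Proof.
by move=> /valuation_exists[phi [h ho]]; exists (map phi (innp K)), phi.
Qed.

Lemma inner_valuation_unique K psis psis' : built K ->
  inner_valuation K psis -> inner_valuation K psis' -> psis = psis'.
Proof.
move=> bK [phi [h ho <-]] [phi' [h' ho' <-]]; apply: eq_map.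
by apply: valuation_unique => // e he; rewrite ho ?ho'.
Qed.

Lemma inner_valuation_size K psis : inner_valuation K psis -> size psis = size (innp K).
Proof. by move=> [phi [_ _ <-]]; rewrite size_map. Qed.

Lemma iso_valuation K L psis : complex_iso K L -> inner_valuation K psis ->
  inner_valuation L psis.
Proof.
move=> [fV [fE [fC [[_ [gE fEK gEK] [gC fCK gCK]] [_ [ht hb [ho _] [hi _]]]]]]].
move=> [phi [h hout <-]]; exists (phi \o gE).
have eg l : map gE (map fE l) = l by rewrite -map_comp map_id_in // => x _ /=; rewrite fEK.
split.
- move=> c; have := h (gC c); rewrite -{2}(gCK c) /cell_valued ht hb.
  move=> [h1 h2]; split=> a b1 b2 e1 e2.
    apply: h1; first by rewrite -[top _]eg e1.
    by rewrite -[bot _]eg e2.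
  apply: h2; first by rewrite -[bot _]eg e1.
  by rewrite -[top _]eg e2.
- by move=> e; rewrite ho => /mapP[e' he' ->] /=; rewrite fEK hout.
- by rewrite hi map_comp eg.
Qed.

(** The values on the path inside the dipole determine those on both outer sides in the same way, so
    identified edges have equal values and the valuation descends to [L]. *)
Lemma dipole_valuation K L psis : built K -> dipole_removal K L ->
  inner_valuation K psis -> inner_valuation L psis.
Proof.
move=> bK [c1 [c2 [[bt lt] [fV [fE [gC [[_ sE sC] [[_ eE _] [_
  [ht hb [ho _] [hi _]]]]]]]]]]] [phi [h hout hin]].
have gK := ef_good bK.
have /boolp.choice[gE hgE] : forall e, exists e', e' \notin bot c1 /\ fE e' = e.
  by move=> e; have [e' k e1] := sE e; exists e'.
have zip_phi e f : (e, f) \in zip (top c1) (bot c2) -> phi e = phi f.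
  have [h1 h2] := h c1; have [h1' h2'] := h c2.
  (* The two sides have equal labels, hence equal lengths, so the same kind of bisection holds in
     both cells. *)
  have st : size (top c1) = size (bot c2).
    by have := congr1 size lt; rewrite !size_map.
  case: (built_shape c1 bK) => -[a [b1 [b2 [e1 e2]]]].
    move: st; rewrite e1; case e3 : (bot c2) => [//|a' [|//]] _.
    rewrite /= inE => /eqP[-> ->]; apply: bisects_fun (h1 _ _ _ e1 e2) _.
    by apply: h2' => //; rewrite -bt.
  move: st; rewrite e2; case e3 : (bot c2) => [//|b1' [//|b2' [|//]]] _.
  have [f1 f2] := bisects_inj (h2 _ _ _ e1 e2) (h1' a _ _ (etrans (esym bt) e1) e3).
  by rewrite /= !inE => /orP[] /eqP[-> ->].
have kept e : e \notin bot c1 -> phi (gE (fE e)) = phi e.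
  move=> ke; have [kg eg] := hgE (fE e); case/(eE _ _ kg ke): eg => [->//|/zip_phi//|/zip_phi//].
have kept_all l : (forall e, e \in l -> e \notin bot c1) ->
    map (phi \o gE) (map fE l) = map phi l.
  by move=> kl; rewrite -map_comp; apply/eq_in_map => e /kl/kept.
have gC_ne c : gC c <> c1 /\ gC c <> c2.
  have /sC : exists c', gC c' = gC c by exists c.
  by rewrite !inE negb_or => /andP[/eqP ? /eqP ?].
have ktop c e : e \in top (gC c) -> e \notin bot c1.
  move=> he; apply/negP; rewrite bt => he2; have [_] := gC_ne c; apply.
  exact: good_top_inj he he2.
have kbot c e : e \in bot (gC c) -> e \notin bot c1.
  move=> he; apply/negP => he2; have [ne _] := gC_ne c; apply: ne.
  exact: good_bot_inj he he2.
exists (phi \o gE); split.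
- move=> c; have [h1 h2] := h (gC c); split=> a b1 b2.
    rewrite ht hb; case et : (top (gC c)) => [//|a' [|//]] [<-].
    case eb : (bot (gC c)) => [//|b1' [//|b2' [|//]]] [<- <-] /=.
    have k x : x \in [:: b1'; b2'] -> x \notin bot c1 by rewrite -eb; apply: kbot.
    have ka : a' \notin bot c1 by apply: (ktop c); rewrite et mem_head.
    rewrite (kept _ ka) !kept ?k ?inE ?eqxx ?orbT //; exact: (h1 _ _ _ et eb).
  rewrite ht hb; case eb : (bot (gC c)) => [//|a' [|//]] [<-].
  case et : (top (gC c)) => [//|b1' [//|b2' [|//]]] [<- <-] /=.
  have k x : x \in [:: b1'; b2'] -> x \notin bot c1 by rewrite -et; apply: ktop.
  have ka : a' \notin bot c1 by apply: (kbot c); rewrite eb mem_head.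
  rewrite (kept _ ka) !kept ?k ?inE ?eqxx ?orbT //; exact: (h2 _ _ _ eb et).
- move=> e; rewrite ho => /mapP[e' he' ->] /=; rewrite kept ?hout //.
  by apply/negP => /(good_bot_outp gK); rewrite he'.
- rewrite hi kept_all // => e he; apply/negP; rewrite bt => /(good_top_innp gK).
  by rewrite he.
Qed.

(** Transport along a move is available in one direction; existence on the source and uniqueness on
    the target give the other. *)
Lemma ceq_valuation K L psis : ceq K L -> inner_valuation K psis <-> inner_valuation L psis.
Proof.
move=> e; elim: e psis => {K L} [K L m|K|K L _ IH|K L M _ IH _ IH'] psis //.
- have step psis' : inner_valuation K psis' -> inner_valuation L psis'.
    by case: m => bK _ [] m; [apply: iso_valuation|apply: dipole_valuation].
  split=> [/step//|hL]; case: m => bK bL _.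
  have [psis' hK] := inner_valuation_exists bK.
  by rewrite (inner_valuation_unique bL hL (step _ hK)).
- by split=> /IH.
- by split=> [/IH/IH'|/IH'/IH].
Qed.

Lemma rot_valuation i K psis : inner_valuation K psis ->
  inner_valuation (rot_inner i K) (rot i psis).
Proof. by move=> [phi [h ho <-]]; exists phi; split=> //=; rewrite map_rot. Qed.

Lemma split_valuation K l psi l' : good K -> inner_valuation K (l ++ psi :: l') ->
  inner_valuation (split_at (size l) K) (l ++ [:: psi \o halve false; psi \o halve true] ++ l').
Proof.
move=> gK hK; have hl : size l < size (innp K).
  by rewrite -(inner_valuation_size hK) size_cat addnS ltnS leq_addr.
have [A [e [B [eK sA]]]] := innp_nth hl.
have [e1 e2] := split_at_innp gK eK; rewrite -sA e1.
case: hK => phi [h ho]; rewrite eK map_cat => hi.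
have hA := congr1 (take (size l)) hi; have hB := congr1 (drop (size l)) hi.
rewrite !take_size_cat ?size_map // in hA.
rewrite !drop_size_cat ?size_map // in hB; case: hB => he hB.
exists (fun x => match x with inl x' => phi x'
          | inr i => phi e \o halve (val i != 0) end); split.
- move=> [c|].
    have [h1 h2] := h c; split=> a b1 b2 /=.
      case: (top c) h1 => [//|a' [|//]] h1 [<-]; case: (bot c) h1 => [//|b1' [//|b2' [|//]]] h1.
      by case=> <- <-; apply: h1.
    case: (bot c) h2 => [//|a' [|//]] h2 [<-]; case: (top c) h2 => [//|b1' [//|b2' [|//]]] h2.
    by case=> <- <-; apply: h2.
  by split=> a b1 b2 /=; rewrite -?enumT enum_I2 //= => -[<-] [<- <-] t.
- by move=> x /mapP[x' hx ->]; apply: ho.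
- by rewrite e2 !map_cat -!map_comp /= -hA -hB he.
Qed.

Lemma tree_valuation K l psi l' t : built K -> inner_valuation K (l ++ psi :: l') ->
  inner_valuation (splits (tree_word (size l) t) K)
    (l ++ [seq psi \o cone p | p <- leaves t] ++ l').
Proof.
elim: t l psi l' K => [//|t1 IH1 t2 IH2] l psi l' K bK hK.
have hl : size l < size (innp K).
  by rewrite -(inner_valuation_size hK) size_cat addnS ltnS leq_addr.
rewrite splits_Node; have [b1 s1] := split_at_spec bK erefl hl.
have h1 := split_valuation (ef_good bK) hK; rewrite /= -cat_rcons in h1.
have := IH2 _ _ _ _ b1 h1; rewrite size_rcons cat_rcons => h2.
have [|b2 _] := @built_tree_word (size l).+1 t2 _ b1; first by rewrite s1.
by have := IH1 _ _ _ _ b2 h2; rewrite /= map_cat -!map_comp -catA.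
Qed.

Lemma trivial_valuation : inner_valuation trivial_diagram [:: id].
Proof.
by exists (fun _ => id); split=> [[]|//|]; rewrite /= -?enumT enum_I1.
Qed.

End Valuations.

Lemma zip_rot (S T : Type) i (s : seq S) (t : seq T) : size s = size t ->
  zip (rot i s) (rot i t) = rot i (zip s t).
Proof.
move=> e; rewrite /rot zip_cat ?size_drop ?e //; congr cat.
  by elim: i s t e => [|i IH] [|x s] [|y t] //= [/IH].
by elim: i s t e => [|i IH] [|x s] [|y t] //= [/IH->].
Qed.

(** Without repetitions a rotated list determines the amount of rotation modulo the length. This
    carries an equality of rotated leaf lists over to inner paths. *)
Lemma rot_uniq_transfer (S T : eqType) (s : seq S) (t : seq T) i j : uniq s ->
  size t = size s -> rot i s = rot j s -> rot i t = rot j t.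
Proof.
move=> us st e.
have small k : exists k', [/\ (k' < size s)%N || (s == [::]), rot k s = rot k' s & rot k t = rot k' t].
  case: (ltnP k (size s)) => hk; first by exists k; rewrite hk.
  exists 0; rewrite !rot0 !rot_oversize ?st //; split=> //.
  by rewrite -size_eq0; case: (size s).
have [i' [hi ei ->]] := small i; have [j' [hj ej ->]] := small j.
move: e; rewrite ei ej => e; case/orP: hi => [hi|/eqP s0]; last first.
  by case: (t) st; rewrite s0.
case/orP: hj => [hj|/eqP s0]; last by case: (t) st; rewrite s0.
suff -> : i' = j' by [].
case: s us hi hj e {ei ej small st} => // x s us hi hj e.
have := congr1 (fun l => nth x l 0) e; rewrite !nth_rot // 1?ltnW // !add0n.
by rewrite !modn_small // => /eqP; rewrite nth_uniq // => /eqP.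
Qed.

(** * The circle map of an annular diagram *)

Section DiagramMaps.
Variable R : realType.
Local Notation circle := (circle R).
Local Notation built := (built ef_rels [:: Le]).
Implicit Types K L : complex ef.

Lemma leaf_cone t (x : circle) : exists p s, p \in leaves t /\ x = cone p s.
Proof.
elim: t x => [|l IHl r IHr] x; first by exists [::], x.
have [b [y ->]] := halve_surj x.
have [p [s [hp ->]]] : exists p s, p \in leaves (if b then r else l) /\ y = cone p s.
  by case: b; [apply: IHr|apply: IHl].
by exists (b :: p), s; rewrite mem_leaves_Node.
Qed.

Lemma leaf_cone_inj t p q (s s' : circle) : p \in leaves t -> q \in leaves t ->
  cone p s = cone q s' -> p = q /\ s = s'.
Proof.
wlog le_pq : p q s s' / (size p <= size q)%N => [th hp hq e|hp hq e].
  case: (leqP (size p) (size q)) => [h|/ltnW h]; first exact: th.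
  by have [-> ->] := th _ _ _ _ h hq hp (esym e).
have [w [eq es]] := cone_compare le_pq e.
rewrite eq in hq; have w0 := leaves_prefix hp hq.
by rewrite eq es w0 cats0.
Qed.

(* The diagram K equals (T, rotation by i, S^-1). *)
Definition tree_form K S i T : Prop :=
  ceq (splits (tree_word 0 S) K) (rot_inner i (splits (tree_word 0 T) trivial_diagram)).

Definition leaf_pairs S i T := zip (rot i (leaves T)) (leaves S).

Lemma size_trivial : size (innp trivial_diagram) = 1.
Proof. by rewrite size_enum_ord. Qed.

Lemma built_word P : valid 1 P -> built (splits P trivial_diagram) /\
  size (innp (splits P trivial_diagram)) = 1 + size P.
Proof.
move=> vP; have := @built_splits P trivial_diagram.
by rewrite size_trivial => /(_ vP built_trivial).
Qed.

Lemma labels_trivial : labels trivial_diagram = [:: Le].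
Proof. by rewrite -[LHS]/(map (tnth (in_tuple [:: Le])) (enum _)) map_tnth_enum. Qed.

(** Compares labels and valuations on the inner paths of the two sides of the tree form: the edge of
    leaf [q] of [S] carries [psi \o cone q], that of leaf [p] of [T] carries [cone p], and labels
    encode states. *)
Lemma tree_form_spec K S i T (psi : circle -> circle) : built K ->
  labels K = [:: Le] -> tree_form K S i T -> inner_valuation K [:: psi] ->
  [/\ size (leaves S) = size (leaves T),
      forall p q, (p, q) \in leaf_pairs S i T -> same_run p q /\ psi \o cone q = cone p &
      map (fun q => psi \o cone q) (leaves S) = map (@cone R) (rot i (leaves T))].
Proof.
move=> bK lK form hpsi.
have hv : map (fun q => psi \o cone q) (leaves S) = map (@cone R) (rot i (leaves T)).
  have h1 := @tree_valuation R K [::] psi [::] S bK hpsi.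
  have h2 := @tree_valuation R _ [::] id [::] T built_trivial (@trivial_valuation R).
  rewrite /= !cats0 in h1 h2.
  have h3 := (ceq_valuation _ form).1 h1.
  have [|bT _] := @built_tree_word 0 T _ built_trivial; first by rewrite size_trivial.
  by rewrite (inner_valuation_unique (built_rot i bT) h3 (rot_valuation i h2)) map_rot.
have hl : tree_labels false S = rot i (tree_labels false T).
  have := labels_tree_word (l := [::]) (s := false) (l' := [::]) S bK lK.
  have := labels_tree_word (l := [::]) (s := false) (l' := [::]) T built_trivial labels_trivial.
  by rewrite /= !cats0 => <- <-; rewrite (ceq_labels form) labels_rot.
have sz : size (leaves S) = size (leaves T).
  by have := congr1 size hv; rewrite !size_map size_rot.
split=> // p q /(nthP ([::], [::]))[j]; rewrite size1_zip ?size_rot ?sz // => hj.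
rewrite nth_zip ?size_rot ?sz // => -[<- <-].
have hjS : (j < size (leaves S))%N by rewrite sz.
have hjT : (j < size (rot i (leaves T)))%N by rewrite size_rot.
split.
  have := congr1 (fun l => nth Le l j) hl; rewrite /tree_labels -map_rot.
  rewrite (nth_map [::]) // (nth_map [::]) // /same_run /ef_run.
  by case: (foldl _ _ _) (foldl _ _ _) => [] [].
have := congr1 (fun l => nth (@cone R [::]) l j) hv.
by rewrite (nth_map [::]) // (nth_map [::]).
Qed.

Lemma tree_form_exists K : built K -> size (innp K) = 1 -> exists S i T, tree_form K S i T.
Proof.
move=> bK sK; have [Q [P [i [vQ vP e]]]] := normal_form bK; rewrite sK in vQ.
have [S hS] := word_tree vQ; have [T hT] := word_tree vP.
exists S, i, T; apply: ceq_trans (ceq_sym (hS K bK sK)) _.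
apply: ceq_trans e _; apply: ceq_rot; apply: hT; [exact: built_trivial|exact: size_trivial].
Qed.

Definition diagram_map K (g : circle -> circle) : Prop :=
  exists psi, [/\ inner_valuation K [:: psi], cancel psi g & cancel g psi].

Lemma leaf_pairs_cover S i T (x : circle) : size (leaves S) = size (leaves T) ->
  (exists p q s, (p, q) \in leaf_pairs S i T /\ x = cone p s) /\
  (exists p q s, (p, q) \in leaf_pairs S i T /\ x = cone q s).
Proof.
move=> sz; have pair j : (j < size (leaves S))%N ->
    (nth [::] (rot i (leaves T)) j, nth [::] (leaves S) j) \in leaf_pairs S i T.
  move=> hj; rewrite -nth_zip ?size_rot ?sz //; apply: mem_nth.
  by rewrite size1_zip size_rot -?sz.
split.
  have [p [s [hp ->]]] := leaf_cone T x; rewrite -(mem_rot i) in hp.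
  exists p, (nth [::] (leaves S) (index p (rot i (leaves T)))), s; split=> //.
  rewrite -{1}(nth_index [::] hp); apply: pair.
  by rewrite sz -(size_rot i) index_mem.
have [q [s [hq ->]]] := leaf_cone S x.
exists (nth [::] (rot i (leaves T)) (index q (leaves S))), q, s; split=> //.
by rewrite -{2}(nth_index [::] hq); apply: pair; rewrite index_mem.
Qed.

Lemma tree_form_map K S i T (g : circle -> circle) : built K -> labels K = [:: Le] ->
  tree_form K S i T -> (forall p q, (p, q) \in leaf_pairs S i T -> maps g p q) ->
  diagram_map K g.
Proof.
move=> bK lK form hg; have [psis hpsi] := inner_valuation_exists R bK.
have [psi epsi] : exists psi, psis = [:: psi].
  have := inner_valuation_size hpsi; rewrite -(size_map (@lab _ K)) -/(labels K) lK.
  by case: psis {hpsi} => [|psi []] //; exists psi.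
rewrite epsi in hpsi; have [sz hp _] := tree_form_spec bK lK form hpsi.
have psiE p q s : (p, q) \in leaf_pairs S i T -> psi (cone q s) = cone p s.
  by move=> /hp[_ e]; have := congr1 (fun f => f s) e.
exists psi; split=> // x.
  have [_ [p [q [s [hpq ->]]]]] := leaf_pairs_cover i x sz.
  by rewrite (psiE _ _ _ hpq) (hg _ _ hpq).
have [[p [q [s [hpq ->]]]] _] := leaf_pairs_cover i x sz.
by rewrite (hg _ _ hpq) (psiE _ _ _ hpq).
Qed.

Lemma annular_labels K : annular ef_rels [:: Le] K -> labels K = [:: Le].
Proof. by case. Qed.

Lemma annular_size K : annular ef_rels [:: Le] K -> size (innp K) = 1.
Proof. by move=> /annular_labels/(congr1 size); rewrite size_map. Qed.

Lemma leaf_pairs_triple S i T : size (leaves S) = size (leaves T) ->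
  exists d, [/\ tdom d = T, tran d = S, wf_triple d &
    forall p q, leaf_identified d p q -> (p, q) \in leaf_pairs S i T].
Proof.
move=> sz; have [k ek] := @rot_sym _ i (leaves T) _ erefl.
have [d [dT dS wf er]] := triple_of_rot k (esym sz).
exists d; split=> // p q /(leaf_identified_zip _ _ wf).
rewrite dT dS er {1}ek zip_rot ?mem_rot ?size_rot //.
Qed.

Lemma diagram_map_exists K : annular ef_rels [:: Le] K ->
  exists g, vecT g /\ diagram_map K g.
Proof.
move=> aK; have [bK _] := aK; have lK := annular_labels aK.
have [S [i [T form]]] := tree_form_exists bK (annular_size aK).
have [psis hpsi] := inner_valuation_exists R bK.
have [psi epsi] : exists psi, psis = [:: psi].
  have := inner_valuation_size hpsi; rewrite annular_size //.
  by case: psis {hpsi} => [|psi []] //; exists psi.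
rewrite epsi in hpsi; have [sz hp _] := tree_form_spec bK lK form hpsi.
have /boolp.choice[g hg] : forall x : circle, exists y : circle, exists p q s,
    [/\ (p, q) \in leaf_pairs S i T, x = cone p s & y = cone q s].
  move=> x; have [[p [q [s [hpq ->]]]] _] := leaf_pairs_cover i x sz.
  by exists (cone q s), p, q, s.
(* A point lies in the cone of only one leaf of [T], so the pointwise choice of [g] follows the
   pairing of leaves. *)
have gm p q : (p, q) \in leaf_pairs S i T -> maps g p q.
  move=> hpq t; have [p' [q' [s [hpq' e ->]]]] := hg (cone p t).
  have [h1 _] := mem_zip hpq; have [h1' _] := mem_zip hpq'.
  rewrite !mem_rot in h1 h1'; have [ep es] := leaf_cone_inj h1 h1' e.
  rewrite -ep in hpq'; rewrite -es; congr cone.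
  have u : uniq (rot i (leaves T)) by rewrite rot_uniq leaves_uniq.
  by rewrite (mem_zip_nth [::] u _ hpq) ?(mem_zip_nth [::] u _ hpq') ?size_rot.
exists g; split; last exact: tree_form_map form gm.
have [d [dT dS wf hd]] := leaf_pairs_triple i sz.
apply/vecTP; exists d; split; first by apply/represents_maps; split=> // p q /hd/gm.
by split=> // p q /hd/hp[].
Qed.

(** Grow [T] on the trivial diagram and rotate. Identified leaves are in the same state, so the
    inner path now reads the leaf labels of [S] and can be contracted along [S] to one edge labelled
    e. *)
Lemma diagram_of_map (g : circle -> circle) : vecT g ->
  exists K, annular ef_rels [:: Le] K /\ diagram_map K g.
Proof.
move=> /vecTP[d [/represents_maps[wf hg] [_ hrun]]].
set T := tdom d in hg hrun; set S := tran d.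
have sz : size (leaves S) = size (leaves T) by case: wf.
set k := (tshift d).-1; have hz p q := leaf_identified_zip p q wf.
have [i ei] := @rot_sym _ k (leaves S) _ erefl.
have pairs p q : (p, q) \in leaf_pairs S i T -> leaf_identified d p q.
  by rewrite /leaf_pairs {1}ei zip_rot ?size_rot // mem_rot => /hz.
have bT := (@built_tree_word 0 T _ built_trivial); rewrite size_trivial in bT.
have {bT} [//|bT _] := bT.
have hl : labels (rot_inner i (splits (tree_word 0 T) trivial_diagram)) =
    [::] ++ tree_labels false S ++ [::].
  rewrite labels_rot (labels_tree_word (l := [::]) (s := false) (l' := [::])) ?labels_trivial //= ?cats0; last exact: built_trivial.
  rewrite /tree_labels -map_rot; apply: (@eq_from_nth _ Le) => [|j].
    by rewrite !size_map size_rot.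
  rewrite size_map size_rot => hj; rewrite -sz in hj.
  rewrite (nth_map [::]) ?size_rot -?sz // (nth_map [::]) //.
  congr ef_of; apply: hrun; apply: pairs; rewrite /leaf_pairs.
  rewrite -nth_zip ?size_rot //; apply: mem_nth.
  by rewrite size1_zip size_rot -?sz.
have [L [bL lL form]] := tree_unsplit (built_rot i bT) hl.
exists L; split; first by split.
by apply: (tree_form_map bL lL form) => p q /pairs/hg.
Qed.

Lemma diagram_map_fun K g g' : built K -> diagram_map K g -> diagram_map K g' -> g = g'.
Proof.
move=> bK [psi [h c1 c2]] [psi' [h' c1' c2']].
case: (inner_valuation_unique bK h h') => e; apply: funext => t.
by rewrite -{1}(c2' t) -e c1.
Qed.

Lemma diagram_map_ceq K L g : ceq K L -> diagram_map K g -> diagram_map L g.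
Proof.
move=> e [psi [h c1 c2]]; exists psi; split=> //.
exact: (ceq_valuation _ e).1.
Qed.

(** Refine the two inner trees to a common tree [U]. The common parametrization then gives both
    forms the same rotated list of leaves on the outer side, hence the same outer tree and equal
    rotations, and the splits along [U] cancel. *)
Lemma diagram_map_inj K L (g : circle -> circle) : annular ef_rels [:: Le] K ->
  annular ef_rels [:: Le] L -> diagram_map K g -> diagram_map L g -> ceq K L.
Proof.
move=> aK aL [psi [hK c1 c2]] [psi' [hL c1' c2']].
have epsi : psi = psi' by apply: funext => t; rewrite -(c2 (psi' t)) c1'.
rewrite -{}epsi in hL; have [[bK _] [bL _]] := (aK, aL).
have sK := annular_size aK; have sL := annular_size aL.
have [S [i [T formK]]] := tree_form_exists bK sK.
have [S' [i' [T' formL]]] := tree_form_exists bL sL.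
have v k t : k < 1 -> valid 1 (tree_word k t) := @valid_tree_word k 1 t.
have [P1 [Q1 [v1 v2 s12 hore]]] := ore (v 0 S isT) (v 0 S' isT).
have vW : valid 1 (tree_word 0 S ++ Q1) by rewrite valid_cat v.
have [U hU] := word_tree vW.
(* Further splits [Q] of the inner side pass the rotation and enlarge the outer tree. *)
have reform M t j Z Q : built M -> size (innp M) = 1 -> tree_form M Z j t ->
    valid (1 + size (tree_word 0 Z)) Q -> exists i2 T2,
    ceq (splits Q (splits (tree_word 0 Z) M)) (rot_inner i2 (splits (tree_word 0 T2) trivial_diagram)).
  move=> bM sM form vQ.
  have [bZ sZ] : built (splits (tree_word 0 Z) M) /\
      size (innp (splits (tree_word 0 Z) M)) = 1 + size (tree_word 0 Z).
    by rewrite -sM; apply: built_splits; rewrite ?sM ?v.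
  have [bt st] : built (splits (tree_word 0 t) trivial_diagram) /\
      size (innp (splits (tree_word 0 t) trivial_diagram)) = 1 + size (tree_word 0 t).
    exact: built_word (v 0 t isT).
  have e1 : ceq (splits Q (splits (tree_word 0 Z) M)) (splits Q (rot_inner j (splits (tree_word 0 t) trivial_diagram))).
    by apply: ceq_splits; rewrite ?sZ.
  have szt : size (innp (splits (tree_word 0 t) trivial_diagram)) = 1 + size (tree_word 0 Z).
    by rewrite -sZ (ceq_size form) /= size_rot.
  have [|i2 [Q2 [v2' e2]]] := @splits_rotr Q j _ bt; first by rewrite szt.
  have [|T2 hT2] := @word_tree (tree_word 0 t ++ Q2); first by rewrite valid_cat v // -st.
  exists i2, T2; apply: ceq_trans e1 _; rewrite e2 -splits_cat; apply: ceq_rot.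
  by apply: hT2; [exact: built_trivial|exact: size_trivial].
have [i2 [T2 e2]] := reform K T i S Q1 bK sK formK v1.
have [i3 [T3 e3]] := reform L T' i' S' P1 bL sL formL v2.
have fK : tree_form K U i2 T2.
  by apply: ceq_trans (ceq_sym (hU K bK sK)) _; rewrite splits_cat.
have fL : tree_form L U i3 T3.
  apply: ceq_trans (ceq_sym (hU L bL sL)) _; rewrite splits_cat.
  exact: ceq_trans (hore L bL sL) e3.
have [szK _ vK] := tree_form_spec bK (annular_labels aK) fK hK.
have [szL _ vL] := tree_form_spec bL (annular_labels aL) fL hL.
have er : rot i2 (leaves T2) = rot i3 (leaves T3).
  have cone_inj : injective (@cone R).
    by move=> p q e; apply: (@cone_fun_inj R) => t; rewrite e.
  by apply: (inj_map cone_inj); rewrite -vK -vL.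
have eT : T2 = T3.
  by apply: leaves_inj => p; rewrite -(mem_rot i2) er mem_rot.
rewrite -{}eT in er fL.
have [bT sT] : built (splits (tree_word 0 T2) trivial_diagram) /\
    size (innp (splits (tree_word 0 T2) trivial_diagram)) = 1 + size (tree_word 0 T2).
  exact: built_word (v 0 T2 isT).
have erot : rot_inner i2 (splits (tree_word 0 T2) trivial_diagram) =
            rot_inner i3 (splits (tree_word 0 T2) trivial_diagram).
  have gT := ef_good bT; rewrite !rot_innerE //; congr set_inner.
  by apply: rot_uniq_transfer er; rewrite ?leaves_uniq // sT -(size_tree_word 0).
apply: (splits_cancel bK bL (Q := tree_word 0 U)); rewrite ?sK ?sL ?v //.
by apply: ceq_trans fK _; rewrite erot; apply: ceq_sym.
Qed.

End DiagramMaps.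

(** * Gluing and the isomorphism *)

Lemma mem_zip_inlr (S A B : eqType) (s : seq S) (t : seq A) x a :
  ((x, inl a) \in zip s (map (@inl A B) t)) = ((x, a) \in zip s t).
Proof. by elim: s t => [|y s IH] [|b t] //=; rewrite !inE IH. Qed.

Section Gluing.
Implicit Types K L M : complex ef.
Local Notation built := (built ef_rels [:: Le]).

Lemma glued_attach K L M (p q : seq (cE L)) s : innp L = p ++ q -> glued K L M ->
  exists p' q' : seq (cE M), [/\ innp M = p' ++ q',
    map (@lab _ M) p' = map (@lab _ L) p & glued K (attach p q s) (attach p' q' s)].
Proof.
move=> epq [fV [fE [fC [gV [gE [gC [[[fVi fEi fCi] [gVi gEi gCi] [sV sE sC] [eV eE eC]]
  [[hf hg htf htg] [[ho hov] [hi hiv]]]]]]]]]].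
exists (map gE p), (map gE q); split.
- by rewrite hi epq map_cat.
- by rewrite -map_comp; apply: eq_map => e /=; have [_ _ ->] := hg e.
have inl_inj (A B : Type) : injective (@inl A B) by move=> x y [].
have hnv j : new_vertex (map gE p) s j = smap gV (new_vertex p s j).
  by apply: new_vertex_map => // e _; have [_ -> _] := hg e.
have smap_inj (A B C : Type) (f : A -> B) : injective f -> injective (@smap A B C f).
  by move=> fi [a|c] [a'|c'] //= [e]; [rewrite (fi _ _ e)|rewrite e].
have osrc : map (@src _ (attach p q s)) (map inl (outp L)) = map inl (map (@src _ L) (outp L)).
  by rewrite -!map_comp.
exists (inl \o fV), (inl \o fE), (Some \o fC), (smap gV), (smap gE), (omap gC).
split; [split|split]; [split|split|split|split|split|split].
- by move=> x y /= [/fVi].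
- by move=> x y /= [/fEi].
- by move=> x y /= [/fCi].
- exact: smap_inj.
- exact: smap_inj.
- by move=> [c|] [c'|] //= [/gCi->].
- move=> [v|i]; last by right; exists (inr i).
  by case: (sV v) => -[v' <-]; [left; exists v'|right; exists (inl v')].
- move=> [v|i]; last by right; exists (inr i).
  by case: (sE v) => -[v' <-]; [left; exists v'|right; exists (inl v')].
- move=> [v|]; last by right; exists None.
  by case: (sC v) => -[v' <-]; [left; exists v'|right; exists (Some v')].
- move=> v [w|i] /=; rewrite osrc.
    by rewrite mem_zip_inlr -eV; split=> [[]|->].
  by split=> [//|/mem_zip[_ /mapP[]]].
- move=> v [w|i] /=.
    by rewrite mem_zip_inlr -eE; split=> [[]|->].
  by split=> [//|/mem_zip[_ /mapP[]]].
- by move=> c [c'|] //= [/eC].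
- by move=> e /=; have [-> -> ->] := hf e.
- case=> [e|i]; first by have [h1 h2 h3] := hg e; rewrite /= h1 h2 h3.
  by split=> //; apply: hnv.
- by move=> c /=; have [-> ->] := htf c; rewrite -!map_comp.
- by move=> [c|] /=; rewrite ?(htg c).1 ?(htg c).2 -!map_comp.
- by rewrite /= ho hov -!map_comp.
- by rewrite /= hiv map_cat -!map_comp.
Qed.

Lemma glued_rot i K L M : glued K L M -> glued K (rot_inner i L) (rot_inner i M).
Proof.
move=> [fV [fE [fC [gV [gE [gC [h1 [h2 [ho [hi hiv]]]]]]]]]].
exists fV, fE, fC, gV, gE, gC; split=> //; split=> //; split=> //=.
rewrite hi map_rot hiv -map_take -map_comp -(last_map gV) -map_comp; split=> //.
by congr last; apply: eq_map => e /=; case: h2 => _ h2 _ _; have [_ -> _] := h2 e.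
Qed.

Lemma glued_trivial K : annular ef_rels [:: Le] K -> glued K trivial_diagram K.
Proof.
move=> [bK lK]; have gK := ef_good bK.
have [e1 ei] : exists e1, innp K = [:: e1].
  by move: lK; case: (innp K) => [|e1 []] //; exists e1.
have := good_path gK; rewrite ei /= => -[hs ht].
have out1 : outp trivial_diagram = [:: ord0] by rewrite /= -?enumT enum_I1.
have inn1 : innp trivial_diagram = [:: ord0] by rewrite /= -?enumT enum_I1.
have le1 : lab e1 = Le by move: lK; rewrite ei => -[].
exists id, id, id, (fun _ => innv K), (fun _ => e1), (@of_void _).
split; [split|split]; [split|split|split|split|split|split]; try by [].
- by move=> x y _; rewrite (ord1 x) (ord1 y).
- by move=> x y _; rewrite (ord1 x) (ord1 y).
- by move=> v; left; exists v.
- by move=> v; left; exists v.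
- by move=> v; left; exists v.
- move=> v w; rewrite ei out1 /= (ord1 w) inE -hs.
  by split=> [->|/eqP[]].
- move=> v w; rewrite ei out1 /= (ord1 w) inE.
  by split=> [->|/eqP[]].
- move=> e; rewrite (ord1 e) le1 -hs ht; split=> //.
- by move=> c; rewrite !map_id.
- by rewrite map_id.
- by rewrite ei inn1.
Qed.

(** The construction of [L] is repeated on the inner path of [K]: the initial cycle of [L] is glued
    to the single inner edge of [K], and each later rotation or cell is copied. *)
Lemma glued_exists K L : annular ef_rels [:: Le] K -> built L ->
  exists M, built M /\ glued K L M.
Proof.
move=> aK; elim=> {L} [x w [<- <-]|i L _ [M [bM h]]|L p q r s bL [M [bM h]] epq er hrs].
- by exists K; split; [case: aK|apply: glued_trivial].
- by exists (rot_inner i M); split; [apply: built_rot|apply: glued_rot].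
have [p' [q' [e1 e2 h']]] := glued_attach s epq h.
exists (attach p' q' s); split=> //.
by apply: built_attach bM e1 _ hrs; rewrite e2.
Qed.

Lemma glued_labels K L M : glued K L M -> labels M = labels L.
Proof.
move=> [fV [fE [fC [gV [gE [gC [_ [[_ hg _ _] [_ [hi _]]]]]]]]]].
rewrite /labels hi -map_comp; apply: eq_map => e /=.
by have [_ _ ->] := hg e.
Qed.

Lemma built_outp K : built K -> exists e, outp K = [:: e].
Proof.
elim=> {K} [x w [_ <-]|//|K p q r s _ [e he] _ _ _]; last by exists (inl e); rewrite /= he.
by exists ord0; rewrite /= -?enumT enum_I1.
Qed.

Variable R : realType.

(** A valuation of [M] restricts to one of [K], so the edge along which the diagrams are glued has
    value [psi]. On [L] it is then [psi] composed with the valuation of [L], and the inner edge gets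
    [psi \o psi'], the inverse of [g] followed by [h]. *)
Lemma glued_map K L M (g h : circle R -> circle R) : annular ef_rels [:: Le] K ->
  built L -> built M -> glued K L M -> diagram_map K g -> diagram_map L h ->
  diagram_map M (lr_comp g h).
Proof.
move=> aK bL bM; have sK := annular_size aK; have [bK _] := aK.
move=> [fV [fE [fC [gV [gE [gC [[_ _ _ [_ eE _]] [[_ _ htf htg] [[ho _] [hi _]]]]]]]]]].
move=> [psi [hpsi c1 c2]] [psi' [[phi0 [h0 ho0 hi0]] c1' c2']].
have [phi [hphi hout]] := valuation_exists R bM.
have pull N (gE' : cE N -> cE M) (gC' : cC N -> cC M) :
    (forall c, top (gC' c) = map gE' (top c) /\ bot (gC' c) = map gE' (bot c)) ->
    valuation (phi \o gE').
  move=> ht c; have [h1 h2] := hphi (gC' c); have [e1 e2] := ht c.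
  by split=> a b1 b2 et eb; [apply: h1|apply: h2]; rewrite ?e1 ?e2 ?et ?eb.
have hK : inner_valuation K (map (phi \o fE) (innp K)).
  exists (phi \o fE); split=> //; first exact: pull htf.
  by move=> e he; apply: hout; rewrite ho map_f.
have [ei eiK] : exists e, innp K = [:: e] by move: sK; case: (innp K) => [|e []] //; exists e.
have [eo eoL] := built_outp bL.
have epsi : phi (fE ei) = psi.
  by have := inner_valuation_unique bK hK hpsi; rewrite eiK => -[].
have eglue : fE ei = gE eo by apply/eE; rewrite eiK eoL mem_head.
have eL : forall e, (phi \o gE) e = psi \o phi0 e.
  apply: (valuation_unique bL); first exact: pull htg.
    move=> c; have [h1 h2] := h0 c.
    split=> a b1 b2 e1 e2 t.
      by have [e3 e4] := h1 _ _ _ e1 e2 t; rewrite /= e3 e4.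
    by have [e3 e4] := h2 _ _ _ e1 e2 t; rewrite /= e3 e4.
  by move=> e he; rewrite (ho0 _ he); move: he; rewrite eoL inE => /eqP-> /=; rewrite -eglue epsi.
exists (psi \o psi'); split.
- exists phi; split=> //; rewrite hi -map_comp (eq_map eL).
  by rewrite (map_comp (fun f => psi \o f)) hi0.
- by move=> t; rewrite /lr_comp /= c1 c1'.
- by move=> t; rewrite /lr_comp /= c2' c2.
Qed.

End Gluing.

(** * The isomorphism with the annular diagram group *)

Section DiagramGroup.
Variable R : realType.
Local Notation adiag := (adiag ef_rels [:: Le]).
Local Notation built := (built ef_rels [:: Le]).

(** Inner labels are invariant under moves, so a chain of moves between built complexes that starts
    at an annular diagram stays among annular diagrams and lifts to [adiag]. *)
Lemma adiag_eq_ceq (D D' : adiag) : adiag_eq D D' <-> ceq (sval D) (sval D').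
Proof.
split.
  elim=> {D D'} [D D' h|D|D D' _|D D' D'' _ h _].
  - by apply: rst_step; split=> //; [case: (svalP D)|case: (svalP D')].
  - exact: ceq_refl.
  - exact: ceq_sym.
  - exact: ceq_trans h.
have lift K L : ceq K L ->
    (forall aK : annular ef_rels [:: Le] K, exists aL : annular ef_rels [:: Le] L,
       adiag_eq (exist _ K aK) (exist _ L aL)) /\
    (forall aL : annular ef_rels [:: Le] L, exists aK : annular ef_rels [:: Le] K,
       adiag_eq (exist _ K aK) (exist _ L aL)).
  elim=> {K L} [K L m|K|K L _ [h1 h2]|K L M _ [h1 h2] _ [h3 h4]].
  - have e := move_labels m; case: m => bK bL h; split=> [aK|aL].
      have [_ l] := aK; have aL : annular ef_rels [:: Le] L by split=> //; rewrite -/(labels L) -e.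
      by exists aL; apply: rst_step.
    have [_ l] := aL.
    have aK : annular ef_rels [:: Le] K by split=> //; rewrite -/(labels K) e.
    by exists aK; apply: rst_step.
  - by split=> aK; exists aK; apply: rst_refl.
  - split=> [aL|aK]; first by have [aK h] := h2 aL; exists aK; apply: rst_sym.
    by have [aL h] := h1 aK; exists aL; apply: rst_sym.
  - split=> [aK|aM].
      have [aL hKL] := h1 aK; have [aM hLM] := h3 aL; exists aM; exact: rst_trans hKL hLM.
    have [aL hLM] := h4 aM; have [aK hKL] := h2 aL; exists aK; exact: rst_trans hKL hLM.
case: D D' => [K aK] [L aL] /= /lift[/(_ aK)[aL' h] _].
by rewrite (Prop_irrelevance aL aL').
Qed.

Lemma adiag_class (g : circle R -> circle R) : vecT g ->
  exists D : adiag, (fun D' : adiag => diagram_map (sval D') g) = adiag_eq D.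
Proof.
move=> /diagram_of_map[K [aK hK]]; exists (exist _ K aK).
apply: funext => -[L aL]; apply: propext; rewrite adiag_eq_ceq /=; split.
  exact: diagram_map_inj hK.
by move=> e; apply: diagram_map_ceq hK.
Qed.

Definition class_of_map (x : {g | @vecT R g}) : adiag_group ef_rels [:: Le] :=
  exist (fun A : adiag -> Prop => exists D, A = adiag_eq D)
    (fun D : adiag => diagram_map (sval D) (sval x)) (adiag_class (svalP x)).

Lemma class_of_map_bij : bijective class_of_map.
Proof.
have inj : injective class_of_map.
  move=> [g hg] [h hh] /(congr1 sval) /= e; apply: eq_exist => /=.
  have [K [aK hK]] := diagram_of_map hg.
  apply: (diagram_map_fun (proj1 aK) hK).
  by have := congr1 (fun A => A (exist _ K aK)) e => /= <-.
have surj A : exists x, class_of_map x = A.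
  case: A => A [[K aK] eA]; have [g [hg hK]] := diagram_map_exists R aK.
  exists (exist _ g hg); apply: eq_exist => /=; rewrite eA.
  apply: funext => -[L aL]; apply: propext; rewrite adiag_eq_ceq /=; split.
    exact: diagram_map_inj hK.
  by move=> e; apply: diagram_map_ceq hK.
have /boolp.choice[f hf] := surj.
by exists f => [x|A]; [apply: inj; rewrite hf|].
Qed.

(** [adiag_mul] only asks for some representatives. Since a diagram has only one map, any glued
    representatives yield the same product, which gives the converse implication. *)
Lemma vecT_isomorphic :
  isomorphic (@prod_on R (@vecT R)) (@adiag_mul ef ef_rels [:: Le]).
Proof.
exists class_of_map; split; first exact: class_of_map_bij.
move=> x y z; split=> [e|[D1 [D2 [D3 [h1 h2 h3 hg]]]]].
  have [K [aK hK]] := diagram_of_map (svalP x); have [L [aL hL]] := diagram_of_map (svalP y).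
  have [M [bM hM]] := glued_exists aK (proj1 aL).
  have aM : annular ef_rels [:: Le] M.
    by split=> //; rewrite -/(labels M) (glued_labels hM); apply: annular_labels.
  exists (exist _ K aK), (exist _ L aL), (exist _ M aM); split=> //=.
  by rewrite e; apply: glued_map hM hK hL => //; case: aL.
case: D1 D2 D3 h1 h2 h3 hg => [K aK] [L [bL lL]] [M [bM lM]] /= h1 h2 h3 hg.
by apply: (diagram_map_fun bM h3); apply: glued_map hg h1 h2.
Qed.

End DiagramGroup.

Theorem proposition22 (R : realType) :
  [/\ closureC (vecT_gens R) = @vecT R,
      (forall ys : seq (circle R -> circle R),
         generated ys = @vecT R -> closureC ys = @vecT R) &
      isomorphic (@prod_on R (@vecT R)) (@adiag_mul ef ef_rels [:: Le])].
Proof.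
split; [exact: closureC_vecT_gens|exact: closureC_generators|exact: vecT_isomorphic].
Qed.
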